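(* Let $n\ge 2$, let $P\subset\mathbb{R}^n$ be an $n$-dimensional polytope, and let $P_N=[X_1,\dots,X_N]$ be the convex hull of $N$ independent random points distributed uniformly on the boundary $\partial P$. Then, as $N\to\infty$, the expected number of facets of $P_N$ satisfies $$\mathbb{E} f_{n-1}(P_N)\ \ge\ c_{n-1,n-2}\,\operatorname{flag}(P)\,(\ln N)^{n-2}(1+o(1)),$$ where $c_{n-1,n-2}$ is the constant (independent of $P$) defined in the context.
   Context: $f_\ell(Q)$ is the number of $\ell$-dimensional faces of a polytope $Q$. A flag of an $n$-dimensional polytope $P$ is a sequence $F_0\subset F_1\subset\dots\subset F_{n-1}$ of faces of $P$ with $\dim F_i=i$; $\operatorname{flag}(P)$ is the number of flags of $P$. Uniformly distributed on $\partial P$ means with respect to normalized $(n-1)$-dimensional Hausdorff measure on $\partial P$. Definition of $c_{d,\ell}$: by known results (Bárány–Buchta, Reitzner), for every $d\geq 1$ and $\ell\in\{0,\dots,d-1\}$ there is a constant $c_{d,\ell}$, depending only on $d$ and $\ell$, such that for every $d$-dimensional polytope $Q\subset\mathbb{R}^d$ the convex hull $Q_N$ of $N$ independent points distributed uniformly in $Q$ (i.e. with respect to normalized $d$-dimensional Lebesgue measure on $Q$) satisfies $\mathbb{E} f_\ell(Q_N)=c_{d,\ell}\operatorname{flag}(Q)(\ln N)^{d-1}(1+o(1))$ as $N\to\infty$. This known fact may be taken as given. *)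

(* Defs.v *)
From HB Require Import structures.
From mathcomp Require Import all_boot all_order all_algebra.
From mathcomp Require Import finmap.
From mathcomp Require Import all_classical all_reals all_analysis.

Set Implicit Arguments.
Unset Strict Implicit.
Unset Printing Implicit Defensive.

Import Order.TTheory GRing.Theory Num.Theory.
Import numFieldNormedType.Exports.

Local Open Scope classical_set_scope.
Local Open Scope ring_scope.

Section polytopes.
Context {R : realType} {n : nat}.
Implicit Types (A P Q F : set 'rV[R]_n) (u x y : 'rV[R]_n).

Definition dotv u x : R := (u *m x^T) 0 0.

Definition conv_hull A : set 'rV[R]_n := smallest (@convex_set R 'rV[R]_n) A.

Definition aff_hull A : set 'rV[R]_n :=
  [set x | exists (m : nat) (a : 'I_m -> R) (p : 'I_m -> 'rV[R]_n),
    [/\ forall i, A (p i), \sum_(i < m) a i = 1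
      & x = \sum_(i < m) a i *: p i]].

(* No [k] satisfies [has_dim set0 k], since [aff_hull set0] is empty. *)
Definition has_dim A (k : nat) : Prop :=
  exists x0 (U : {vspace 'rV[R]_n}),
    aff_hull A = [set x0 + v | v in [set v | v \in U]] /\ (\dim U)%VS = k.

Definition is_polytope P : Prop := exists s : seq 'rV[R]_n, P = conv_hull [set` s].

(* [u = 0] is allowed, so [Q] and [set0] are faces of [Q]. *)
Definition is_face Q F : Prop :=
  exists u (alpha : R), (forall x, Q x -> dotv u x <= alpha) /\
    F = Q `&` [set x | dotv u x = alpha].

Definition nfaces (l : nat) Q : nat :=
  #|` fset_set [set F | is_face Q F /\ has_dim F l]|%N.

(* Dimensions run up to n - 1, n the dimension of the ambient space: these are
   the flags of P when P is full-dimensional. *)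
Definition is_flag P (F : {ffun 'I_n -> set 'rV[R]_n}) : Prop :=
  (forall i, is_face P (F i) /\ has_dim (F i) i) /\
  (forall i j : 'I_n, (i < j)%N -> F i `<` F j).

Definition nflags P : nat := #|` fset_set [set F | is_flag P F]|%N.

Definition boundary A : set 'rV[R]_n := closure A `\` A°.

End polytopes.

Section measures.
Context {R : realType} {n : nat}.
Implicit Types (A U : set 'rV[R]_n).
Local Open Scope ereal_scope.

(* The norm that ['rV[R]_n] carries in the library is the maximum norm, which
   yields another Hausdorff measure; hence the explicit Euclidean norm. *)
Definition enorm (x : 'rV[R]_n) : R := Num.sqrt (dotv x x).

Definition ediam A : \bar R :=
  maxe 0 (ereal_sup [set r | exists x y, [/\ A x, A y & r = (enorm (x - y)%R)%:E]]).

Definition hausdorff_gauge (s : nat) U : \bar R :=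
  if U == set0 then 0 else ediam U ^+ s.

Definition hausdorff_pre (s : nat) (delta : R) A : \bar R :=
  ereal_inf [set r | exists U : nat -> set 'rV[R]_n,
    [/\ A `<=` \bigcup_i U i, forall i, ediam (U i) <= delta%:E
      & r = \sum_(0 <= i <oo) hausdorff_gauge s (U i)]].

(* Without the constant that makes it agree with Lebesgue measure when s = n:
   only ratios of values of [hausdorff s] are used below. *)
Definition hausdorff (s : nat) A : \bar R :=
  ereal_sup [set hausdorff_pre s delta A | delta in [set delta | (0 < delta)%R]].

Definition box (a b : 'rV[R]_n) : set 'rV[R]_n :=
  [set x | forall j, (a 0 j <= x 0 j <= b 0 j)%R].

(* n-dimensional Lebesgue (outer) measure on R^n. *)
Definition lebesgue_rV A : \bar R :=
  ereal_inf [set r | exists a b : nat -> 'rV[R]_n,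
    [/\ forall i j, (a i 0 j <= b i 0 j)%R, A `<=` \bigcup_i box (a i) (b i)
      & r = \sum_(0 <= i <oo) (\prod_(j < n) (b i 0 j - a i 0 j)%R)%:E]].

End measures.

Definition borel_rV (R : realType) (n : nat) :=
  g_sigma_algebraType (@open 'rV[R]_n).

Section random_polytopes.
Context {R : realType} {n : nat}.
Local Open Scope ereal_scope.

Definition uniform_on (mu : set 'rV[R]_n -> \bar R) (A : set 'rV[R]_n)
    d (T : measurableType d) (Pr : probability T R)
    (X : {RV Pr >-> borel_rV R n}) : Prop :=
  forall B : set (borel_rV R n), measurable B ->
    distribution Pr X B = mu (A `&` B) / mu A.

(* For a finite family, the product rule over all subfamilies is the case
   [B i = setT] outside the subfamily. *)
Definition independent_rv d (T : measurableType d) (Pr : probability T R)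
    (N : nat) (X : 'I_N -> {RV Pr >-> borel_rV R n}) : Prop :=
  forall B : 'I_N -> set (borel_rV R n), (forall i, measurable (B i)) ->
    Pr (\bigcap_i (X i @^-1` B i)) = \big[*%E/1]_(i < N) Pr (X i @^-1` B i).

Definition iid_uniform (mu : set 'rV[R]_n -> \bar R) (A : set 'rV[R]_n)
    d (T : measurableType d) (Pr : probability T R)
    (N : nat) (X : 'I_N -> {RV Pr >-> borel_rV R n}) : Prop :=
  independent_rv X /\ forall i, uniform_on mu A (X i).

Definition random_hull d (T : measurableType d) (Pr : probability T R)
    (N : nat) (X : 'I_N -> {RV Pr >-> borel_rV R n}) (w : T) : set 'rV[R]_n :=
  conv_hull (range (fun i => X i w : 'rV[R]_n)).

Definition expected_nfaces d (T : measurableType d) (Pr : probability T R)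
    (N : nat) (X : 'I_N -> {RV Pr >-> borel_rV R n}) (l : nat) : \bar R :=
  'E_Pr[fun w => (nfaces l (random_hull X w))%:R].

End random_polytopes.

(* [c d l] is the constant c_{d,l} of the asymptotic formula
   E f_l(Q_N) = c_{d,l} flag(Q) (ln N)^(d-1) (1 + o(1)).
   Every number [N] of points may have its own probability space. *)
Definition face_constants (R : realType) (c : nat -> nat -> R) : Prop :=
  forall d l : nat, (1 <= d)%N -> (l < d)%N ->
  forall Q : set 'rV[R]_d, is_polytope Q -> has_dim Q d ->
  forall (disp : nat -> measure_display)
    (T : forall N, measurableType (disp N))
    (Pr : forall N, probability (T N) R)
    (X : forall N, 'I_N -> {RV (Pr N) >-> borel_rV R d}),
  (forall N, iid_uniform lebesgue_rV Q (X N)) ->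
  exists eps : nat -> R, (eps N @[N --> \oo] --> (0 : R)) /\
    \forall N \near \oo, expected_nfaces (X N) l =
      (c d l * (nflags Q)%:R * ln (N%:R : R) ^+ (d - 1) * (1 + eps N))%:E.

(* Main.v *)
(* Let F be a facet of P.  Given which of the N points lie on F, these points
   are independent and uniform on F, that is, after an affine choice of
   coordinates, on an (n-1)-dimensional polytope Q_F.  If there are m of them,
   their hull has on average about c flag(Q_F) (ln m)^(n-2) facets; and outside
   an event of exponentially small probability m is at least a fixed fraction
   of N, so that ln m is equivalent to ln N.

   Almost surely the points are in general position.  A supporting hyperplane
   of P along F can then be rotated around a facet G of the hull of the points
   of F until it meets another point, which gives a facet of P_N; for n >= 3
   different pairs (F, G) give different facets.  For n = 2 an edge of P_N may
   arise in this way from both of its ends, but then the edges of P_N contained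
   in those of P make up for the loss.  Finally a flag of P is a facet F
   together with a flag of F, so that the flag(Q_F) add up to at least flag(P).

   That the law of a point restricted to F is Lebesgue measure in coordinates
   follows from the behaviour of Hausdorff measure under translations and
   homotheties.  The numbers of faces are not known to be measurable, but their
   integrals are lower integrals, and superadditivity suffices for a lower
   bound. *)

Require Import Defs.
From HB Require Import structures.
From mathcomp Require Import all_boot all_order all_algebra.
From mathcomp Require Import finmap.
From mathcomp Require Import all_classical all_reals all_analysis.
From mathcomp Require Import measurable_realfun.
From mathcomp Require Import ring lra zify.

Import Order.TTheory GRing.Theory Num.Theory.
Import numFieldNormedType.Exports.

Local Open Scope classical_set_scope.
Local Open Scope ring_scope.

Set Implicit Arguments.
Unset Strict Implicit.
Unset Printing Implicit Defensive.

(** * Homogeneous coordinates and dimension *)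

(** [hausdorff] is never shown to be a measure. The law [L] of the single point of the sample with
    [N = 1] is a probability, and [M%:E * L B] is the Hausdorff measure of the part of [B] on the
    boundary; additivity on Borel sets comes from there, and the very existence of a uniform point
    makes the total [M] finite and positive. On a facet [L] is then identified by uniqueness: in a
    chart it is invariant under the translations that stay inside a small cube, and homotheties
    spread the proportionality to Lebesgue measure from the cube to the whole facet. A Lipschitz
    comparison makes the factor positive.

    Conditioning is on the exact set of indices of the points on [F], so that only finitely many
    events of positive probability occur. The obstacle is that the asymptotic formula speaks of one
    sequence of samples, while conditioning yields many samples of each size, on varying spaces; a
    bound uniform in all of them has to be extracted. The sum runs over the facets whose chart image
    has a flag: a flag contains a ridge, hence leads to a second facet of [P], and this gives
    [L F < 1]. *)

Section homogenize.
Context {R : realType} {n : nat}.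
Implicit Types (A : set 'rV[R]_n) (u x y : 'rV[R]_n).

(* Homogeneous coordinates turn affine (in)dependence into linear (in)dependence. *)
Definition hm x : 'rV[R]_(n + 1) := row_mx x 1%:M.

Definition hmx m (e : 'I_m -> 'rV[R]_n) : 'M[R]_(m, n + 1) :=
  \matrix_i hm (e i).

(** The affine functional [dotv u x - a] as a linear functional on homogeneous coordinates:
    hyperplanes become kernels. *)
Definition affine_col u (a : R) : 'cV[R]_(n + 1) := col_mx u^T (- a)%:M.

Lemma dotvE u x : dotv u x = \sum_i u 0 i * x 0 i.
Proof. by rewrite /dotv mxE; apply: eq_bigr => i _; rewrite mxE. Qed.

Lemma hm_affine_col u a x : hm x *m affine_col u a = (dotv u x - a)%:M.
Proof.
rewrite mul_row_col mul1mx; apply/matrixP => i j; rewrite !ord1 !mxE eqxx /= !mulr1n.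
by congr (_ - _); rewrite dotvE; apply: eq_bigr => k _; rewrite mxE mulrC.
Qed.

Lemma hm_affine_col0 u a x : (hm x *m affine_col u a == 0) = (dotv u x == a).
Proof.
rewrite hm_affine_col -[RHS]subr_eq0; apply/eqP/eqP => [/matrixP/(_ 0 0)|->].
  by rewrite !mxE eqxx mulr1n.
by rewrite raddf0.
Qed.

Lemma affine_col_neq0 u a x : dotv u x != a -> affine_col u a != 0.
Proof. by rewrite -hm_affine_col0; apply: contraNneq => ->; rewrite mulmx0. Qed.

(** The last homogeneous coordinate is 1, so a linear relation between lifted points carries the
    condition on the sum of the coefficients. *)
Lemma hm_comb m (c : 'I_m -> R) (p : 'I_m -> 'rV[R]_n) x :
  hm x = \sum_i c i *: hm (p i) <->
  \sum_i c i = 1 /\ x = \sum_i c i *: p i.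
Proof.
have -> : \sum_i c i *: hm (p i) =
    row_mx (\sum_i c i *: p i) (\sum_i c i)%:M.
  apply/rowP => j; rewrite summxE mxE; under eq_bigr do rewrite !mxE.
  case: fintype.split => k; first by (rewrite summxE; apply: eq_bigr => i _; rewrite mxE).
  rewrite (ord1 k) !mxE eqxx mulr1n; apply: eq_bigr => i _.
  by rewrite mulr1.
split=> [/eq_row_mx[-> /matrixP/(_ 0 0)]|[-> <-//]].
by rewrite !mxE eqxx !mulr1n.
Qed.

Lemma row_hmx m (e : 'I_m -> 'rV[R]_n) i : row i (hmx e) = hm (e i).
Proof. exact: rowK. Qed.

Lemma sub_hmxP m (e : 'I_m -> 'rV[R]_n) x :
  (hm x <= hmx e)%MS <->
  exists c : 'I_m -> R, \sum_i c i = 1 /\ x = \sum_i c i *: e i.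
Proof.
split=> [/submxP[D hx]|[c /hm_comb hx]].
  exists (D 0); apply/hm_comb; rewrite hx mulmx_sum_row.
  by apply: eq_bigr => i _; rewrite rowK.
apply/submxP; exists (\row_i c i); rewrite hx mulmx_sum_row.
by apply: eq_bigr => i _; rewrite rowK mxE.
Qed.

Lemma row_free_hmx_le m (e : 'I_m -> 'rV[R]_n) : row_free (hmx e) -> (m <= n.+1)%N.
Proof. by move=> fe; have := rank_leq_col (hmx e); rewrite (eqP fe) addn1. Qed.

Lemma hmx_sub m k (e : 'I_m -> 'rV[R]_n) (B : 'M[R]_(k, n + 1)) :
  (forall i, (hm (e i) <= B)%MS) -> (hmx e <= B)%MS.
Proof. by move=> eB; apply/row_subP => i; rewrite rowK. Qed.

Lemma hm_sub_hmx m (e : 'I_m -> 'rV[R]_n) i : (hm (e i) <= hmx e)%MS.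
Proof. by rewrite -[hm _](rowK (fun i => hm (e i))) row_sub. Qed.

Definition rcons_fam m (e : 'I_m -> 'rV[R]_n) x (i : 'I_(m + 1)) : 'rV[R]_n :=
  match fintype.split i with inl j => e j | inr _ => x end.

Lemma hmx_rcons m (e : 'I_m -> 'rV[R]_n) x :
  hmx (rcons_fam e x) = col_mx (hmx e) (hm x).
Proof.
apply/row_matrixP => i; rewrite rowK /rcons_fam.
case: (splitP i) => j ij.
  by have -> : i = lshift 1 j by [apply: val_inj]; rewrite rowKu rowK.
have -> : i = rshift m j by apply: val_inj.
by rewrite rowKd row_id.
Qed.

Lemma row_free_rcons m (e : 'I_m -> 'rV[R]_n) x :
  row_free (hmx e) -> ~~ (hm x <= hmx e)%MS -> row_free (hmx (rcons_fam e x)).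
Proof.
move=> fe xe; rewrite hmx_rcons /row_free eqn_leq rank_leq_row /=.
have : (\rank (hmx e) < \rank (hmx e + hm x)%MS)%N.
  apply: rank_ltmx; rewrite /ltmx addsmxSl /=; apply: contra xe; apply: submx_trans.
  exact: addsmxSr.
by rewrite (eqP fe) addsmxE => lt; apply: leq_trans lt; rewrite addn1.
Qed.

(** An independent family in [A] of maximal length, which exists since lengths are at most [n.+1].
    It is not empty: the span of no rows contains no lifted point. *)
Lemma exists_affine_basis A : A !=set0 ->
  exists m (e : 'I_m.+1 -> 'rV[R]_n),
    [/\ forall i, A (e i), row_free (hmx e) & forall x, A x -> (hm x <= hmx e)%MS].
Proof.
move=> [a Aa].
pose P m := `[< exists e : 'I_m -> 'rV[R]_n,
  (forall i, A (e i)) /\ row_free (hmx e) >].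
have P0 : exists m, P m.
  exists 0%N; apply/asboolP; exists (fun=> a); split; first by case.
  by rewrite /row_free; apply/eqP/eqP; rewrite -leqn0 rank_leq_row.
have Pb m : P m -> (m <= n.+1)%N by move=> /asboolP[e [_ /row_free_hmx_le]].
case: (ex_maxnP P0 Pb) => m /asboolP[e [Ae fe]] mmax.
have full x : A x -> (hm x <= hmx e)%MS.
  move=> Ax; apply: contraT => xe; have := mmax (m + 1)%N.
  rewrite addn1 ltnn -addn1; apply; apply/asboolP.
  exists (rcons_fam e x); split; last exact: row_free_rcons.
  by rewrite /rcons_fam => i; case: fintype.split.
case: m e Ae fe full {mmax} => [|m] e Ae fe full; last by exists m, e.
have := full _ Aa; move=> /sub_hmxP[c [+ _]]; rewrite big_ord0 => /eqP.
by rewrite eq_sym oner_eq0.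
Qed.

Lemma aff_hullE A m (e : 'I_m -> 'rV[R]_n) : (forall i, A (e i)) ->
  (forall x, A x -> (hm x <= hmx e)%MS) ->
  aff_hull A = [set x | (hm x <= hmx e)%MS].
Proof.
move=> Ae full; apply/seteqP; split=> x /=.
  move=> [k [a [p [Ap a1 xE]]]].
  have /hm_comb -> : \sum_i a i = 1 /\ x = \sum_i a i *: p i by [].
  by apply: summx_sub => i _; apply: scalemx_sub; exact: full.
by move=> /sub_hmxP[c [c1 xE]]; exists m, c, e.
Qed.

(** The differences with [e ord0] form a basis of the direction of the affine span. *)
Lemma affine_span_dim k (e : 'I_k.+1 -> 'rV[R]_n) : row_free (hmx e) ->
  exists U : {vspace 'rV[R]_n},
    [set x | (hm x <= hmx e)%MS] = [set e ord0 + v | v in [set v | v \in U]] /\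
    (\dim U)%VS = k.
Proof.
move=> fe; pose X := [tuple e (lift ord0 i) - e ord0 | i < k].
have fX : free X.
  apply/freeP => c; under eq_bigr do rewrite -tnth_nth tnth_mktuple.
  (* The coefficient [- \sum_j c j] at the first point makes the last homogeneous coordinate
     vanish. *)
  move=> c0 i; pose D := \row_(j < k.+1)
    oapp c (- \sum_j c j) (unlift ord0 j).
  have Dz : D 0 ord0 = - \sum_j c j by rewrite mxE unlift_none.
  have Ds j : D 0 (lift ord0 j) = c j by rewrite mxE liftK.
  have D0 : D = 0.
    apply: (row_free_inj fe); rewrite mul0mx mulmx_sum_row big_ord_recl.
    rewrite row_hmx; under eq_bigr do rewrite row_hmx Ds.
    rewrite Dz.
    rewrite scaleNr scaler_suml -sumrN -big_split /=.
    apply/rowP => j; rewrite summxE [RHS]mxE; under eq_bigr do rewrite !mxE.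
    case: fintype.split => l; last by rewrite big1// => m _; rewrite addNr.
    have /rowP/(_ l) := c0; rewrite summxE mxE => c0l; rewrite -[RHS]c0l.
    apply: eq_bigr => m _.
    by rewrite !mxE mulrBr addrC.
  by rewrite -Ds D0 mxE.
exists <<X>>%VS; split; last by rewrite -/(dimv _) (eqP fX) size_tuple.
apply/seteqP; split=> x /=.
  move=> /sub_hmxP[c [c1 xE]]; exists (x - e ord0); last by rewrite addrC subrK.
  have -> : x - e ord0 = \sum_(i < k) c (lift ord0 i) *: X`_i.
    under eq_bigr do rewrite -tnth_nth tnth_mktuple scalerBr.
    rewrite sumrB -scaler_suml xE big_ord_recl.
    rewrite big_ord_recl in c1.
    have -> : \sum_(i < k) c (lift ord0 i) = 1 - c ord0 by rewrite -c1 addrC addKr.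
    by rewrite scalerBl scale1r opprB -addrA addrCA.
  apply: rpred_sum => i _; apply: rpredZ; apply: memv_span.
  by apply: mem_nth; rewrite size_tuple.
move=> [v vU <-]; apply/sub_hmxP.
pose c (i : 'I_k) : R := coord X i v.
pose d (j : 'I_k.+1) := oapp c (1 - \sum_j c j) (unlift ord0 j).
have dz : d ord0 = 1 - \sum_j c j by rewrite /d unlift_none.
have ds j : d (lift ord0 j) = c j by rewrite /d liftK.
exists d; rewrite !big_ord_recl; split.
  by under eq_bigr do rewrite ds; rewrite dz subrK.
have vE : v = \sum_i c i *: (e (lift ord0 i) - e ord0).
  rewrite {1}(@coord_span _ _ _ X v vU); apply: eq_bigr => i _; congr (_ *: _).
  by have := tnth_mktuple (fun i => e (lift ord0 i) - e ord0) i; rewrite (tnth_nth 0).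
have vE' : v = \sum_i c i *: e (lift ord0 i) - (\sum_i c i) *: e ord0.
  by rewrite {1}vE scaler_suml -sumrB; apply: eq_bigr => i _; rewrite scalerBr.
under eq_bigr do rewrite ds; rewrite dz [in LHS]vE' scalerBl scale1r -addrA.
by congr (_ + _); rewrite addrC.
Qed.

(** Replaces the subspace of the definition by an affine basis taken in [A] itself. Conversely to
    building the subspace, two descriptions [x0 + U] and [e ord0 + V] of the same affine hull must
    have the same direction. *)
Lemma has_dimP A k : has_dim A k <-> exists e : 'I_k.+1 -> 'rV[R]_n,
  [/\ forall i, A (e i), row_free (hmx e) & forall x, A x -> (hm x <= hmx e)%MS].
Proof.
split=> [[x0 [U [AU dU]]]|[e [Ae fe full]]]; last first.
  have [U [eU dU]] := affine_span_dim fe.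
  by exists (e ord0), U; split=> //; rewrite (aff_hullE Ae full).
have A0 : A !=set0.
  have : aff_hull A x0 by rewrite AU; exists 0; rewrite ?addr0 //; exact: mem0v.
  move=> [[|m] [a [p [Ap]]]].
    by rewrite big_ord0 => /esym/eqP; rewrite oner_eq0.
  by exists (p ord0).
have [m [e [Ae fe full]]] := exists_affine_basis A0.
have [V [eV dV]] := affine_span_dim fe.
have UV : U = V.
  have /seteqP[UV VU] : [set x0 + v | v in [set v | v \in U]] =
      [set e ord0 + v | v in [set v | v \in V]].
    by rewrite -AU -eV (aff_hullE Ae full).
  have [w wV x0E] : [set e ord0 + v | v in [set v | v \in V]] x0.
    by apply: UV; exists 0; rewrite ?addr0 //; exact: mem0v.
  apply/vspaceP => v; apply/idP/idP => [vU|vV].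
    have [z /= zV] : [set e ord0 + v | v in [set v | v \in V]] (x0 + v).
      by apply: UV; exists v.
    rewrite -x0E -addrA => /addrI zE.
    have -> : v = z - w by rewrite zE addrAC subrr add0r.
    exact: rpredB.
  have [z /= zU] : [set x0 + v | v in [set v | v \in U]] (e ord0 + (w + v)).
    by apply: VU; exists (w + v) => //; exact: rpredD.
  by rewrite addrA x0E => /addrI <-.
by rewrite -dU UV dV; exists e.
Qed.

Lemma row_free_dim_le A k m (e : 'I_m -> 'rV[R]_n) : has_dim A k ->
  (forall i, A (e i)) -> row_free (hmx e) -> (m <= k.+1)%N.
Proof.
move=> /has_dimP[f [_ _ full]] Ae /eqP <-.
apply: leq_trans (rank_leq_row (hmx f)); apply: mxrankS.
by apply: hmx_sub => i; exact: full.
Qed.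

Lemma has_dim_mono A B k l : A `<=` B -> has_dim A k -> has_dim B l -> (k <= l)%N.
Proof.
move=> AB /has_dimP[e [Ae fe _]] Bl.
by have := row_free_dim_le Bl (fun i => AB _ (Ae i)) fe.
Qed.

Lemma has_dim_uniq A k l : has_dim A k -> has_dim A l -> k = l.
Proof. by move=> Ak Al; apply/eqP; rewrite eqn_leq !(has_dim_mono _ Ak Al, has_dim_mono _ Al Ak). Qed.

(** A rank count: the kernel of a nonzero column has rank [n], and it contains [m >= n] independent
    rows, which therefore span it. *)
Lemma hyperplane_sub_hmx m (e : 'I_m -> 'rV[R]_n) u a x : row_free (hmx e) ->
  (n <= m)%N -> affine_col u a != 0 -> (forall i, dotv u (e i) = a) ->
  dotv u x = a -> (hm x <= hmx e)%MS.
Proof.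
move=> fe nm f0 ef xf; set f := affine_col u a in f0.
have ker y : dotv u y = a -> (hm y <= kermx f)%MS.
  by move=> yf; apply/sub_kermxP/eqP; rewrite hm_affine_col0 yf.
have ek : (hmx e <= kermx f)%MS by apply: hmx_sub => i; exact: ker.
apply: submx_trans (ker _ xf) _; rewrite -(geq_leqif (mxrank_leqif_sup ek)).
have : (0 < \rank f)%N by rewrite lt0n mxrank_eq0.
rewrite (eqP fe) mxrank_ker; move: (\rank f) => r r0.
by rewrite leq_subLR addnC leq_add.
Qed.

Lemma not_sub_hmx m (e : 'I_m -> 'rV[R]_n) u a x :
  (forall i, dotv u (e i) = a) -> dotv u x != a -> ~~ (hm x <= hmx e)%MS.
Proof.
move=> ef; rewrite -hm_affine_col0; apply: contra => xe.
apply/eqP/sub_kermxP; apply: submx_trans xe _; apply: hmx_sub => i.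
by apply/sub_kermxP/eqP; rewrite hm_affine_col0 ef.
Qed.

End homogenize.

(** * Convex hulls of finitely many points *)

Lemma card_fset_set_image (I : finType) (V : choiceType) (f : I -> V) (B : {set I}) :
  {in B &, injective f} -> #|` fset_set (f @` [set` B])|%fset = #|B|.
Proof.
move=> fB.
have -> : fset_set (f @` [set` B]) = [fset f x | x in B]%fset.
  apply/fsetP => y; rewrite in_fset_set; last exact/finite_image/finite_finset.
  apply/idP/imfsetP => [/set_mem[x /= xB <-]|[x /= xB ->]]; first by exists x.
  by apply/mem_set; exists x.
by rewrite card_in_imfset //= cardE.
Qed.

Section hull.
Context {R : realType} {n : nat}.
Implicit Types (A : set 'rV[R]_n) (u x y : 'rV[R]_n).

Lemma convex_setP A : @convex_set R 'rV[R]_n A <->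
  forall x y (t : R), 0 <= t -> t <= 1 -> A x -> A y -> A (t *: x + (1 - t) *: y).
Proof.
split=> [cA x y t t0 t1 Ax Ay|cA x y t /set_mem Ax /set_mem Ay]; last first.
  by apply/mem_set; apply: cA.
have t01 : Itv.spec (@Itv.num_sem R) (Itv.Real `[0%Z, 1%Z]) t.
  by rewrite /Itv.spec/= /Itv.num_sem/= in_itv/= t0 t1 ger0_real.
have := cA x y (Itv.mk t01) (mem_set Ax) (mem_set Ay).
by move=> /set_mem.
Qed.

(** Induction on the number of points, renormalising the coefficients after the first. Points with
    coefficient 0 may lie outside [A], so a combination over a subset of indices can be summed over
    all of them. *)
Lemma convex_comb A N (c : 'I_N -> R) (p : 'I_N -> 'rV[R]_n) :
  @convex_set R 'rV[R]_n A -> (forall i, 0 <= c i) -> \sum_i c i = 1 ->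
  (forall i, c i != 0 -> A (p i)) -> A (\sum_i c i *: p i).
Proof.
move=> /convex_setP cA; elim: N c p => [|N IH] c p c0 c1 cp.
  by move: c1; rewrite big_ord0 => /esym/eqP; rewrite oner_eq0.
rewrite big_ord_recl in c1; rewrite big_ord_recl.
have s0 : 0 <= \sum_(i < N) c (lift ord0 i) by apply: sumr_ge0.
have [c01|c01] := eqVneq (c ord0) 1.
  have sz : \sum_(i < N) c (lift ord0 i) = 0.
    by move: c1; rewrite c01 -[RHS]addr0 => /addrI.
  rewrite big1 ?addr0 => [|i _].
    by rewrite c01 scale1r; apply: cp; rewrite c01 oner_eq0.
  move/eqP: sz; rewrite psumr_eq0 // => /allP/(_ i (mem_index_enum _))/eqP ->.
  by rewrite scale0r.
have d0 : 0 < 1 - c ord0.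
  rewrite subr_gt0 lt_neqAle c01 -c1 lerDl.
  exact: s0.
have [c00|c00] := eqVneq (c ord0) 0.
  rewrite c00 scale0r add0r; apply: IH => //; last by move=> i; exact: cp.
  by rewrite -c1 c00 add0r.
have -> : \sum_(i < N) c (lift ord0 i) *: p (lift ord0 i) =
    (1 - c ord0) *: \sum_(i < N) (c (lift ord0 i) / (1 - c ord0)) *: p (lift ord0 i).
  rewrite scaler_sumr; apply: eq_bigr => i _.
  by rewrite scalerA mulrC divfK // gt_eqF.
apply: cA => //; [by rewrite -subr_ge0 ltW|by apply: cp|].
apply: IH => [i||i ci].
- by rewrite divr_ge0 // ltW.
- have sE : \sum_(i < N) c (lift ord0 i) = 1 - c ord0 by rewrite -c1 addrC addKr.
  by rewrite -mulr_suml sE divff // gt_eqF.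
- by apply: cp; apply: contraNneq ci => ->; rewrite mul0r.
Qed.

Lemma dotv_comb u N (c : 'I_N -> R) (p : 'I_N -> 'rV[R]_n) :
  dotv u (\sum_i c i *: p i) = \sum_i c i * dotv u (p i).
Proof.
rewrite dotvE; under eq_bigr do rewrite summxE mulr_sumr.
rewrite exchange_big; apply: eq_bigr => i _ /=; rewrite dotvE mulr_sumr.
by apply: eq_bigr => j _; rewrite mxE mulrCA.
Qed.

Lemma dotvD u x y : dotv u (x + y) = dotv u x + dotv u y.
Proof. by rewrite !dotvE -big_split; apply: eq_bigr => i _; rewrite mxE mulrDr. Qed.

Lemma dotvZ u (t : R) x : dotv u (t *: x) = t * dotv u x.
Proof. by rewrite !dotvE mulr_sumr; apply: eq_bigr => i _; rewrite mxE mulrCA. Qed.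

Lemma dotvDl u v x : dotv (u + v) x = dotv u x + dotv v x.
Proof. by rewrite !dotvE -big_split; apply: eq_bigr => i _; rewrite mxE mulrDl. Qed.

Lemma dotvZl u (t : R) x : dotv (t *: u) x = t * dotv u x.
Proof. by rewrite !dotvE mulr_sumr; apply: eq_bigr => i _; rewrite mxE mulrA. Qed.

Lemma dotvC u x : dotv u x = dotv x u.
Proof. by rewrite !dotvE; apply: eq_bigr => i _; rewrite mulrC. Qed.

Lemma dotv0 x : dotv 0 x = 0.
Proof. by rewrite dotvE big1 // => i _; rewrite mxE mul0r. Qed.

Lemma conv_hull_convex A : @convex_set R 'rV[R]_n (conv_hull A).
Proof.
apply/convex_setP => x y t t0 t1 Ax Ay B [Bc AB].
by move/convex_setP: (Bc); apply => //; [exact: Ax|exact: Ay].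
Qed.

Lemma sub_conv_hull A : A `<=` conv_hull A.
Proof. by move=> x Ax B [_]; apply. Qed.

Lemma conv_hull_sub A B : A `<=` B -> @convex_set R 'rV[R]_n B -> conv_hull A `<=` B.
Proof. by move=> AB Bc x; apply. Qed.

Lemma conv_hull_le A u (a : R) : (forall x, A x -> dotv u x <= a) ->
  forall x, conv_hull A x -> dotv u x <= a.
Proof.
move=> Aa x; apply: (@conv_hull_sub A [set x | dotv u x <= a]) => //.
apply/convex_setP => y z t t0 t1 /= ya za.
rewrite dotvD !dotvZ.
have -> : a = t * a + (1 - t) * a by rewrite -mulrDl addrC subrK mul1r.
by rewrite lerD // ler_wpM2l // subr_ge0.
Qed.

Lemma conv_hull_finP N (p : 'I_N -> 'rV[R]_n) (S : {set 'I_N}) x :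
  conv_hull (p @` [set` S]) x <-> exists c : 'I_N -> R,
    [/\ forall i, 0 <= c i, forall i, i \notin S -> c i = 0, \sum_i c i = 1
      & x = \sum_i c i *: p i].
Proof.
split=> [|[c [c0 cS c1 ->]]]; last first.
  apply: convex_comb => // [|i ci]; first exact: conv_hull_convex.
  apply: sub_conv_hull; exists i => //=.
  by apply: contraNT ci => /cS ->.
apply: (@conv_hull_sub _ [set x | exists c : 'I_N -> R,
    [/\ forall i, 0 <= c i, forall i, i \notin S -> c i = 0, \sum_i c i = 1
      & x = \sum_i c i *: p i]]) => [_ [i /= iS <-]|].
  exists (fun j => (j == i)%:R); split=> [j|j jS||].
  - exact: ler0n.
  - by case: eqP jS => // ->; rewrite iS.
  - by rewrite (bigD1 i)//= eqxx big1 ?addr0 // => j /negbTE ->.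
  - rewrite (bigD1 i)//= eqxx scale1r big1 ?addr0 // => j /negbTE ->.
    by rewrite scale0r.
apply/convex_setP => y z t t0 t1 [c [c0 cS c1 ->]] [d [d0 dS d1 ->]].
exists (fun i => t * c i + (1 - t) * d i); split=> [i|i iS||].
- by rewrite addr_ge0 // mulr_ge0 // subr_ge0.
- by rewrite cS // dS // !mulr0 addr0.
- by rewrite big_split /= -!mulr_sumr c1 d1 !mulr1 addrC subrK.
- rewrite !scaler_sumr -big_split; apply: eq_bigr => i _ /=.
  by rewrite [RHS]scalerDl !scalerA.
Qed.

Definition tight N (p : 'I_N -> 'rV[R]_n) (S : {set 'I_N}) u (a : R) : {set 'I_N} :=
  [set i in S | dotv u (p i) == a].

(** A convex combination attains the maximal value [a] only if every point with nonzero coefficient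
    does. *)
Lemma conv_hull_face N (p : 'I_N -> 'rV[R]_n) (S : {set 'I_N}) u (a : R) :
  (forall i, i \in S -> dotv u (p i) <= a) ->
  conv_hull (p @` [set` S]) `&` [set x | dotv u x = a] =
  conv_hull (p @` [set` tight p S u a]).
Proof.
move=> Sa; apply/seteqP; split=> [x [/conv_hull_finP[c [c0 cS c1 xE]] /= xa]|x].
  apply/conv_hull_finP; exists c; split=> // i iT; have [iS|] := boolP (i \in S); last exact: cS.
  have z : \sum_i c i * (a - dotv u (p i)) = 0.
    under eq_bigr do rewrite mulrBr.
    by rewrite sumrB -mulr_suml c1 mul1r -dotv_comb -xE xa subrr.
  have nn j : true -> 0 <= c j * (a - dotv u (p j)).
    move=> _; have [jS|/cS ->] := boolP (j \in S); last by rewrite mul0r.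
    by rewrite mulr_ge0 // subr_ge0 Sa.
  move/eqP: z; rewrite psumr_eq0 // => /allP/(_ i (mem_index_enum _)) /=.
  rewrite mulf_eq0 subr_eq0 => /orP[/eqP//|/eqP ai].
  by move: iT; rewrite inE iS -ai eqxx.
move=> /conv_hull_finP[c [c0 cS c1 xE]]; split.
  apply/conv_hull_finP; exists c; split=> // i iS; apply: cS.
  by rewrite inE (negbTE iS).
rewrite /= xE dotv_comb -[RHS]mul1r -c1 mulr_suml; apply: eq_bigr => i _.
have [|/cS ->] := boolP (i \in tight p S u a); last by rewrite !mul0r.
by rewrite inE => /andP[_ /eqP ->].
Qed.

(** An affine basis of [A] is one of its hull, because spans are convex; the converse follows from
    uniqueness of the dimension. *)
Lemma has_dim_conv_hull A k : has_dim (conv_hull A) k <-> has_dim A k.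
Proof.
have key m : has_dim A m -> has_dim (conv_hull A) m.
  move=> /has_dimP[e [Ae fe full]]; apply/has_dimP; exists e; split=> // [i|].
    exact: sub_conv_hull.
  apply: (@conv_hull_sub A [set x | (hm x <= hmx e)%MS]) => //.
  apply/convex_setP => x y t _ _ /= xe ye.
  have -> : hm (t *: x + (1 - t) *: y) = t *: hm x + (1 - t) *: hm y.
    rewrite /hm !scale_row_mx add_row_mx; congr row_mx.
    by rewrite -scalerDl addrC subrK scale1r.
  by rewrite addmx_sub // scalemx_sub.
split=> [dA|]; last exact: key.
have A0 : A !=set0.
  apply: contrapT => /set0P/negP/negPn/eqP A0.
  have /has_dimP[e [/(_ ord0) + _ _]] := dA.
  by rewrite A0; apply: (@conv_hull_sub set0 set0) => //; apply/convex_setP.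
have [m [e [Ae fe full]]] := exists_affine_basis A0.
have dm : has_dim A m by apply/has_dimP; exists e.
by rewrite (has_dim_uniq dA (key _ dm)).
Qed.

(** Faces of a hull are encoded by the indices of the given points that they contain, which turns
    face numbers into cardinals of finite sets. The empty face is excluded because it has no
    dimension. *)
Definition facesets N (p : 'I_N -> 'rV[R]_n) (S : {set 'I_N}) (l : nat) : {set {set 'I_N}} :=
  [set J | `[< (exists u a, (forall i, i \in S -> dotv u (p i) <= a) /\ J = tight p S u a) /\
    has_dim (p @` [set` J]) l >]].

Lemma facesetsP N (p : 'I_N -> 'rV[R]_n) (S J : {set 'I_N}) (l : nat) :
  J \in facesets p S l <->
  (exists u a, (forall i, i \in S -> dotv u (p i) <= a) /\ J = tight p S u a) /\
    has_dim (p @` [set` J]) l.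
Proof. by rewrite inE; split=> [/asboolP|?] //; apply/asboolP. Qed.

Lemma is_face_hullP N (p : 'I_N -> 'rV[R]_n) (S : {set 'I_N}) F :
  is_face (conv_hull (p @` [set` S])) F <-> exists u a,
    (forall i, i \in S -> dotv u (p i) <= a) /\
    F = conv_hull (p @` [set` tight p S u a]).
Proof.
split=> [[u [a [Pa ->]]]|[u [a [Sa ->]]]]; exists u, a.
  have Sa i : i \in S -> dotv u (p i) <= a.
    by move=> iS; apply: Pa; apply: sub_conv_hull; exists i.
  by rewrite conv_hull_face.
split; last by rewrite conv_hull_face.
by apply: conv_hull_le => _ [i /= iS <-]; exact: Sa.
Qed.

(** The encoding is injective: an index set is recovered from its hull as the set of indices in [S]
    whose points lie in the hull. *)
Lemma nfacesE N (p : 'I_N -> 'rV[R]_n) (S : {set 'I_N}) (l : nat) :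
  nfaces l (conv_hull (p @` [set` S])) = #|facesets p S l|.
Proof.
pose f (J : {set 'I_N}) := conv_hull (p @` [set` J]).
rewrite /nfaces.
have -> : [set F | is_face (conv_hull (p @` [set` S])) F /\ has_dim F l] =
    f @` [set` facesets p S l].
  apply/seteqP; split=> F /=.
    move=> [/is_face_hullP[u [a [Sa FE]]] dF]; exists (tight p S u a) => //=.
    apply/facesetsP; split; first by exists u, a.
    by apply/has_dim_conv_hull; rewrite -FE.
  move=> [J /facesetsP[[u [a [Sa ->]]] dJ] <-]; split.
    by apply/is_face_hullP; exists u, a.
  exact/has_dim_conv_hull.
apply: card_fset_set_image => J J' /facesetsP[[u [a [Sa JE]]] _].
move=> /facesetsP[[u' [a' [Sa' JE']]] _] fJJ'.
suff fE v b K : (forall i, i \in S -> dotv v (p i) <= b) -> K = tight p S v b ->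
    K = [set i in S | `[< f K (p i) >]].
  by rewrite (fE _ _ _ Sa JE) (fE _ _ _ Sa' JE') fJJ'.
move=> Sb KE; apply/setP => i; rewrite inE; have [iS|iS] /= := boolP (i \in S); last first.
  by rewrite KE inE (negbTE iS).
apply/idP/asboolP => [iK|]; first by apply: sub_conv_hull; exists i.
by rewrite /f KE -conv_hull_face // => -[_ /= /eqP]; rewrite inE iS.
Qed.

End hull.

(** * Affine maps and rotation of supporting hyperplanes *)

Lemma has_dim_intro (R : realType) n (A : set 'rV[R]_n) k m (e : 'I_m -> 'rV[R]_n) :
  m = k.+1 -> (forall i, A (e i)) -> row_free (hmx e) ->
  (forall x, A x -> (hm x <= hmx e)%MS) -> has_dim A k.
Proof. by move=> mk; subst m => Ae fe full; apply/has_dimP; exists e. Qed.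

Lemma hmx_inj (R : realType) n m (e : 'I_m -> 'rV[R]_n) : row_free (hmx e) -> injective e.
Proof.
move=> fe i j eij; apply/eqP; apply: contraT => ij.
have : delta_mx 0 i = delta_mx 0 j :> 'rV[R]_m.
  by apply: (row_free_inj fe); rewrite -!rowE !row_hmx eij.
move=> /rowP/(_ i); rewrite !mxE !eqxx (negbTE ij) /= => /eqP.
by rewrite oner_eq0.
Qed.

Section affine_map.
Context {R : realType} {n d : nat}.

Definition affine_map (C : 'M[R]_(n, d)) (b : 'rV[R]_d) (x : 'rV[R]_n) : 'rV[R]_d :=
  x *m C + b.

Definition affine_mx (C : 'M[R]_(n, d)) (b : 'rV[R]_d) : 'M[R]_(n + 1, d + 1) :=
  block_mx C 0 b 1%:M.

Lemma hm_affine_map C b x : hm (affine_map C b x) = hm x *m affine_mx C b.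
Proof. by rewrite /hm mul_row_block mul1mx mulmx0 add0r mul1mx. Qed.

Lemma hmx_affine_map C b m (e : 'I_m -> 'rV[R]_n) :
  hmx (affine_map C b \o e) = hmx e *m affine_mx C b.
Proof. by apply/row_matrixP => i; rewrite row_mul !row_hmx /= hm_affine_map. Qed.

Lemma row_free_affine_map C b m (e : 'I_m -> 'rV[R]_n) :
  row_free (hmx (affine_map C b \o e)) -> row_free (hmx e).
Proof.
rewrite hmx_affine_map /row_free => /eqP fe.
by rewrite eqn_leq rank_leq_row -[X in (X <= _)%N]fe mxrankM_maxl.
Qed.

Lemma dotv_affine_map C b v x :
  dotv v (affine_map C b x) = dotv (v *m C^T) x + dotv v b.
Proof. by rewrite dotvD; congr (_ + _); rewrite /dotv trmx_mul mulmxA. Qed.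

End affine_map.

Section rotation.
Context {R : realType} {n N : nat}.
Variable x : 'I_N -> 'rV[R]_n.

(* Rotating the hyperplane [u = a] around the face [G] of the tight points until
   it hits a new point: among the functionals [v + t u] take the smallest
   admissible [t]. *)
Lemma rotate_hyperplane (J G : {set 'I_N}) u (a : R) v (b : R) :
  (forall i, dotv u (x i) <= a) -> J = tight x [set: 'I_N] u a ->
  (forall i, i \in J -> dotv v (x i) <= b) -> G = tight x J v b ->
  (exists j, j \notin J) ->
  exists w c, [/\ forall i, dotv w (x i) <= c,
    tight x [set: 'I_N] w c :&: J = G
    & exists2 j, j \in tight x [set: 'I_N] w c & j \notin J].
Proof.
move=> ua JE vb GE [j0 j0J].
have JP i : (i \in J) = (dotv u (x i) == a) by rewrite JE !inE.
have gap i : i \notin J -> 0 < a - dotv u (x i).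
  by rewrite JP => iJ; rewrite subr_gt0 lt_neqAle iJ ua.
pose r i := (dotv v (x i) - b) / (a - dotv u (x i)).
case: (@Order.TotalTheory.arg_maxP _ _ _ j0 (fun i => i \notin J) r j0J) => j jJ jmax.
pose t := r j; pose w := v + t *: u; pose c := b + t * a.
have wE i : dotv w (x i) - c = (dotv v (x i) - b) - t * (a - dotv u (x i)).
  by rewrite dotvDl dotvZl /c; ring.
have wJ i : i \in J -> dotv w (x i) - c = dotv v (x i) - b.
  by rewrite wE JP => /eqP ->; rewrite subrr mulr0 subr0.
have wc i : dotv w (x i) <= c.
  rewrite -subr_le0; have [iJ|iJ] := boolP (i \in J); first by rewrite wJ // subr_le0 vb.
  rewrite wE subr_le0 -ler_pdivrMr ?gap //.
  exact: jmax.
exists w, c; split=> //.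
  apply/setP => i; rewrite GE !inE andbC; have [iJ|//] := boolP (i \in J).
  by rewrite /= -subr_eq0 wJ // subr_eq0.
exists j => //; rewrite !inE -subr_eq0 wE /t /r divfK ?subrr ?eqxx //.
by rewrite gt_eqF // gap.
Qed.

End rotation.

Section ridge.
Context {R : realType} {k N : nat}.
Variable x : 'I_N -> 'rV[R]_k.+2.

(** The [k.+1] independent points of the ridge and a new point off the hyperplane [u = a] are [k.+2]
    independent points of the rotated hyperplane, so the new face is a facet. A point of [J] outside
    [G] guarantees that the rotated functional is not constantly tight. *)
Lemma facet_of_ridge (J G : {set 'I_N}) u (a : R) v (b : R) (g : 'I_k.+1 -> 'I_N) :
  (forall i, dotv u (x i) <= a) -> J = tight x [set: 'I_N] u a ->
  (forall i, i \in J -> dotv v (x i) <= b) -> G = tight x J v b ->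
  (forall i, g i \in G) -> row_free (hmx (x \o g)) ->
  (exists j, j \notin J) -> (exists2 i, i \in J & i \notin G) ->
  exists2 E, E \in facesets x [set: 'I_N] k.+1 & E :&: J = G /\ exists2 j, j \in E & j \notin J.
Proof.
move=> ua JE vb GE gG fg Jn [i0 i0J i0G].
have [w [c [wc EJ [j jE jJ]]]] := rotate_hyperplane ua JE vb GE Jn.
set E := tight x _ w c in EJ jE.
have gE i : g i \in E by have := gG i; rewrite -EJ inE => /andP[].
have gJ i : g i \in J by have := gG i; rewrite -EJ inE => /andP[].
exists E; last by split=> //; exists j.
have fe : row_free (hmx (rcons_fam (x \o g) (x j))).
  apply: row_free_rcons => //; apply: (@not_sub_hmx _ _ _ _ u a) => [i /=|].
    by have := gJ i; rewrite JE !inE => /eqP.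
  by move: jJ; rewrite JE !inE.
have w0 : affine_col w c != 0.
  apply: (@affine_col_neq0 _ _ _ _ (x i0)); apply: contra i0G => i0E.
  by rewrite -EJ !inE i0E i0J.
have eE i : exists2 h, h \in E & rcons_fam (x \o g) (x j) i = x h.
  by rewrite /rcons_fam; case: fintype.split => h; [exists (g h)|exists j].
apply/facesetsP; split; first by exists w, c; split=> // i _; exact: wc.
apply: (@has_dim_intro _ _ _ _ _ (rcons_fam (x \o g) (x j))) => //.
- by rewrite addn1.
- by move=> i; have [h hE ->] := eE i; exists h.
- move=> _ [h /= hE <-]; apply: hyperplane_sub_hmx w0 _ _ => //.
  + by rewrite addn1.
  + by move=> i; have [l + ->] := eE i; rewrite !inE => /eqP.
  + by move: hE; rewrite !inE => /eqP.
Qed.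

End ridge.

(** * Facets of the hull of points in general position *)

Lemma has_dim_full (R : realType) n (A : set 'rV[R]_n) k m (e : 'I_m -> 'rV[R]_n) :
  has_dim A k -> m = k.+1 -> (forall i, A (e i)) -> row_free (hmx e) ->
  forall x, A x -> (hm x <= hmx e)%MS.
Proof.
move=> /has_dimP[f [_ _ full]] mk Ae fe x Ax; subst m.
have ef : (hmx e <= hmx f)%MS by apply: hmx_sub => i; exact: full.
apply: submx_trans (full _ Ax) _; rewrite -(geq_leqif (mxrank_leqif_sup ef)).
by rewrite (eqP fe) rank_leq_row.
Qed.

Definition rcons_idx N m (g : 'I_m -> 'I_N) (y : 'I_N) (i : 'I_(m + 1)) : 'I_N :=
  match fintype.split i with inl j => g j | inr _ => y end.

Lemma hmx_rcons_idx (R : realType) n N m (x : 'I_N -> 'rV[R]_n) (g : 'I_m -> 'I_N) y :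
  hmx (x \o rcons_idx g y) = hmx (rcons_fam (x \o g) (x y)).
Proof.
apply/row_matrixP => i; rewrite !row_hmx /= /rcons_idx /rcons_fam.
by case: fintype.split.
Qed.

Lemma subset_enum_inj (T : finType) (J : {set T}) m : (m <= #|J|)%N ->
  exists2 i : 'I_m -> T, injective i & forall l, i l \in J.
Proof.
move=> mJ; exists (fun l => enum_val (widen_ord mJ l)); last by move=> l; exact: enum_valP.
by move=> l l' /enum_val_inj /(congr1 val) /= ll'; apply: val_inj.
Qed.

(** On a line the sign of [v 0 0] decides whether the face consists of all maximal or of all minimal
    points. The sign 0 would make the whole of [S] a single point. The equation [k = 0%N] lets the
    lemma be applied where [k] is a section variable. *)
Lemma vertices_segment (R : realType) N k (y : 'I_N -> 'rV[R]_k.+1) (S : {set 'I_N}) :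
  k = 0%N -> (exists i j, [/\ i \in S, j \in S & y i != y j]) ->
  (#|facesets y S k| <= 2)%N.
Proof.
move=> k0; subst k => -[i [j [iS jS yij]]].
pose top := [set i in S | [forall j in S, y j 0 0 <= y i 0 0]]%SET.
pose bot := [set i in S | [forall j in S, y i 0 0 <= y j 0 0]]%SET.
have dE v l : dotv v (y l) = v 0 0 * y l 0 0 by rewrite dotvE big_ord1.
suff : {subset facesets y S 0 <= [set top; bot]%SET}.
  move=> sub; apply: leq_trans (subset_leq_card (introT fintype.subsetP sub)) _.
  by rewrite cards2; case: (_ != _).
move=> A /facesetsP[[v [c [vc AE]]] /has_dimP[e [eA _ full]]].
have AP l : (l \in A) = (l \in S) && (v 0 0 * y l 0 0 == c) by rewrite AE inE dE.
have {}vc l : l \in S -> v 0 0 * y l 0 0 <= c by rewrite -dE; exact: vc.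
have ye l : l \in A -> y l = e ord0.
  move=> lA; have /sub_hmxP[d [+ ->]] : (hm (y l) <= hmx e)%MS by apply: full; exists l.
  by rewrite !big_ord1 => ->; rewrite scale1r.
have [m mA _] := eA ord0; have := mA; rewrite /= AP => /andP[mS /eqP mc].
rewrite !inE; have [v0|v0|v0] := ltgtP (v 0 0) 0.
- apply/orP; right; apply/eqP/setP => l; rewrite AP inE; apply: andb_id2l => lS.
  apply/eqP/'forall_implyP => [lc h hS|/(_ m mS) lm].
    by rewrite -(ler_nM2l v0) lc vc.
  apply/eqP; rewrite eq_le vc //= -mc (ler_nM2l v0) //.
- apply/orP; left; apply/eqP/setP => l; rewrite AP inE; apply: andb_id2l => lS.
  apply/eqP/'forall_implyP => [lc h hS|/(_ m mS) lm].
    by rewrite -(ler_pM2l v0) lc vc.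
  apply/eqP; rewrite eq_le vc //= -mc (ler_pM2l v0) //.
- have AS l : l \in S -> l \in A by move=> lS; rewrite AP lS -mc v0 !mul0r /=.
  by case/eqP: yij; rewrite !ye ?AS.
Qed.

Section pointwise.
Context {R : realType} {k N : nat} {Fc : finType}.
Variables (x : 'I_N -> 'rV[R]_k.+2) (u : Fc -> 'rV[R]_k.+2) (a : Fc -> R).
Variables (C : Fc -> 'M[R]_(k.+2, k.+1)) (b : Fc -> 'rV[R]_k.+1).

Let psi F := affine_map (C F) (b F).
Let J F := tight x [set: 'I_N] (u F) (a F).

(** The conditions on the sample used by the counting. The points lie on the inner side of every
    facet hyperplane; none lies on two of them; [k.+2] points on one facet form a simplex in its
    chart, where its faces are counted; and a point on [F] avoids the affine span of [k.+2]
    independent other points, unless these all lie on [F]. The last clause keeps a facet of the hull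
    from meeting too many facets of the polytope. Its [m] is separate from [k.+2] to admit index
    types such as ['I_(k.+1 + 1)]. *)
Definition general_position : Prop :=
  [/\ forall F i, dotv (u F) (x i) <= a F,
      forall F F' i, F != F' -> i \in J F -> i \notin J F',
      forall F (i : 'I_k.+2 -> 'I_N), injective i -> (forall l, i l \in J F) ->
        row_free (hmx (psi F \o (x \o i)))
    & forall F m (i : 'I_m -> 'I_N) j, m = k.+2 -> row_free (hmx (x \o i)) ->
        (exists l, i l \notin J F) -> j \in J F -> (forall l, i l != j) ->
        ~~ (hm (x j) <= hmx (x \o i))%MS].

Hypothesis gp : general_position.

Let G F := facesets (psi F \o x) (J F) k.
Let EE := facesets x [set: 'I_N] k.+1.
(** With [k.+2] points on [F] their hull is full-dimensional in [F]; a point off [F] is what a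
    rotated hyperplane can run into. *)
Let good F := (k.+2 <= #|J F| < N)%N.

Let G_sub F A : A \in G F -> A \subset J F.
Proof.
by move=> /facesetsP[[v [c [_ ->]]] _]; apply/fintype.subsetP => i; rewrite inE => /andP[].
Qed.

Let G_indep F A : A \in G F ->
  exists2 g : 'I_k.+1 -> 'I_N, (forall i, g i \in A) & row_free (hmx (x \o g)).
Proof.
move=> /facesetsP[_ /has_dimP[e [eA fe _]]].
have [g gA ge] := fin_all_exists2 eA.
exists g => //.
apply: (@row_free_affine_map _ _ _ (C F) (b F)).
rewrite (_ : hmx _ = hmx e) //; apply/row_matrixP => i; rewrite !row_hmx.
by rewrite -ge.
Qed.

(** Otherwise the [k]-dimensional set [A] would contain [k.+2] points that are independent in the
    chart. *)
Let not_ridge F A : good F -> A \in G F -> exists2 i, i \in J F & i \notin A.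
Proof.
case: gp => _ _ gp2 _ /andP[kJ _] AG.
have [i inj iJ] := subset_enum_inj kJ.
have [/forallP iA|] := boolP [forall l, i l \in A]; last first.
  by rewrite negb_forall => /existsP[l lA]; exists (i l).
have /facesetsP[_ dA] := AG.
suff : (k.+2 <= k.+1)%N by rewrite ltnn.
by apply: (row_free_dim_le dA _ (gp2 _ _ inj iJ)) => l; exists (i l) => //=.
Qed.

Let ridge_ex F A : good F -> A \in G F -> exists2 E, E \in EE & E :&: J F = A.
Proof.
move=> gF AG; have [g gA fg] := G_indep AG.
have [i iJ iA] := not_ridge gF AG.
case: gp => gp0 _ _ _; move: gF => /andP[_ JT].
have Jn : exists j, j \notin J F.
  apply/existsP; rewrite -negb_forall; apply: contraL JT => /forallP JT.
  by rewrite (eq_card (B := predT)) ?card_ord ?ltnn // => j; rewrite JT inE.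
have /facesetsP[[v [c [vc AE]]] _] := AG.
(* The supporting functional of the chart is pulled back to the ambient space, with the constant
   shifted accordingly. *)
have vE j : dotv v (psi F (x j)) - c =
    dotv (v *m (C F)^T) (x j) - (c - dotv v (b F)).
  by rewrite dotv_affine_map; ring.
have [||E EE1 [EJ _]] := @facet_of_ridge _ _ _ x (J F) A (u F) (a F)
   (v *m (C F)^T) (c - dotv v (b F)) g (gp0 F) erefl _ _ gA fg Jn (ex_intro2 _ _ i iJ iA).
- by move=> j jJ; rewrite -subr_le0 -vE subr_le0; exact: vc.
- apply/setP => j; rewrite AE !inE; congr (_ && _).
  by rewrite -subr_eq0 vE subr_eq0.
- by exists E.
Qed.

(** The facet [E] has [k.+1] independent points on [F]; together with [y], which is off [F], they
    span its hyperplane. Then [z] lies in this span, against the last clause of [general_position]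
    for [F'']: the points on [F] are not on [F'']. *)
Let clash F F' F'' E A y z : E \in EE -> A \in G F -> A \subset E ->
  F != F' -> F != F'' -> y \in E -> y \in J F' -> z \in E -> z \in J F'' ->
  y != z -> False.
Proof.
move=> EE1 AG AE FF' FF'' yE yJ zE zJ yz.
have [g gA fg] := G_indep AG; case: gp => _ gp1 _ gp3.
have gJ l : g l \in J F by apply: (fintype.subsetP (G_sub AG)).
have gE l : g l \in E by apply: (fintype.subsetP AE).
have fe : row_free (hmx (x \o rcons_idx g y)).
  rewrite hmx_rcons_idx; apply: row_free_rcons => //.
  apply: (@not_sub_hmx _ _ _ _ (u F) (a F)) => [l /=|].
    by have := gJ l; rewrite !inE => /eqP.
  by rewrite eq_sym in FF'; have := gp1 _ _ _ FF' yJ; rewrite !inE.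
have iE l : rcons_idx g y l \in E by rewrite /rcons_idx; case: fintype.split.
have : ~~ (hm (x z) <= hmx (x \o rcons_idx g y))%MS.
  apply: (gp3 F'') => //; first by rewrite addn1.
    exists (lshift 1 ord0); rewrite /rcons_idx.
    case: splitP => // l _.
    by apply: (gp1 F).
  move=> l; rewrite /rcons_idx; case: fintype.split => // l'.
  apply: contraTneq zJ => <-; exact: (gp1 F).
move/negP; apply.
have /facesetsP[_ dE] := EE1.
apply: (has_dim_full dE) fe _ _; [by rewrite addn1| |by exists z].
by move=> l; exists (rcons_idx g y l) => //=.
Qed.

Let choose_facet : exists ep : Fc * {set 'I_N} -> {set 'I_N}, forall p,
  good p.1 -> p.2 \in G p.1 -> ep p \in EE /\ ep p :&: J p.1 = p.2.
Proof.
have H (p : Fc * {set 'I_N}) : exists E : {set 'I_N}, good p.1 -> p.2 \in G p.1 ->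
    E \in EE /\ E :&: J p.1 = p.2.
  have [[gF pG]|nP] := pselect (good p.1 /\ p.2 \in G p.1).
    by have [E ? ?] := ridge_ex gF pG; exists E.
  by exists finset.set0 => gF pG; case: nP.
by have [ep epP] := choice H; exists ep.
Qed.

Let D : {set Fc * {set 'I_N}} := [set p | good p.1 && (p.2 \in G p.1)].

Let inD p : (p \in D) = good p.1 && (p.2 \in G p.1).
Proof. by rewrite finset.in_set. Qed.

Let cardD : (\sum_(F | good F) #|G F|)%N = #|D|.
Proof.
under eq_bigr do rewrite -sum1_card.
by rewrite pair_big_dep -sum1_card; apply: eq_bigl => p; rewrite inD.
Qed.

(** For a fixed [F], the ridge is recovered from the rotated facet as [ep p :&: J F]. If one facet
    arose from two different [F], the ridge in the second would supply two distinct points, as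
    [k.+1 >= 2], and these clash with the first ridge. *)
Let facets_ge_high : (0 < k)%N -> (#|D| <= #|EE|)%N.
Proof.
move=> k0; have [ep epP] := choose_facet.
have epD p : p \in D -> ep p \in EE /\ ep p :&: J p.1 = p.2.
  by rewrite inD => /andP[]; exact: epP.
rewrite -(@card_in_imset _ _ ep).
  by apply/subset_leq_card/fintype.subsetP => _ /imsetP[p /epD[? _] ->].
move=> [F A] [F' A'] pD pD' epE.
have [E1 /= E1J] := epD _ pD; have [E2 /= E2J] := epD _ pD'.
move: pD pD'; rewrite !inD /= => /andP[_ AG] /andP[_ AG'].
have [FF'|FF'] := eqVneq F F'; first by subst F'; rewrite -E1J epE E2J.
exfalso; have [g gA fg] := G_indep AG'.
have gJ l : g l \in J F' by apply: (fintype.subsetP (G_sub AG')).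
have gE l : g l \in ep (F, A) by have := gA l; rewrite -E2J epE inE => /andP[].
apply: (@clash F F' F' (ep (F, A)) A (g ord0) (g ord_max)) => //.
  by apply/fintype.subsetP => l; have /finset.setP/(_ l) := E1J; rewrite inE => <- /andP[].
apply/eqP => gg; have /(_ ord0 ord_max) := hmx_inj fg.
by rewrite /= gg => /(_ erefl)/(congr1 val)/= k0'; rewrite -k0' in k0.
Qed.

Let J_facet F : good F -> J F \in EE.
Proof.
case: gp => gp0 _ gp2 _ /andP[kJ JN].
have [i inj iJ] := subset_enum_inj kJ.
have fi : row_free (hmx (x \o i)).
  exact: (row_free_affine_map (gp2 _ _ inj iJ)).
have [j jJ] : exists j, j \notin J F.
  apply/existsP; rewrite -negb_forall; apply: contraL JN => /forallP JT.
  by rewrite (eq_card (B := predT)) ?card_ord ?ltnn // => j; rewrite JT inE.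
have uF0 : affine_col (u F) (a F) != 0.
  by apply: (affine_col_neq0 (x := x j)); move: jJ; rewrite !inE.
apply/facesetsP; split; first by exists (u F), (a F); split=> // l _; exact: gp0.
apply: (has_dim_intro _ _ fi) => // [l|_ [l /= lJ <-]]; first by exists (i l) => //=.
apply: hyperplane_sub_hmx fi _ uF0 _ _ => // [h /=|].
  by have := iJ h; rewrite !inE => /eqP.
by move: lJ; rewrite !inE => /eqP.
Qed.

(** In the plane a rotated edge arises from at most two pairs, a third one being a clash, so [#|D|]
    is at most twice the number of rotated edges. Each good [F] has at most two vertices in its
    chart, so [#|D|] is also at most twice the number of good [F]. The edges [J F] are distinct from
    the rotated ones, and the average of the two bounds gives the claim. *)
Let facets_ge_low : k = 0%N -> (#|D| <= #|EE|)%N.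
Proof.
move=> k0; have [ep epP] := choose_facet.
have epD p : p \in D -> ep p \in EE /\ ep p :&: J p.1 = p.2.
  by rewrite inD => /andP[]; exact: epP.
have gp1 : forall F F' i, F != F' -> i \in J F -> i \notin J F' by case: gp.
have DG p : p \in D -> good p.1 /\ p.2 \in G p.1 by rewrite inD => /andP[].
have G0 F A : A \in G F -> exists2 i, i \in A & i \in J F.
  move=> AG; have [g gA _] := G_indep AG; exists (g ord0) => //.
  by apply: (fintype.subsetP (G_sub AG)).
have fiber E : (#|[set p in D | ep p == E]%SET| <= 2)%N.
  rewrite leqNgt; apply/negP => /card_gt2P[p [q [r [[]]]]].
  rewrite 3!finset.in_set => /andP[pD /eqP pE] /andP[qD /eqP qE] /andP[rD /eqP rE] [pq qr rp].
  have neq s t : s \in D -> t \in D -> ep s = E -> ep t = E -> s != t -> s.1 != t.1.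
    move=> /epD[_ sJ] /epD[_ tJ] sE tE; apply: contraNneq => st.
    by rewrite [s]surjective_pairing [t]surjective_pairing -sJ -tJ sE tE st.
  have [p1 p2] := epD _ pD; have [_ q2] := epD _ qD; have [_ r2] := epD _ rD.
  have [y yA yJ] := G0 _ _ (DG _ qD).2; have [z zA zJ] := G0 _ _ (DG _ rD).2.
  apply: (@clash p.1 q.1 r.1 E p.2 y z).
  - by rewrite -pE.
  - exact: (DG _ pD).2.
  - by rewrite -p2 pE finset.subsetIl.
  - exact: neq.
  - by rewrite eq_sym; exact: neq.
  - by move: yA; rewrite -q2 qE inE => /andP[].
  - exact: yJ.
  - by move: zA; rewrite -r2 rE inE => /andP[].
  - exact: zJ.
  - by apply: contraTneq zJ => <-; apply: (gp1 q.1) => //; exact: neq.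
have D1 : (#|D| <= #|ep @: D| * 2)%N.
  rewrite -sum1_card (partition_big_imset ep) /= -sum_nat_const.
  apply: leq_sum => E _; apply: leq_trans (fiber E).
  by rewrite sum1dep_card; apply/subset_leq_card/fintype.subsetP => p; rewrite !inE.
have D2 : (#|D| <= #|[set F | good F]%SET| * 2)%N.
  rewrite -cardD -sum_nat_const.
  rewrite [leqRHS](eq_bigl good) => [|F]; last by rewrite inE.
  apply: leq_sum => F gF; apply: vertices_segment => //.
  case: gp => _ _ gp2 _; move: (gF) => /andP[kJ _].
  have [i inj iJ] := subset_enum_inj kJ.
  exists (i ord0), (i ord_max); split=> //.
  by apply/eqP => /(hmx_inj (gp2 _ _ inj iJ))/(congr1 val).
have JJ : {in [set F | good F]%SET &, injective J}.
  move=> F F'; rewrite !inE => /andP[kJ _] _ JJ.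
  have [i _ /(_ ord0) iJ] := subset_enum_inj kJ.
  apply/eqP; apply: contraT => FF'; move: (iJ); rewrite JJ.
  by rewrite (negbTE (gp1 _ _ _ FF' iJ)).
have dis : (ep @: D :&: J @: [set F | good F])%SET = finset.set0.
  apply/finset.setP => E; rewrite finset.in_set0; apply/negP => /finset.setIP[].
  move=> /imsetP[p pD EE'] /imsetP[F].
  rewrite inE => gF EJ; have [p1 p2] := epD _ pD; have [gp' pG] := DG _ pD.
  have [pF|pF] := eqVneq p.1 F.
    have [i iJ /negP] := not_ridge gp' pG; apply.
    by rewrite -p2 -EE' EJ pF finset.setIid -pF.
  have [y yA yJ] := G0 _ _ pG.
  move: (gp1 _ _ _ pF yJ) => /negP; apply.
  by move: yA; rewrite -p2 -EE' EJ inE => /andP[].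
have : (#|ep @: D| + #|[set F | good F]%SET| <= #|EE|)%N.
  rewrite -(card_in_imset JJ) -cardsUI dis cards0 addn0.
  apply/subset_leq_card/fintype.subsetP => E.
  rewrite inE => /orP[/imsetP[p /epD[? _] ->]//|/imsetP[F]].
  by rewrite inE => gF ->; exact: J_facet.
lia.
Qed.

Theorem nfaces_general_position :
  (\sum_(F | (k.+2 <= #|J F| < N)%N) #|G F| <= #|EE|)%N.
Proof.
rewrite cardD; have [k0|] := posnP k; first exact: facets_ge_low.
exact: facets_ge_high.
Qed.

End pointwise.

(** * Charts and flags *)

Section affine_hull_image.
Context {R : realType} {n d : nat}.
Variables (C : 'M[R]_(n, d)) (b : 'rV[R]_d).
Let psi := affine_map C b.

Lemma affine_map_comb (t : R) x y :
  psi (t *: x + (1 - t) *: y) = t *: psi x + (1 - t) *: psi y.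
Proof.
rewrite /psi /affine_map mulmxDl -!scalemxAl !scalerDr addrACA; congr (_ + _).
by rewrite -scalerDl addrC subrK scale1r.
Qed.

Lemma affine_conv_hull (A : set 'rV[R]_n) :
  psi @` conv_hull A = conv_hull (psi @` A).
Proof.
apply/seteqP; split=> [_ [x Ax <-]|].
  apply: (@conv_hull_sub _ _ A (psi @^-1` conv_hull (psi @` A))) Ax => [y Ay|].
    by apply: sub_conv_hull; exists y.
  apply/convex_setP => y z t t0 t1 /= Ay Az; rewrite affine_map_comb.
  by move/convex_setP: (@conv_hull_convex _ _ (psi @` A)); apply.
apply: conv_hull_sub => [_ [x Ax <-]|]; first by exists x => //; exact: sub_conv_hull.
apply/convex_setP => _ _ t t0 t1 [x Ax <-] [y Ay <-].
exists (t *: x + (1 - t) *: y); last exact: affine_map_comb.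
by move/convex_setP: (@conv_hull_convex _ _ A); apply.
Qed.

End affine_hull_image.

(* [psi] are affine coordinates on the affine hull of the [d]-dimensional convex
   set [F], [phi] the inverse parametrization, and the standard simplex of the
   coordinates lies in [F]. *)
Definition is_chart (R : realType) n d (F : set 'rV[R]_n)
    (psi : 'rV[R]_n -> 'rV[R]_d) (phi : 'rV[R]_d -> 'rV[R]_n) : Prop :=
  [/\ forall y, psi (phi y) = y, forall x, F x -> phi (psi x) = x
    & forall y : 'rV[R]_d, (forall i, 0 <= y 0 i) -> \sum_i y 0 i <= 1 -> F (phi y)].

(** Coordinates with respect to an affine basis in [F] with origin [e ord0]. [Psi] inverts the rows
    [Phi] of edge vectors on the right only, hence [phi (psi x) = x] is obtained on [F]. The
    standard simplex is mapped to convex combinations of the basis. *)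
Lemma chart_exists (R : realType) n d (F : set 'rV[R]_n) :
  has_dim F d -> @convex_set R 'rV[R]_n F ->
  exists C b C' b', is_chart F (affine_map C b) (affine_map C' b' : 'rV[R]_d -> _).
Proof.
move=> /has_dimP[e [Fe fe full]] cF.
pose Phi : 'M[R]_(d, n) := \matrix_i (e (lift ord0 i) - e ord0).
have rPhi y : y *m Phi = \sum_i y 0 i *: (e (lift ord0 i) - e ord0).
  by rewrite mulmx_sum_row; apply: eq_bigr => i _; rewrite rowK.
have fPhi : row_free Phi.
  rewrite -kermx_eq0; apply/eqP/row_matrixP => i.
  set y := row i _; have : y *m Phi = 0 by apply/sub_kermxP; exact: row_sub.
  rewrite rPhi => yP; rewrite row0.
  have : \row_j oapp (fun j => y 0 j) (- \sum_j y 0 j) (unlift ord0 j) *m hmx e = 0.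
    rewrite mulmx_sum_row big_ord_recl row_hmx mxE unlift_none /=.
    rewrite (eq_bigr (fun j => y 0 j *: hm (e (lift ord0 j)))) => [|j _]; last first.
      by rewrite row_hmx mxE liftK.
    rewrite scaleNr scaler_suml -sumrN -big_split /=.
    apply/rowP => j; rewrite summxE [RHS]mxE.
    rewrite (eq_bigr (fun l => y 0 l * (hm (e (lift ord0 l)) 0 j - hm (e ord0) 0 j))) => [|l _].
      rewrite /hm; under eq_bigr do rewrite !mxE.
      case: (fintype.split j) => m; last by rewrite big1 // => l _; rewrite subrr mulr0.
      have /rowP/(_ m) := yP; rewrite summxE [RHS]mxE => yP'; rewrite -[RHS]yP'.
      by apply: eq_bigr => l _; rewrite !mxE.
    by rewrite [LHS]mxE [X in X + _]mxE [X in - X]mxE [X in _ + X]mxE mulrBr addrC.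
  rewrite -[RHS](mul0mx _ (hmx e)) => /(row_free_inj fe)/rowP y0.
  by apply/rowP => j; have := y0 (lift ord0 j); rewrite mxE liftK mxE /= => ->; rewrite mxE.
pose Psi := pinvmx Phi.
have PP : Phi *m Psi = 1%:M by exact: mulmxVp.
exists Psi, (- (e ord0 *m Psi)), Phi, (e ord0).
have K1 y : affine_map Psi (- (e ord0 *m Psi)) (affine_map Phi (e ord0) y) = y.
  by rewrite /affine_map mulmxDl -mulmxA PP mulmx1 addrK.
split=> // [x Fx|y y0 y1].
  suff [y ->] : exists y, x = affine_map Phi (e ord0) y by rewrite K1.
  have /sub_hmxP[c [c1 ->]] := full _ Fx.
  exists (\row_i c (lift ord0 i)); rewrite /affine_map rPhi.
  rewrite !big_ord_recl in c1 *.
  rewrite [in RHS](eq_bigr (fun i => c (lift ord0 i) *: e (lift ord0 i) -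
    c (lift ord0 i) *: e ord0)) => [|i _]; last by rewrite mxE scalerBr.
  rewrite sumrB -scaler_suml.
  have -> : c ord0 = 1 - \sum_i c (lift ord0 i) by rewrite -c1 addrK.
  by rewrite scalerBl scale1r -addrA [LHS]addrC [- _ + _]addrC.
rewrite /affine_map rPhi; under eq_bigr do rewrite scalerBr; rewrite sumrB -scaler_suml.
have -> : \sum_i y 0 i *: e (lift ord0 i) - (\sum_i y 0 i) *: e ord0 + e ord0 =
    \sum_(i < d.+1) oapp (fun i => y 0 i) (1 - \sum_i y 0 i) (unlift ord0 i) *: e i.
  rewrite big_ord_recl unlift_none /= [in RHS](eq_bigr (fun i => y 0 i *: e (lift ord0 i))) => [|i _]; last first.
    by rewrite liftK.
  by rewrite scalerBl scale1r -addrA [LHS]addrC [- _ + _]addrC.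
apply: convex_comb => // [i|].
  by case: unliftP => [j|] _ //=; rewrite subr_ge0.
rewrite big_ord_recl unlift_none /= [X in _ + X](eq_bigr (fun i => y 0 i)) ?subrK // => i _.
by rewrite liftK.
Qed.

Lemma has_dim_chart (R : realType) n d k (F A : set 'rV[R]_n) C b C' b' :
  is_chart F (affine_map C b) (affine_map C' b' : 'rV[R]_d -> _) ->
  A `<=` F -> has_dim A k -> has_dim (affine_map C b @` A) k.
Proof.
move=> [_ phK _] AF /has_dimP[e [Ae fe full]]; apply/has_dimP.
exists (affine_map C b \o e); split=> [i||_ [x Ax <-]].
- by exists (e i).
- apply: (@row_free_affine_map _ _ _ C' b').
  rewrite (_ : hmx _ = hmx e) //; apply/row_matrixP => i.
  by rewrite !row_hmx /= phK //; exact: AF.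
- by rewrite hm_affine_map hmx_affine_map submxMr // full.
Qed.

Section flags.
Context {R : realType} {K : nat}.

Lemma facesets_id n (p : 'I_K -> 'rV[R]_n) (S : {set 'I_K}) J l : J \in facesets p S l ->
  J = [set i in S | `[< conv_hull (p @` [set` J]) (p i) >]]%SET.
Proof.
move=> /facesetsP[[u [a [Sa JE]]] _].
apply/finset.setP => i; rewrite inE; have [iS|iS] /= := boolP (i \in S); last first.
  by rewrite JE inE (negbTE iS).
apply/idP/asboolP => [iK|]; first by apply: sub_conv_hull; exists i.
by rewrite JE -conv_hull_face // => -[_ /= /eqP]; rewrite inE iS.
Qed.

Lemma facesets_inj n (p : 'I_K -> 'rV[R]_n) (S : {set 'I_K}) J J' l l' :
  J \in facesets p S l -> J' \in facesets p S l' ->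
  conv_hull (p @` [set` J]) = conv_hull (p @` [set` J']) -> J = J'.
Proof.
move=> /facesets_id JE /facesets_id JE' JJ'; rewrite JE JE'.
by apply/finset.setP => i; rewrite !inE JJ'.
Qed.

Lemma facesets_face n (p : 'I_K -> 'rV[R]_n) (S : {set 'I_K}) J l : J \in facesets p S l ->
  is_face (conv_hull (p @` [set` S])) (conv_hull (p @` [set` J])) /\
  has_dim (conv_hull (p @` [set` J])) l.
Proof.
move=> /facesetsP[[u [a [Sa ->]]] dJ]; split; last exact/has_dim_conv_hull.
by apply/is_face_hullP; exists u, a.
Qed.

Lemma face_facesets n (p : 'I_K -> 'rV[R]_n) (S : {set 'I_K}) F l :
  is_face (conv_hull (p @` [set` S])) F -> has_dim F l ->
  exists2 J, J \in facesets p S l & F = conv_hull (p @` [set` J]).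
Proof.
move=> /is_face_hullP[u [a [Sa ->]]] dF; exists (tight p S u a) => //.
by apply/facesetsP; split; [exists u, a|apply/has_dim_conv_hull].
Qed.

Definition flagsets n (p : 'I_K -> 'rV[R]_n) (S : {set 'I_K}) :
    {set {ffun 'I_n -> {set 'I_K}}} :=
  [set g : {ffun 'I_n -> {set 'I_K}} | [forall i : 'I_n, g i \in facesets p S i] &&
    `[< forall i j : 'I_n, (i < j)%N ->
      conv_hull (p @` [set` g i]) `<` conv_hull (p @` [set` g j]) >]].

Lemma flagsetsP n (p : 'I_K -> 'rV[R]_n) (S : {set 'I_K}) g : g \in flagsets p S <->
  (forall i : 'I_n, g i \in facesets p S i) /\
  (forall i j : 'I_n, (i < j)%N ->
      conv_hull (p @` [set` g i]) `<` conv_hull (p @` [set` g j])).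
Proof.
rewrite finset.in_set; split=> [/andP[/forallP ? /asboolP]|[? ?]] //.
by apply/andP; split; [apply/forallP|apply/asboolP].
Qed.

Lemma nflagsE n (p : 'I_K -> 'rV[R]_n) (S : {set 'I_K}) :
  nflags (conv_hull (p @` [set` S])) = #|flagsets p S|.
Proof.
pose f (g : {ffun 'I_n -> {set 'I_K}}) : {ffun 'I_n -> set 'rV[R]_n} :=
  [ffun i => conv_hull (p @` [set` g i])].
rewrite /nflags (_ : [set F | is_flag _ F] = f @` [set` flagsets p S]).
  apply: card_fset_set_image => g g' /flagsetsP[gp _] /flagsetsP[gp' _] /ffunP fgg'.
  apply/ffunP => i; apply: facesets_inj (gp i) (gp' i) _.
  by have := fgg' i; rewrite !ffunE.
apply/seteqP; split=> [F /= [Fp Fs]|_ [g /= /flagsetsP[gp gs] <-]]; last first.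
  split=> [i|i j ij]; rewrite !ffunE; last exact: gs.
  exact: facesets_face.
have H (i : 'I_n) : exists J : {set 'I_K}, J \in facesets p S i /\ F i = conv_hull (p @` [set` J]).
  by have [Fi Di] := Fp i; have [J ? ?] := face_facesets Fi Di; exists J.
have [g gP] := choice H.
exists (finfun g); last by apply/ffunP => i; rewrite !ffunE; have [_ ->] := gP i.
apply/flagsetsP; split=> [i|i j ij]; rewrite !ffunE; first by have [] := gP i.
have [_ <-] := gP i; have [_ <-] := gP j; exact: Fs.
Qed.

(** A functional that supports the larger polytope is transported to the chart by composition with
    the inverse parametrization. *)
Lemma facesets_chart n d (p : 'I_K -> 'rV[R]_n) (S J A : {set 'I_K}) C b C' b' l :
  is_chart (conv_hull (p @` [set` J])) (affine_map C b) (affine_map C' b' : 'rV[R]_d -> _) ->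
  J \subset S -> A \in facesets p S l -> A \subset J ->
  A \in facesets (affine_map C b \o p) J l.
Proof.
move=> ch JS /facesetsP[[v [c [vc AE]]] dA] AJ; have [_ phK _] := ch.
have JF i : i \in J -> conv_hull (p @` [set` J]) (p i).
  by move=> iJ; apply: sub_conv_hull; exists i.
have vE i : i \in J -> dotv (v *m C'^T) (affine_map C b (p i)) =
    dotv v (p i) - dotv v b'.
  move=> iJ; have e := phK _ (JF _ iJ); rewrite -[in RHS]e.
  by rewrite [in RHS]dotv_affine_map addrK.
apply/facesetsP; split.
  exists (v *m C'^T), (c - dotv v b'); split=> [i iJ|].
    by rewrite /= vE // lerD2r vc // (fintype.subsetP JS).
  apply/finset.setP => i; rewrite [RHS]inE; have [iJ|iJ] /= := boolP (i \in J).
    by rewrite vE // AE inE (fintype.subsetP JS) //= (inj_eq (addIr _)).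
  by apply: contraNF iJ; apply: fintype.subsetP.
rewrite -image_comp; apply: has_dim_chart ch _ dA => _ [i /= iA <-].
by apply: JF; apply: (fintype.subsetP AJ).
Qed.

(** Group the flags by their top face [J]. Within a group the lower faces determine the flag, and
    they are faces of [J], hence of its chart image. *)
Lemma card_flagsets_le d (p : 'I_K -> 'rV[R]_d.+1) (S : {set 'I_K}) C b C' b' :
  (forall J : {set 'I_K}, J \in facesets p S d ->
    is_chart (conv_hull (p @` [set` J])) (affine_map (C J) (b J))
      (affine_map (C' J) (b' J) : 'rV[R]_d -> _)) ->
  (#|flagsets p S| <= \sum_(J in facesets p S d)
    #|flagsets (affine_map (C J) (b J) \o p) J|)%N.
Proof.
move=> ch.
pose top (g : {ffun 'I_d.+1 -> {set 'I_K}}) := g ord_max.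
pose low (g : {ffun 'I_d.+1 -> {set 'I_K}}) : {ffun 'I_d -> {set 'I_K}} :=
  [ffun i => g (widen_ord (leqnSn d) i)].
have topF g : g \in flagsets p S -> top g \in facesets p S d.
  by move=> /flagsetsP[/(_ ord_max)].
rewrite -sum1_card (partition_big top (fun J => J \in facesets p S d)) //=.
apply: leq_sum => J JF; rewrite sum1dep_card.
rewrite -(card_in_imset (f := low)) => [|g g']; last first.
  rewrite !finset.in_set => /andP[_ /eqP gJ] /andP[_ /eqP gJ'] /ffunP lE.
  apply/ffunP => i; have [i' ii'|->] := unliftP ord_max i; last first.
    by rewrite -/(top g) -/(top g') gJ gJ'.
  have := lE i'; rewrite !ffunE (_ : widen_ord _ i' = i) //.
  by apply: val_inj; rewrite ii' /= /bump leqNgt ltn_ord.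
apply/subset_leq_card/fintype.subsetP => h0 /imsetP[g].
rewrite finset.in_set => /andP[gF /eqP gJ] ->; have /flagsetsP[gf gs] := gF.
have JS : J \subset S.
  have /facesetsP[[u [a [_ ->]]] _] := JF.
  by apply/fintype.subsetP => i; rewrite inE => /andP[].
have gsub i : low g i \subset J.
  rewrite ffunE -gJ; apply/fintype.subsetP => h.
  rewrite {1}(facesets_id (gf _)) /top [in X in _ -> X](facesets_id (gf ord_max)).
  rewrite !finset.in_set => /andP[-> /=] /asboolP hx.
  apply/asboolP; have [+ _] := gs (widen_ord (leqnSn d) i) ord_max (ltn_ord i).
  by apply.
have imE i : conv_hull ((affine_map (C J) (b J) \o p) @` [set` low g i]) =
    affine_map (C J) (b J) @` conv_hull (p @` [set` low g i]).
  by rewrite affine_conv_hull image_comp.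
have cJ := ch _ JF; have [_ phK _] := cJ.
have sJ i : conv_hull (p @` [set` low g i]) `<=` conv_hull (p @` [set` J]).
  apply: conv_hull_sub; last exact: conv_hull_convex.
  move=> _ [h /= hl <-]; apply: sub_conv_hull; exists h => //=.
  by apply: (fintype.subsetP (gsub i)).
apply/flagsetsP; split=> [i|i j ij].
  apply: (facesets_chart cJ JS) (gsub i).
  by rewrite ffunE; exact: gf.
rewrite !imE; have := gs (widen_ord (leqnSn d) i) (widen_ord (leqnSn d) j) ij.
move: (sJ i) (sJ j); rewrite !ffunE; set A := conv_hull _; set B := conv_hull (p @` [set` g (widen_ord _ j)]).
(* Strictness of the inclusion survives because the chart is injective on the facet. *)
move=> AJ BJ [AB BA]; split=> [_ [x Ax <-]|BA']; first by exists x => //; exact: AB.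
apply: BA => x Bx; have [y Ay yx] := BA' _ (ex_intro2 _ _ x Bx erefl).
suff <- : y = x by [].
by rewrite -[LHS](phK _ (AJ _ Ay)) -[RHS](phK _ (BJ _ Bx)) yx.
Qed.

End flags.

(** * Borel sets and Lebesgue measure *)

Section borel_generators.
Context {R : realType} {n : nat}.
Implicit Types (A U : set 'rV[R]_n).

Lemma open_borel U : open U -> measurable (U : set (borel_rV R n)).
Proof. by move=> oU; exact: sub_sigma_algebra. Qed.

Lemma closed_borel U : closed U -> measurable (U : set (borel_rV R n)).
Proof.
move=> cU; rewrite -[U]setCK; apply: measurableC; apply: open_borel.
exact: closed_openC.
Qed.

Definition halfspaces : set (set 'rV[R]_n) :=
  [set A | exists j (a : R), A = [set x : 'rV[R]_n | x 0 j <= a]].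

(** An open set is the countable union of the half-open cells with rational corners that it
    contains, and a cell is a finite intersection of differences of half-spaces. *)
Lemma open_halfspaces U : open U -> <<s halfspaces >> U.
Proof.
move=> oU; pose T := g_sigma_algebraType halfspaces.
pose cell (q : {ffun 'I_n -> rat * rat}) : set T :=
  [set x : 'rV[R]_n | forall j, ratr (q j).1 < x 0 j <= ratr (q j).2].
have mcell q : measurable (cell q).
  have -> : cell q = \bigcap_(j in [set: 'I_n])
      ([set x : 'rV[R]_n | x 0 j <= ratr (q j).2] `\`
       [set x : 'rV[R]_n | x 0 j <= ratr (q j).1]).
    apply/seteqP; split=> [x xq j _|x xq j].
      by have /andP[? ?] := xq j; split=> //=; apply/negP; rewrite -ltNge.
    by have [-> /negP] := xq j I; rewrite -ltNge => ->.
  apply: fin_bigcap_measurable => [|j _]; first exact: finite_finset.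
  apply: measurableD.
    by apply: sub_sigma_algebra; exists j, (ratr (q j).2).
  by apply: sub_sigma_algebra; exists j, (ratr (q j).1).
have -> : U = \bigcup_(q in [set q | cell q `<=` U]) cell q.
  apply/seteqP; split=> [x Ux|x [q /= qU xq]]; last exact: qU.
  have /nbhs_ballP[e /= e0 eU] := open_nbhs_nbhs (conj oU Ux).
  have H j : exists q : rat * rat, x 0 j - e < ratr q.1 :> R /\ ratr q.1 < x 0 j /\
      x 0 j < ratr q.2 :> R /\ ratr q.2 < x 0 j + e.
    have [q1] := rat_in_itvoo (ltr_pwDr e0 (lexx (x 0 j - e))).
    rewrite subrK in_itv /= => /andP[? ?].
    have [q2] := rat_in_itvoo (ltr_pwDr e0 (lexx (x 0 j))).
    by rewrite in_itv /= => /andP[? ?]; exists (q1, q2).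
  have [q qP] := choice H; exists (finfun q).
    move=> y /= yq; apply: eU; rewrite /ball /=; split => // i j.
    have [h1 [h2 [h3 h4]]] := qP j; have := yq j; rewrite ffunE => /andP[l1 l2].
    rewrite (ord1 i) /ball /= distrC ltr_norml; lra.
  move=> j; rewrite ffunE; have [h1 [h2 [h3 h4]]] := qP j.
  by rewrite h2 ltW.
rewrite bigcup_mkcond; apply: (@countable_bigcupT_measurable _ T) => // q.
by case: ifP => _; [exact: mcell|exact: measurable0].
Qed.

Lemma borel_halfspaces : @measurable _ (borel_rV R n) = <<s halfspaces >>.
Proof.
apply/seteqP; split.
  apply: smallest_sub; first exact: smallest_sigma_algebra.
  by move=> U; exact: open_halfspaces.
apply: smallest_sub; first exact: sigma_algebra_measurable.
move=> _ [j [a ->]]; apply: closed_borel.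
apply: (@closed_comp _ _ (fun x : 'rV[R]_n => x 0 j) [set y | y <= a]).
  by move=> x _; exact: coord_continuous.
exact: closed_le.
Qed.

End borel_generators.

Section lebesgue_outer.
Context {R : realType} {d : nat}.
Implicit Types (A : set 'rV[R]_d.+1) (a b : 'rV[R]_d.+1).
Local Open Scope ereal_scope.

Definition vol n (a b : 'rV[R]_n) : R := (\prod_(j < n) (b 0 j - a 0 j))%R.

Lemma vol_ge0 n (a b : 'rV[R]_n) : (forall j, a 0 j <= b 0 j)%R -> (0 <= vol a b)%R.
Proof. by move=> ab; apply: prodr_ge0 => j _; rewrite subr_ge0. Qed.

(** Dimension at least one matters here, as the empty product is 1. Coverings are infinite sequences
    and are padded with such degenerate boxes. *)
Lemma vol_diag a : vol a a = 0%R.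
Proof. by rewrite /vol big_ord_recl subrr mul0r. Qed.

Lemma box_inj n (a b a' b' : 'rV[R]_n) : (forall j, a 0 j <= b 0 j)%R ->
  (forall j, a' 0 j <= b' 0 j)%R -> box a b = box a' b' -> a = a' /\ b = b'.
Proof.
move=> ab ab' E.
have aa : box a b a by move=> j; rewrite lexx ab.
have bb : box a b b by move=> j; rewrite lexx ab.
have aa' : box a' b' a' by move=> j; rewrite lexx ab'.
have bb' : box a' b' b' by move=> j; rewrite lexx ab'.
rewrite E in aa bb; rewrite -E in aa' bb'.
split; apply/rowP => j; apply/eqP; rewrite eq_le.
  by have /andP[-> _] := aa j; have /andP[-> _] := aa' j.
by have /andP[_ ->] := bb j; have /andP[_ ->] := bb' j.
Qed.

(** A set function on all sets, infinite on those that are not boxes, so that the covering infimum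
    of [lebesgue_rV] becomes the outer measure [mu_ext] induced by a set function. *)
Definition box_volume A : \bar R :=
  if A == set0 then 0 else
  if pselect (exists ab : 'rV[R]_d.+1 * 'rV[R]_d.+1,
    (forall j, ab.1 0 j <= ab.2 0 j)%R /\ A = box ab.1 ab.2) is left h
  then (vol (proj1_sig (cid h)).1 (proj1_sig (cid h)).2)%:E else +oo.

Lemma box_volume0 : box_volume set0 = 0.
Proof. by rewrite /box_volume eqxx. Qed.

Lemma box_volume_ge0 A : 0 <= box_volume A.
Proof.
rewrite /box_volume; case: ifP => // _; case: pselect => // h.
by case: cid => ab /= [? _]; rewrite lee_fin vol_ge0.
Qed.

Lemma box_volumeE a b : (forall j, a 0 j <= b 0 j)%R ->
  box_volume (box a b) = (vol a b)%:E.
Proof.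
move=> ab; rewrite /box_volume ifF; last first.
  by apply/negbTE/set0P; exists a => j; rewrite lexx ab.
case: pselect => [h|]; last by case; exists (a, b).
by case: cid => -[a' b'] /= [ab' /(box_inj ab ab')[-> ->]].
Qed.

Lemma box_volume_fin A : box_volume A != +oo -> exists a b,
  [/\ (forall j, a 0 j <= b 0 j)%R, A `<=` box a b & box_volume A = (vol a b)%:E].
Proof.
rewrite /box_volume; case: ifPn => [/eqP -> _|_].
  by exists 0%R, 0%R; rewrite vol_diag; split.
case: pselect => [h|nh]; last by rewrite eqxx.
case: cid => -[a b] /= [ab AE] _; exists a, b; split=> //.
by rewrite AE.
Qed.

Lemma measurable_box n (a b : 'rV[R]_n) : measurable (box a b : set (borel_rV R n)).
Proof.
have -> : box a b = \bigcap_(j in [set: 'I_n])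
    ((fun x : 'rV[R]_n => x 0%R j) @^-1` [set` `[a 0%R j, b 0%R j]]).
  apply/seteqP; split=> [x xab j _|x xab j]; first by rewrite /= in_itv /=; exact: xab.
  by have := xab j I; rewrite /= in_itv.
apply: fin_bigcap_measurable => [|j _]; first exact: finite_finset.
apply: closed_borel; apply: closed_comp; first by move=> x _; exact: coord_continuous.
exact: interval_closed.
Qed.

(** A covering by measurable sets either contains a set of infinite [box_volume], and then its cost
    is infinite, or can be replaced by boxes at the same cost. *)
Lemma lebesgue_rVE A :
  lebesgue_rV A = @mu_ext _ (borel_rV R d.+1) R box_volume A.
Proof.
apply/eqP; rewrite eq_le; apply/andP; split.
  apply: le_ereal_inf_tmp => _ [F [mF AF] <-].
  have [[k kF]|Foo] := pselect (exists k, box_volume (F k) = +oo).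
    rewrite (eseries_pinfty _ _ kF) ?leey // => n _.
    by rewrite -ltNye (lt_le_trans _ (box_volume_ge0 _)).
  have H k : exists ab : 'rV[R]_d.+1 * 'rV[R]_d.+1,
    [/\ (forall j, ab.1 0 j <= ab.2 0 j)%R, F k `<=` box ab.1 ab.2
      & box_volume (F k) = (vol ab.1 ab.2)%:E].
    have [|a [b ?]] := @box_volume_fin (F k); last by exists (a, b).
    by apply/eqP => kF; apply: Foo; exists k.
  have [ab abP] := choice H.
  apply: ereal_inf_lbound; exists (fun k => (ab k).1), (fun k => (ab k).2); split.
  - by move=> k; have [] := abP k.
  - by move=> x /AF[k _ Fx]; exists k => //; have [_ + _] := abP k; apply.
  - by apply: eq_eseriesr => k _; have [_ _ ->] := abP k.
apply: le_ereal_inf_tmp => _ [a [b [ab Aab ->]]].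
apply: ereal_inf_lbound; exists (fun k => box (a k) (b k)).
  by split=> // k; exact: measurable_box.
by apply: eq_eseriesr => k _; rewrite box_volumeE.
Qed.

Lemma lebesgue_rV0 : lebesgue_rV (set0 : set 'rV[R]_d.+1) = 0.
Proof. by rewrite lebesgue_rVE mu_ext0 ?box_volume0 //; exact: box_volume_ge0. Qed.

Lemma lebesgue_rV_ge0 A : 0 <= lebesgue_rV A.
Proof. by rewrite lebesgue_rVE; apply: mu_ext_ge0; exact: box_volume_ge0. Qed.

Lemma le_lebesgue_rV : {homo (@lebesgue_rV R d.+1) : A B / A `<=` B >-> A <= B}.
Proof. by move=> A B AB; rewrite !lebesgue_rVE; exact: le_mu_ext. Qed.

Lemma lebesgue_rV_sigma_subadditive : sigma_subadditive (@lebesgue_rV R d.+1).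
Proof.
move=> F; rewrite lebesgue_rVE; under eq_eseriesr do rewrite lebesgue_rVE.
by apply: mu_ext_sigma_subadditive; exact: box_volume_ge0.
Qed.

HB.instance Definition _ := isOuterMeasure.Build R 'rV[R]_d.+1 (@lebesgue_rV R d.+1)
  lebesgue_rV0 lebesgue_rV_ge0 le_lebesgue_rV lebesgue_rV_sigma_subadditive.

Lemma lebesgue_rV_box a b : (forall j, a 0 j <= b 0 j)%R ->
  lebesgue_rV (box a b) <= (vol a b)%:E.
Proof.
move=> ab; apply: ereal_inf_lbound.
exists (fun=> a), (fun k => if k is 0%N then b else a).
split=> [[|k] j //|x xab|]; first by exists 0%N.
pose f k := (vol a (if k is 0%N then b else a))%:E.
change ((vol a b)%:E = \big[+%E/0]_(0 <= k <oo) f k).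
rewrite (@nneseries_split _ f 0%N 1%N) => [|k _]; last first.
  by rewrite lee_fin; apply: vol_ge0 => j; case: k.
rewrite add0n big_nat1 eseries0 ?adde0 // => -[//|k] _ _.
by rewrite /f -/(vol a a) vol_diag.
Qed.

(* A hyperplane [x j = t] splits a box into two boxes whose volumes add up. *)
Lemma caratheodory_halfspace j (t : R) :
  (@lebesgue_rV R d.+1).-caratheodory [set x | x 0 j <= t]%R.
Proof.
apply: le_caratheodory_measurable => X.
apply: le_ereal_inf_tmp => _ [a [b [ab Xab ->]]].
(* [lo] and [hi] clip the coordinate [j] of both corners at [t]. A box on one side of the hyperplane
   has a degenerate other half of volume 0, and lengths add up because a minimum and a maximum have
   the same sum as their arguments. *)
pose lo (x : 'rV[R]_d.+1) : 'rV[R]_d.+1 := \row_i (if i == j then Num.min (x 0 i) t else x 0 i)%R.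
pose hi (x : 'rV[R]_d.+1) : 'rV[R]_d.+1 := \row_i (if i == j then Num.max (x 0 i) t else x 0 i)%R.
have volE i : vol (a i) (b i) = (vol (lo (a i)) (lo (b i)) + vol (hi (a i)) (hi (b i)))%R.
  have D (x y : 'rV[R]_d.+1) : vol x y =
      ((y 0 j - x 0 j) * \prod_(k < d.+1 | k != j) (y 0 k - x 0 k))%R.
    by rewrite /vol (bigD1 j).
  have E (f : 'rV[R]_d.+1 -> 'rV[R]_d.+1) : (forall x k, k != j -> f x 0 k = x 0 k)%R ->
      (\prod_(k < d.+1 | k != j) (f (b i) 0 k - f (a i) 0 k) =
       \prod_(k < d.+1 | k != j) (b i 0 k - a i 0 k))%R.
    by move=> fE; apply: eq_bigr => k kj; rewrite !fE.
  rewrite !D (E lo) => [|x k /negbTE kj]; last by rewrite mxE kj.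
  rewrite (E hi) => [|x k /negbTE kj]; last by rewrite mxE kj.
  rewrite -mulrDl; congr (_ * _)%R; rewrite !mxE eqxx.
  have := addr_max_min (b i 0%R j) t; have := addr_max_min (a i 0%R j) t.
  move: (Num.max _ _) (Num.min _ _) (Num.max _ _) (Num.min _ _) => M1 m1 M2 m2; lra.
have lolo i k : (lo (a i) 0 k <= lo (b i) 0 k)%R.
  by rewrite !mxE; case: ifP => _ //; rewrite le_min !ge_min ab lexx orbT.
have hihi i k : (hi (a i) 0 k <= hi (b i) 0 k)%R.
  by rewrite !mxE; case: ifP => _ //; rewrite ge_max !le_max ab lexx orbT.
have -> : \sum_(0 <= i <oo) (\prod_(j < d.+1) (b i 0 j - a i 0 j)%R)%:E =
   \sum_(0 <= i <oo) (vol (lo (a i)) (lo (b i)))%:E +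
   \sum_(0 <= i <oo) (vol (hi (a i)) (hi (b i)))%:E.
  rewrite -nneseriesD; try by move=> i _; rewrite lee_fin vol_ge0.
  by apply: eq_eseriesr => i _; rewrite -EFinD -volE.
apply: leeD; apply: ereal_inf_lbound.
  exists (lo \o a), (lo \o b); split=> // x [/Xab[i _ xi] xt]; exists i => // k.
  have /andP[l1 l2] := xi k; rewrite !mxE; case: eqP => [kj|_]; last by rewrite l1.
  by rewrite ge_min l1 le_min l2 kj xt.
exists (hi \o a), (hi \o b); split=> // x [/Xab[i _ xi] /negP]; rewrite -ltNge => xt.
exists i => // k.
have /andP[l1 l2] := xi k; rewrite !mxE; case: eqP => [kj|_]; last by rewrite l1.
by rewrite ge_max l1 le_max l2 kj ltW.
Qed.

Lemma caratheodory_borel A : measurable (A : set (borel_rV R d.+1)) ->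
  (@lebesgue_rV R d.+1).-caratheodory A.
Proof.
rewrite borel_halfspaces; move: A; apply: smallest_sub; last first.
  by move=> _ [j [t ->]]; exact: caratheodory_halfspace.
exact: (@sigma_algebra_measurable _ (caratheodory_type (@lebesgue_rV R d.+1))).
Qed.

Definition leb : set (borel_rV R d.+1) -> \bar R := @lebesgue_rV R d.+1.

Lemma leb0 : leb set0 = 0. Proof. exact: lebesgue_rV0. Qed.
Lemma leb_ge0 A : 0 <= leb A. Proof. exact: lebesgue_rV_ge0. Qed.
Lemma leb_sigma_additive : semi_sigma_additive leb.
Proof.
move=> F mF tF mUF; apply: (@caratheodory_measure_sigma_additive R _ (@lebesgue_rV R d.+1)) => //.
  by move=> i; apply: caratheodory_borel; exact: mF.
exact: caratheodory_borel.
Qed.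

HB.instance Definition _ := isMeasure.Build _ _ _ leb leb0 leb_ge0 leb_sigma_additive.

End lebesgue_outer.

(** * Scaling of Lebesgue measure and coverings of a cube *)

Section covering_volume.
Local Open Scope ereal_scope.

Lemma le_mule_ereal_inf (R : realType) (S : set (\bar R)) (y : \bar R) (c : R) :
  (0 < c)%R -> (forall x, S x -> y <= c%:E * x) -> y <= c%:E * ereal_inf S.
Proof.
move=> c0 H; rewrite -lee_pdivrMl //; apply: le_ereal_inf_tmp => x Sx.
by rewrite lee_pdivrMl // H.
Qed.

Definition homothety (R : realType) n (r : R) (t x : 'rV[R]_n) : 'rV[R]_n := (r *: x + t)%R.

Lemma homothetyK (R : realType) n (r : R) (t : 'rV[R]_n) : r != 0%R ->
  cancel (homothety r t) (homothety r^-1 (- (r^-1 *: t))).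
Proof. by move=> r0 x; rewrite /homothety scalerDr scalerA mulVf // scale1r addrK. Qed.

Lemma homothetyKV (R : realType) n (r : R) (t : 'rV[R]_n) : r != 0%R ->
  cancel (homothety r^-1 (- (r^-1 *: t))) (homothety r t).
Proof. by move=> r0 x; rewrite /homothety scalerDr scalerN !scalerA divff // !scale1r subrK. Qed.

Lemma homothety_imageK (R : realType) n (r : R) (t : 'rV[R]_n) (A : set 'rV[R]_n) :
  r != 0%R -> homothety r^-1 (- (r^-1 *: t)) @` (homothety r t @` A) = A.
Proof.
move=> r0; apply/seteqP; split=> [_ [_ [x Ax <-] <-]|x Ax].
  by rewrite homothetyK.
by exists (homothety r t x); [exists x|rewrite homothetyK].
Qed.

(** The inequality for the inverse homothety is the reverse inequality. *)
Lemma scaling_eq (R : realType) n k (m : set 'rV[R]_n -> \bar R) :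
  (forall A (r : R) t, (0 < r)%R -> m (homothety r t @` A) <= (r ^+ k)%:E * m A) ->
  forall A (r : R) t, (0 < r)%R -> m (homothety r t @` A) = (r ^+ k)%:E * m A.
Proof.
move=> H A r t r0; apply/eqP; rewrite eq_le H //=.
have rk : (0 < r ^+ k)%R by rewrite exprn_gt0.
have := H (homothety r t @` A) r^-1%R (- (r^-1 *: t))%R; rewrite invr_gt0 => /(_ r0).
by rewrite homothety_imageK ?gt_eqF // exprVn lee_pdivlMl.
Qed.

Section lebesgue_scaling.
Context {R : realType} {d : nat}.

Lemma vol_homothety n (r : R) t (a b : 'rV[R]_n) :
  vol (homothety r t a) (homothety r t b) = (r ^+ n * vol a b)%R.
Proof.
rewrite /vol -[X in (r ^+ X)%R]card_ord -prodr_const -big_split /=.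
by apply: eq_bigr => j _; rewrite !mxE; lra.
Qed.

Lemma lebesgue_rV_homothety (A : set 'rV[R]_d) (r : R) t : (0 < r)%R ->
  lebesgue_rV (homothety r t @` A) = (r ^+ d)%:E * lebesgue_rV A.
Proof.
move: A r t; apply: scaling_eq => A r t r0.
apply: le_mule_ereal_inf; first by rewrite exprn_gt0.
move=> _ [a [b [ab Aab ->]]].
apply: ereal_inf_lbound.
exists (homothety r t \o a), (homothety r t \o b); split=> [i j|_ [x /Aab[i _ xi] <-]|].
- by rewrite !mxE lerD2r ler_pM2l.
- exists i => // j; have /andP[h1 h2] := xi j.
  by rewrite !mxE !lerD2r !ler_pM2l // h1 h2.
- rewrite -nneseriesZl => [|i _]; last by rewrite lee_fin vol_ge0.
  by apply: eq_eseriesr => i _; rewrite -EFinM -(vol_homothety r t).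
Qed.

Definition tail_rV n (x : 'rV[R]_n.+1) : 'rV[R]_n := \row_j x 0%R (lift ord0 j).

(* Fubini by hand: the slices at a fixed first coordinate cover a cube of one
   dimension less. *)
Lemma cube_cover_volume n (s : R) (w : nat -> bool) (a b : nat -> 'rV[R]_n) :
  (0 <= s)%R -> (forall i j, a i 0 j <= b i 0 j)%R ->
  (forall x : 'rV[R]_n, (forall j, 0 <= x 0 j <= s)%R -> exists2 i, w i & box (a i) (b i) x) ->
  (s ^+ n)%:E <= \sum_(0 <= i <oo) ((w i)%:R * vol (a i) (b i))%:E.
Proof.
move=> s0; elim: n w a b => [|n IH] w a b ab cov.
  have [|i wi _] := cov 0%R; first by case.
  rewrite expr0; apply: le_trans (nneseries_lim_ge i.+1 _); last first.
    by move=> k _; rewrite lee_fin mulr_ge0 // vol_ge0.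
  rewrite big_nat_recr //= wi /vol big_ord0 mulr1 leeDr //.
  by apply: sume_ge0 => k _; rewrite lee_fin mulr_ge0 // big_ord0.
pose I i := `[a i 0%R ord0, b i 0%R ord0]%classic.
pose V i := ((w i)%:R * vol (tail_rV (a i)) (tail_rV (b i)))%R.
have V0 i : (0 <= V i)%R by rewrite mulr_ge0 // vol_ge0 // => j; rewrite !mxE.
pose f i (t : R) : \bar R := (V i)%:E * (\1_(I i) t)%:E.
have f0 i t : 0 <= f i t by rewrite mule_ge0 // lee_fin.
have mI i : measurable (I i) by exact: measurable_itv.
have mf i : @measurable_fun _ _ R (\bar R) `[0%R, s]%classic (f i).
  by apply: measurable_funeM; apply: measurableT_comp => //; exact: measurable_indic.
(* This is the purpose of the selection [w]: the slice at height [t] keeps only the boxes whose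
   first interval contains [t], and the induction hypothesis applies to this subfamily. *)
have slice t : (0 <= t <= s)%R -> (s ^+ n)%:E <= \sum_(0 <= i <oo) f i t.
  move=> ts.
  have -> : \sum_(0 <= i <oo) f i t = \sum_(0 <= i <oo)
      ((w i && (t \in I i))%:R * vol (tail_rV (a i)) (tail_rV (b i)))%:E.
    apply: eq_eseriesr => i _; rewrite /f /V indicE -EFinM; congr EFin.
    by case: (w i); case: (t \in I i); rewrite /= ?mulr0n ?mulr1n ?mul0r ?mul1r ?mulr0 ?mulr1.
  apply: IH => [i j|x xs]; first by rewrite !mxE.
  pose y : 'rV[R]_n.+1 := \row_j oapp (fun j => x 0%R j) t (unlift ord0 j).
  have [|i wi yi] := cov y.
    by move=> j; rewrite mxE; case: unliftP => [j' _|_] //=; exact: xs.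
  exists i; last first.
    by move=> j; have := yi (lift ord0 j); rewrite !mxE liftK.
  rewrite wi /=; apply/mem_set; rewrite /I /= in_itv /=.
  by have := yi ord0; rewrite mxE unlift_none.
have Lm x y : (x <= y)%R -> lebesgue_measure (`[x, y]%classic : set R) = (y - x)%:E.
  rewrite lebesgue_measure_itv /= lte_fin le_eqVlt => /orP[/eqP ->|->//].
  by rewrite ltxx subrr.
have -> : (s ^+ n.+1)%:E = \int[lebesgue_measure]_(t in `[0%R, s]%classic) (s ^+ n)%:E.
  rewrite integral_cst // [X in _ = _ * X](Lm 0%R s) // subr0.
  by rewrite exprSr EFinM.
apply: (@le_trans _ _ (\int[lebesgue_measure]_(t in `[0%R, s]%classic) \sum_(0 <= i <oo) f i t)).
  apply: ge0_le_integral; rewrite //=.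
  - by move=> t _; rewrite lee_fin exprn_ge0.
  - by apply: (@ge0_emeasurable_sum _ _ _ _ f xpredT).
rewrite integral_nneseries //.
apply: lee_nneseries => [i _ _|i _]; first by apply: integral_ge0 => t _.
rewrite ge0_integralZl_EFin //; last first.
  by apply/measurable_EFinP; apply: measurable_indic; exact: mI.
have volE : vol (a i) (b i) =
    ((b i 0 ord0 - a i 0 ord0) * vol (tail_rV (a i)) (tail_rV (b i)))%R.
  by rewrite /vol big_ord_recl; congr (_ * _)%R; apply: eq_bigr => j _; rewrite !mxE.
rewrite [leRHS](_ : _ = (V i)%:E * (b i 0 ord0 - a i 0 ord0)%:E); last first.
  by rewrite -EFinM /V volE -mulrA [X in (_ * X)%R]mulrC.
rewrite integral_indic //; last exact: mI.
apply: lee_wpmul2l; first by rewrite lee_fin.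
apply: (@le_trans _ _ (lebesgue_measure (I i))).
  apply: le_measure; rewrite ?inE.
  - by apply: measurableI; [exact: mI|exact: measurable_itv].
  - exact: mI.
  - exact: subIsetl.
by rewrite Lm.
Qed.

End lebesgue_scaling.

End covering_volume.

(** * Uniqueness of translation-invariant measures on a cube *)

Lemma measurable_borel_continuous (R : realType) n m (f : 'rV[R]_n -> 'rV[R]_m) :
  continuous f -> measurable_fun [set: borel_rV R n] (f : borel_rV R n -> borel_rV R m).
Proof.
move=> cf; apply: (@measurability _ _ _ (borel_rV R m) _ _ (@open 'rV[R]_m)) => //.
move=> _ [U oU <-]; rewrite setTI; apply: open_borel.
by move/continuousP: cf; apply.
Qed.

Lemma continuous_coords (R : realType) (T : topologicalType) n (f : T -> 'rV[R]_n) :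
  (forall j, continuous (fun x => f x 0 j)) -> continuous f.
Proof.
move=> cf x A [P Pf PA].
have H : \forall y \near x, forall j, P 0 j (f y 0 j).
  by apply: filter_forall => j; exact: (cf j x (P 0 j) (Pf 0 j)).
by apply: filterS H => y Py; apply: PA => i j; rewrite (ord1 i).
Qed.

Lemma continuous_sum (R : realType) (T : topologicalType) (I : Type) (r : seq I)
    (F : I -> T -> R) :
  (forall i, continuous (F i)) -> continuous (fun x => \sum_(i <- r) F i x).
Proof.
move=> cF x; elim: r => [|i r IH].
  by under eq_fun do rewrite big_nil; exact: cvg_cst.
by under eq_fun do rewrite big_cons; apply: (@continuousD R R^o _ (F i)) => //; exact: cF.
Qed.

Lemma affine_map_continuous (R : realType) n d (C : 'M[R]_(n, d)) (b : 'rV[R]_d) :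
  continuous (affine_map C b).
Proof.
apply: continuous_coords => j x.
rewrite (_ : (fun y => _) = (fun y : 'rV[R]_n => \sum_i y 0 i * C i j + b 0 j)); last first.
  by apply/funext => y; rewrite !mxE.
have c1 : continuous (fun y : 'rV[R]_n => \sum_i y 0 i * C i j).
  apply: continuous_sum => i y.
  apply: (@continuousM R _ (fun y : 'rV[R]_n => y 0 i) (fun=> C i j) y).
    exact: coord_continuous.
  exact: cst_continuous.
have c2 : continuous (fun _ : 'rV[R]_n => b 0 j) by exact: cst_continuous.
exact: (@continuousD R R^o _ _ _ x (c1 x) (c2 x)).
Qed.

Lemma homothety_continuous (R : realType) n (r : R) (t : 'rV[R]_n) : continuous (homothety r t).
Proof.
rewrite (_ : homothety r t = affine_map r%:M t); first exact: affine_map_continuous.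
by apply/funext => x; rewrite /affine_map mul_mx_scalar.
Qed.

Lemma homothety_imageE (R : realType) n (r : R) (t : 'rV[R]_n) (A : set 'rV[R]_n) : r != 0 ->
  homothety r t @` A = homothety r^-1 (- (r^-1 *: t)) @^-1` A.
Proof.
move=> r0; apply/seteqP; split=> [_ [x Ax <-]|x Ax] /=; first by rewrite homothetyK.
by exists (homothety r^-1 (- (r^-1 *: t)) x) => //; rewrite homothetyKV.
Qed.

Lemma measurable_homothety (R : realType) n (r : R) (t : 'rV[R]_n) (A : set (borel_rV R n)) :
  r != 0 -> measurable A -> measurable (homothety r t @` A : set (borel_rV R n)).
Proof.
move=> r0 mA; rewrite homothety_imageE // -[X in measurable X]setTI.
by apply: (measurable_borel_continuous (@homothety_continuous R n _ _)) => //.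
Qed.

(** Nonnegative additive functions are monotone. With [k] the integer part of [x * N.+1 / s], both
    [h x] and [x / s * h s] lie between [k] and [k.+1] times [h s / N.+1], for every [N]. *)
Lemma additive_linear (R : realType) (s : R) (h : R -> R) : 0 < s ->
  (forall x, 0 <= x -> x <= s -> 0 <= h x) ->
  (forall x y, 0 <= x -> 0 <= y -> x + y <= s -> h (x + y) = h x + h y) ->
  forall x, 0 <= x -> x <= s -> h x = x / s * h s.
Proof.
move=> s0 h0 hD x x0 xs.
have hmono y z : 0 <= y -> y <= z -> z <= s -> h y <= h z.
  move=> y0 yz zs; rewrite -(subrK y z) addrC hD ?subr_ge0 //; last by rewrite addrC subrK.
  by rewrite lerDl h0 ?subr_ge0 //; lra.
have hz : h 0 = 0.
  have := hD 0 0 (lexx _) (lexx _); rewrite addr0 => /(_ (ltW s0)) /eqP.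
  by rewrite -subr_eq0 opprD addNKr oppr_eq0 => /eqP.
have hmul (k : nat) y : 0 <= y -> k%:R * y <= s -> h (k%:R * y) = k%:R * h y.
  move=> y0; elim: k => [|k IH] ks; first by rewrite !mul0r hz.
  have ky0 : 0 <= k%:R * y by rewrite mulr_ge0.
  move: ks; rewrite -natr1 mulrDl mul1r => ks.
  by rewrite hD // IH ?mulrDl ?mul1r //; lra.
have [->|xs'] := eqVneq x s; first by rewrite divff ?gt_eqF // mul1r.
have {}xs : x < s by rewrite lt_neqAle xs' xs.
have hs0 : 0 <= h s by rewrite h0 // ltW.
suff bound (N : nat) : `|h x - x / s * h s| <= h s / N.+1%:R.
  apply/eqP; rewrite -subr_eq0 -normr_eq0; apply: contraT => D0.
  have {}D0 : 0 < `|h x - x / s * h s| by rewrite lt_neqAle eq_sym D0 normr_ge0.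
  have [N HN] : exists N : nat, h s / `|h x - x / s * h s| < N.+1%:R.
    exists (Num.truncn (h s / `|h x - x / s * h s|)).
    by have /truncn_itv/andP[] : 0 <= h s / `|h x - x / s * h s| by rewrite divr_ge0 // ltW.
  have := bound N; rewrite leNgt => /negP; case.
  by rewrite ltr_pdivrMr // -ltr_pdivrMl // mulrC.
have N0 : 0 < N.+1%:R :> R by [].
pose k := Num.truncn (x * N.+1%:R / s).
have y0 : 0 <= x * N.+1%:R / s by rewrite divr_ge0 ?mulr_ge0 // ltW.
have /andP[k1 k2] := truncn_itv y0; rewrite -/k in k1 k2.
have kN : (k < N.+1)%N.
  rewrite -(ltr_nat R); apply: le_lt_trans k1 _.
  by rewrite ltr_pdivrMr // mulrC ltr_pM2l.
have sN : 0 <= s / N.+1%:R by rewrite divr_ge0 // ltW.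
have hsN : h (s / N.+1%:R) = h s / N.+1%:R.
  have := hmul N.+1 _ sN; rewrite mulrC divfK ?gt_eqF // => /(_ (lexx _)) ->.
  by rewrite [RHS]mulrC mulKf ?gt_eqF.
have xk1 : k%:R * (s / N.+1%:R) <= x.
  by rewrite mulrA ler_pdivrMr // -ler_pdivlMr.
have xk2 : x <= k.+1%:R * (s / N.+1%:R).
  by rewrite mulrA ler_pdivlMr // -ler_pdivrMr // ltW.
have ks2 : k.+1%:R * (s / N.+1%:R) <= s.
  by rewrite mulrA ler_pdivrMr // mulrC ler_pM2l // ler_nat.
have h1 : k%:R * (h s / N.+1%:R) <= h x.
  rewrite -hsN -hmul //; last by apply: le_trans xk1 (ltW xs).
  by apply: hmono => //; [rewrite mulr_ge0|exact: ltW].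
have h2 : h x <= k.+1%:R * (h s / N.+1%:R).
  by rewrite -hsN -hmul //; apply: hmono.
have e1 : k%:R * (h s / N.+1%:R) <= x / s * h s.
  rewrite mulrA ler_pdivrMr // mulrAC ler_wpM2r // mulrAC.
  exact: k1.
have e2 : x / s * h s <= k.+1%:R * (h s / N.+1%:R).
  rewrite mulrA ler_pdivlMr // mulrAC ler_wpM2r // mulrAC.
  exact: ltW.
have k1E : k.+1%:R * (h s / N.+1%:R) = k%:R * (h s / N.+1%:R) + h s / N.+1%:R.
  by rewrite -[k.+1%:R]natr1 mulrDl mul1r.
rewrite k1E in h2 e2; rewrite ler_norml.
move: (k%:R * (h s / N.+1%:R)) (h s / N.+1%:R) (x / s * h s) (h x) h1 h2 e1 e2.
move=> K q z w *; lra.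
Qed.

Section cube_measure.
Context {R : realType} {d : nat}.
Local Open Scope ereal_scope.

(** Half-open, so that lengthening one side from [x] to [x + y] adds a disjoint translate of the
    corner with side [y]. *)
Definition corner (b : 'rV[R]_d) : set 'rV[R]_d := [set x | forall j, 0 < x 0 j <= b 0 j]%R.
Definition cube (s : R) : set 'rV[R]_d := corner (const_mx s).

Lemma measurable_corner b : measurable (corner b : set (borel_rV R d)).
Proof.
have -> : corner b = \bigcap_(j in [set: 'I_d])
   ([set x : 'rV[R]_d | x 0 j <= b 0 j]%R `\` [set x : 'rV[R]_d | x 0 j <= 0]%R).
  apply/seteqP; split=> [x xb j _|x xb j].
    by have /andP[? ?] := xb j; split=> //=; apply/negP; rewrite -ltNge.
  by have [/= -> /negP] := xb j I; rewrite -ltNge => ->.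
apply: fin_bigcap_measurable => [|j _]; first exact: finite_finset.
by rewrite borel_halfspaces; apply: (@measurableD _ (g_sigma_algebraType halfspaces));
  apply: sub_sigma_algebra; [exists j, (b 0%R j)|exists j, 0%R].
Qed.

Definition upd (b : 'rV[R]_d) k y : 'rV[R]_d := \row_j (if j == k then y else b 0 j)%R.

Variable s : R.
Hypothesis s0 : (0 < s)%R.

Section one_measure.
Variable m : {measure set (borel_rV R d) -> \bar R}.
Hypothesis m_fin : m (cube s) < +oo.
Hypothesis m_inv : forall (B : set 'rV[R]_d) t, measurable (B : set (borel_rV R d)) ->
  B `<=` cube s -> homothety 1 t @` B `<=` cube s -> m (homothety 1 t @` B) = m B.

Let g b := fine (m (corner b)).
Let inside (b : 'rV[R]_d) := forall j, (0 <= b 0 j <= s)%R.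

Let corner_cube b : inside b -> corner b `<=` cube s.
Proof.
move=> ib x xb j; rewrite mxE; have /andP[-> /le_trans] := xb j; apply.
by have /andP[] := ib j.
Qed.

Let corner_fin b : inside b -> m (corner b) \is a fin_num.
Proof.
move=> ib; rewrite ge0_fin_numE //; apply: le_lt_trans m_fin.
apply: le_measure; rewrite ?inE; [exact: measurable_corner|exact: measurable_corner|].
exact: corner_cube.
Qed.

Let upd_inside b k y : inside b -> (0 <= y <= s)%R -> inside (upd b k y).
Proof. by move=> ib ys j; rewrite mxE; case: eqP. Qed.

Let corner_additive b k x y : inside b -> (0 <= x)%R -> (0 <= y)%R -> (x + y <= s)%R ->
  g (upd b k (x + y)) = (g (upd b k x) + g (upd b k y))%R.
Proof.
move=> ib x0 y0 xys.
have ix : inside (upd b k x) by apply: upd_inside => //; lra.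
have iy : inside (upd b k y) by apply: upd_inside => //; lra.
have ixy : inside (upd b k (x + y)%R) by apply: upd_inside => //; lra.
pose t : 'rV[R]_d := upd 0%R k x.
have tE (z : 'rV[R]_d) j : (homothety 1^-1 (- (1^-1 *: t)) z 0 j =
    z 0 j - (if j == k then x else 0))%R.
  by rewrite !mxE invr1 !mul1r.
have imE : homothety 1 t @` corner (upd b k y) =
    corner (upd b k (x + y)%R) `\` corner (upd b k x).
  rewrite homothety_imageE ?oner_eq0 //; apply/seteqP; split=> z.
    move=> /= zb; split.
      move=> j; have := zb j; rewrite tE !mxE; case: eqP => _; last by rewrite subr0.
      lra.
    by move=> /(_ k); have := zb k; rewrite tE !mxE eqxx; lra.
  move=> [zb nz] j.
  rewrite tE; have := zb j; rewrite !mxE; case: eqP => [->|_]; last by rewrite subr0.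
  move=> /andP[zk0 zk1]; suff : (x < z 0 k)%R by lra.
  rewrite ltNge; apply/negP => zkx; apply: nz => i; have := zb i; rewrite !mxE.
  by case: eqP => [->|//]; rewrite zkx => /andP[->].
have sub : corner (upd b k x) `<=` corner (upd b k (x + y)%R).
  move=> z zb j; have := zb j; rewrite !mxE; case: eqP => // _; lra.
rewrite /g -fineD ?corner_fin //; congr fine.
rewrite -(m_inv (B := corner (upd b k y)) (t := t)); last 3 first.
- exact: measurable_corner.
- exact: corner_cube.
- by rewrite imE; apply: subset_trans (corner_cube ixy); exact: subDsetl.
rewrite imE -measureU.
- by rewrite setDUK.
- exact: measurable_corner.
- by apply: measurableD; exact: measurable_corner.
- by rewrite setDIK.
Qed.

Let corner_upd b k y : inside b -> (0 <= y)%R -> (y <= s)%R ->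
  g (upd b k y) = (y / s * g (upd b k s))%R.
Proof.
move=> ib y0 ys; apply: (additive_linear (h := fun y => g (upd b k y))) => // [x|x z] *.
  by rewrite fine_ge0.
exact: corner_additive.
Qed.

(** The measure is additive, hence linear, in each side length. The sides [s] of the cube are
    changed to those of [b] one at a time. *)
Lemma measure_corner b : inside b -> m (corner b) =
  (\prod_j (b 0 j / s))%:E * m (cube s).
Proof.
move=> ib.
pose part (r : seq 'I_d) : 'rV[R]_d := \row_j (if j \in r then b 0 j else s)%R.
have ip r : inside (part r).
  by move=> j; rewrite mxE; case: ifP => _ //; rewrite lexx ltW.
have key r : uniq r -> g (part r) = (\prod_(j <- r) (b 0 j / s) * g (const_mx s))%R.
  elim: r => [_|k r IH /= /andP[kr ur]].
    by rewrite big_nil mul1r; congr g; apply/rowP => j; rewrite !mxE.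
  have -> : part (k :: r) = upd (part r) k (b 0%R k).
    by apply/rowP => j; rewrite !mxE inE; case: eqP => [->|].
  have /andP[bk0 bks] := ib k.
  rewrite corner_upd // big_cons -[RHS]mulrA -IH //; congr (_ * g _)%R.
  by apply/rowP => j; rewrite !mxE; case: eqP => [->|//]; rewrite (negbTE kr).
have -> : b = part (index_enum 'I_d).
  by apply/rowP => j; rewrite mxE mem_index_enum.
have is_ : inside (const_mx s) by move=> j; rewrite mxE lexx ltW.
rewrite -[LHS]fineK ?corner_fin // -/(g _) key ?index_enum_uniq //.
rewrite -[X in _ * X]fineK ?corner_fin // EFinM; congr (_%:E * _).
by apply: eq_bigr => j _; rewrite mxE mem_index_enum.
Qed.

End one_measure.

(** A generating system closed under intersection. Extended real bounds put the whole space into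
    it. *)
Definition orthants : set (set 'rV[R]_d) :=
  [set A | exists b : 'I_d -> \bar R, A = [set x : 'rV[R]_d | forall j, (x 0 j)%:E <= b j]].

Lemma borel_orthants : @measurable _ (borel_rV R d) = <<s orthants >>.
Proof.
rewrite borel_halfspaces; apply/seteqP; split.
  apply: smallest_sub; first exact: smallest_sigma_algebra.
  move=> _ [j [a ->]]; apply: sub_sigma_algebra.
  exists (fun k => if k == j then a%:E else +oo); apply/seteqP; split=> x /=.
    by move=> xa k; case: eqP => [->|_]; rewrite ?lee_fin ?leey.
  by move=> /(_ j); rewrite eqxx lee_fin.
apply: smallest_sub; first exact: smallest_sigma_algebra.
move=> _ [b ->].
have -> : [set x : 'rV[R]_d | forall j, (x 0 j)%:E <= b j] =
    \bigcap_(j in [set: 'I_d]) [set x : 'rV[R]_d | (x 0 j)%:E <= b j].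
  by apply/seteqP; split=> [x xb j _|x xb j]; [exact: xb|exact: (xb j I)].
apply: (@fin_bigcap_measurable _ (g_sigma_algebraType halfspaces)) => [|j _].
  exact: finite_finset.
case: (b j) => [a||].
- by apply: sub_sigma_algebra; exists j, a; apply/seteqP; split=> x /=; rewrite lee_fin.
- rewrite (_ : [set _ | _] = setT); first exact: measurableT.
  by apply/seteqP; split=> // x _ /=; rewrite leey.
- rewrite (_ : [set _ | _] = set0); first exact: measurable0.
  by apply/seteqP; split=> // x /=.
Qed.

(** Each restriction to the cube is multiplied by the mass that the other measure gives to the cube;
    the products agree on orthants, which cut corners out of the cube. Invariance is asked only for
    translations within the cube, because the law of a point in a chart is not invariant beyond the
    facet. *)
Lemma cube_measure_unique (m1 m2 : {measure set (borel_rV R d) -> \bar R}) :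
  m1 (cube s) < +oo -> m2 (cube s) < +oo ->
  (forall (B : set 'rV[R]_d) t, measurable (B : set (borel_rV R d)) ->
    B `<=` cube s -> homothety 1 t @` B `<=` cube s -> m1 (homothety 1 t @` B) = m1 B) ->
  (forall (B : set 'rV[R]_d) t, measurable (B : set (borel_rV R d)) ->
    B `<=` cube s -> homothety 1 t @` B `<=` cube s -> m2 (homothety 1 t @` B) = m2 B) ->
  forall B : set 'rV[R]_d, measurable (B : set (borel_rV R d)) -> B `<=` cube s ->
  m2 (cube s) * m1 B = m1 (cube s) * m2 B.
Proof.
move=> fin1 fin2 inv1 inv2 B mB Bs.
have mc : measurable (cube s : set (borel_rV R d)) by exact: measurable_corner.
have c1 : (0 <= fine (m1 (cube s)))%R by rewrite fine_ge0.
have c2 : (0 <= fine (m2 (cube s)))%R by rewrite fine_ge0.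
have e1 : (fine (m1 (cube s)))%:E = m1 (cube s) by rewrite fineK // ge0_fin_numE.
have e2 : (fine (m2 (cube s)))%:E = m2 (cube s) by rewrite fineK // ge0_fin_numE.
pose M1 := mscale (NngNum c2) (mrestr m1 mc).
pose M2 := mscale (NngNum c1) (mrestr m2 mc).
have M1E A : M1 A = (fine (m2 (cube s)))%:E * m1 (A `&` cube s) by [].
have M2E A : M2 A = (fine (m1 (cube s)))%:E * m2 (A `&` cube s) by [].
suff : M1 B = M2 B.
  have BE : B `&` cube s = B by exact: setIidl.
  by rewrite M1E M2E BE e1 e2.
(* Bounds are clamped to [[0, s]]; a nonpositive or infinite negative bound becomes 0, and the
   corner is then empty. *)
have clampE (b : 'I_d -> \bar R) : exists2 v : 'rV[R]_d, (forall j, 0 <= v 0 j <= s)%R &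
    [set x : 'rV[R]_d | forall j, (x 0 j)%:E <= b j] `&` cube s = corner v.
  exists (\row_j (match b j with EFin r => Num.max 0 (Num.min r s) | EPInf => s | ENInf => 0 end))%R.
    move=> j; rewrite mxE; case: (b j) => [r||]; rewrite ?lexx ?(ltW s0) //.
    by rewrite le_max lexx ge_max (ltW s0) ge_min lexx orbT.
  apply/seteqP; split=> [x [xb xs] j|x xv]; last split=> j.
  - have := xb j; have := xs j; rewrite !mxE; case: (b j) => [r||] //.
    by rewrite lee_fin => /andP[-> xj] xr; rewrite le_max le_min xr xj orbT.
  - have := xv j; rewrite mxE; case: (b j) => [r||]; rewrite ?leey //.
      rewrite lee_fin => /andP[x0]; rewrite le_max leNgt x0 /= le_min.
      by move=> /andP[].
    by move=> /andP[/lt_le_trans H /H]; rewrite ltxx.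
  - have := xv j; rewrite !mxE; case: (b j) => [r||] //.
      by move=> /andP[x0]; rewrite le_max leNgt x0 /= le_min => /andP[_ ->].
    by move=> /andP[/lt_le_trans H /H]; rewrite ltxx.
apply: (@measure_unique _ R (borel_rV R d) orthants (fun=> setT)) => //.
- exact: borel_orthants.
- move=> _ _ [b1 ->] [b2 ->]; exists (fun j => Order.min (b1 j) (b2 j)).
  apply/seteqP; split=> [x [h1 h2] j|x h]; first by rewrite le_min h1 h2.
  by split=> j; have := h j; rewrite le_min => /andP[].
- by move=> _; exists (fun=> +oo); apply/seteqP; split=> // x _ j; rewrite leey.
- by rewrite bigcup_const //; exists 0%N.
- move=> _ [b ->]; rewrite [LHS]M1E [RHS]M2E; have [v vs ->] := clampE b.
  rewrite (measure_corner fin1 inv1 vs) (measure_corner fin2 inv2 vs) e1 e2 muleCA [RHS]muleCA; congr (_ * _).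
  by rewrite muleC.
- move=> _; rewrite [ltLHS]M1E setTI e2.
  by rewrite lte_mul_pinfty ?ge0_fin_numE // ge0_fin_numE.
Qed.

End cube_measure.

(** * Hausdorff measure *)

Lemma expe_le_scale (R : realType) (x y : \bar R) (c : R) s : (0 <= x)%E -> (0 <= y)%E ->
  0 <= c -> (x <= c%:E * y)%E -> (x ^+ s <= (c ^+ s)%:E * y ^+ s)%E.
Proof.
move=> x0 y0 c0 xy; elim: s => [|s IH]; first by rewrite !expr0 mul1e.
rewrite !expeS exprS EFinM muleACA; apply: lee_pmul => //.
exact: expe_ge0.
Qed.

Section hausdorff_theory.
Context {R : realType} {n : nat}.
Implicit Types (A B U : set 'rV[R]_n) (x y z : 'rV[R]_n).
Local Open Scope ereal_scope.

Lemma enorm_ge0 z : (0 <= enorm z)%R. Proof. exact: sqrtr_ge0. Qed.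

Lemma enormZ (r : R) z : enorm (r *: z) = (`|r| * enorm z)%R.
Proof.
rewrite /enorm dotvZ dotvC dotvZ mulrA -expr2 sqrtrM ?sqr_ge0 //.
by rewrite sqrtr_sqr.
Qed.

Lemma coord_le_enorm z i : (`|z 0 i| <= enorm z)%R.
Proof.
rewrite -sqrtr_sqr /enorm ler_sqrt dotvE.
  by rewrite (bigD1 i) //= expr2 lerDl sumr_ge0 // => j _; rewrite -expr2 sqr_ge0.
by apply: sumr_ge0 => j _; rewrite -expr2 sqr_ge0.
Qed.

Lemma ediam_ge0 U : 0 <= ediam U.
Proof. by rewrite /ediam le_max lexx. Qed.

Lemma enorm_le_ediam U x y : U x -> U y -> (enorm (x - y))%:E <= ediam U.
Proof.
move=> Ux Uy; rewrite /ediam le_max; apply/orP; right.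
by apply: ereal_sup_ubound; exists x, y.
Qed.

Lemma ediam_le U (c : \bar R) : 0 <= c ->
  (forall x y, U x -> U y -> (enorm (x - y))%:E <= c) -> ediam U <= c.
Proof.
move=> c0 H; rewrite /ediam ge_max c0 /=; apply: ge_ereal_sup => _ [x [y [Ux Uy ->]]].
exact: H.
Qed.

Lemma hausdorff_gauge_ge0 s U : 0 <= hausdorff_gauge s U.
Proof. by rewrite /hausdorff_gauge; case: ifP => // _; rewrite expe_ge0 // ediam_ge0. Qed.

Lemma hausdorff_pre_le s (delta : R) A : (0 < delta)%R -> hausdorff_pre s delta A <= hausdorff s A.
Proof. by move=> d0; apply: ereal_sup_ubound; exists delta. Qed.

Lemma hausdorff_ge0 s A : 0 <= hausdorff s A.
Proof.
apply: le_trans (hausdorff_pre_le _ _ ltr01).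
apply: le_ereal_inf_tmp => _ [U [_ _ ->]].
by apply: nneseries_ge0 => i _ _; exact: hausdorff_gauge_ge0.
Qed.

Lemma hausdorff_homothety s A (r : R) t : (0 < r)%R ->
  hausdorff s (homothety r t @` A) = (r ^+ s)%:E * hausdorff s A.
Proof.
move: A r t; apply: scaling_eq => A r t r0.
have rs0 : (0 < r ^+ s)%R by rewrite exprn_gt0.
apply: ge_ereal_sup => _ [delta /= d0 <-].
(* Coverings of mesh [delta / r] are carried to coverings of mesh [delta]. *)
have dr0 : (0 < delta / r)%R by rewrite divr_gt0.
apply: le_trans (_ : (r ^+ s)%:E * hausdorff_pre s (delta / r) A <= _); last first.
  by rewrite lee_pmul2l //; exact: hausdorff_pre_le.
apply: le_mule_ereal_inf => // _ [U [AU Ud ->]].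
have dU i : ediam (homothety r t @` U i) <= r%:E * ediam (U i).
  apply: ediam_le; first by rewrite mule_ge0 ?ediam_ge0 // lee_fin ltW.
  move=> _ _ [x Ux <-] [y Uy <-].
  have -> : (homothety r t x - homothety r t y = r *: (x - y))%R.
    by rewrite /homothety scalerBr opprD addrACA subrr addr0.
  rewrite enormZ gtr0_norm // EFinM lee_pmul2l //; exact: enorm_le_ediam.
apply: le_trans (_ : \sum_(0 <= i <oo) hausdorff_gauge s (homothety r t @` U i) <= _).
  apply: ereal_inf_lbound; exists (fun i => homothety r t @` U i); split=> //.
    by move=> _ [x /AU[i _ Ux] <-]; exists i => //; exists x.
  move=> i; apply: le_trans (dU i) _; rewrite -lee_pdivlMl //.
  by rewrite -EFinM mulrC; exact: Ud.
rewrite -nneseriesZl => [|i _]; last exact: hausdorff_gauge_ge0.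
apply: lee_nneseries => [i _ _|i _]; first exact: hausdorff_gauge_ge0.
rewrite /hausdorff_gauge; have [->|U0] := eqVneq (U i) set0.
  by rewrite image_set0 eqxx mule0.
rewrite ifF; last first.
  by apply/negbTE/set0P; move/set0P: U0 => [x Ux]; exists (homothety r t x), x.
by apply: expe_le_scale; rewrite ?ediam_ge0 // ltW.
Qed.

Lemma affine_map_lipschitz d (C : 'M[R]_(n, d)) (b : 'rV[R]_d) : exists2 L : R, (0 < L)%R &
  forall x y j, (`|affine_map C b x 0 j - affine_map C b y 0 j| <= L * enorm (x - y))%R.
Proof.
pose L : R := (1 + \sum_i \sum_j `|C i j|)%R.
have L0 : (0 < L)%R.
  by rewrite ltr_pwDl // sumr_ge0 // => i _; rewrite sumr_ge0.
exists L => // x y j.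
have -> : (affine_map C b x 0 j - affine_map C b y 0 j = \sum_i (x - y) 0 i * C i j)%R.
  rewrite /affine_map !mxE opprD addrACA subrr addr0 -sumrB; apply: eq_bigr => i _.
  by rewrite !mxE mulrBl.
apply: le_trans (ler_norm_sum _ _ _) _; rewrite /L mulrDl mul1r mulr_suml.
rewrite -[leLHS]add0r lerD ?enorm_ge0 //; apply: ler_sum => i _.
rewrite normrM mulrC ler_pM // ?coord_le_enorm //.
by rewrite (bigD1 j) //= lerDl sumr_ge0.
Qed.

(** A set of diameter [D] is mapped into a cube of side [2 * L * D] around the image of one of its
    points. Mesh 1 makes the diameters finite. This yields the positive probability of every
    facet. *)
Lemma lebesgue_le_hausdorff k (C : 'M[R]_(n, k.+1)) (b : 'rV[R]_k.+1) :
  exists2 c : R, (0 < c)%R &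
  forall A, lebesgue_rV (affine_map C b @` A) <= c%:E * hausdorff k.+1 A.
Proof.
have [L L0 LP] := affine_map_lipschitz C b.
exists ((2 * L) ^+ k.+1)%R; first by rewrite exprn_gt0 // mulr_gt0.
have c0 : (0 < (2 * L) ^+ k.+1)%R by rewrite exprn_gt0 // mulr_gt0.
move=> A; apply: le_trans (_ : ((2 * L) ^+ k.+1)%:E * hausdorff_pre k.+1 1 A <= _); last first.
  by rewrite lee_pmul2l //; exact: hausdorff_pre_le.
apply: le_mule_ereal_inf => // _ [U [AU Ud ->]].
have H i : exists p : 'rV[R]_k.+1 * 'rV[R]_k.+1,
    [/\ (forall j, p.1 0 j <= p.2 0 j)%R, affine_map C b @` U i `<=` box p.1 p.2
     & (vol p.1 p.2)%:E <= ((2 * L) ^+ k.+1)%:E * hausdorff_gauge k.+1 (U i)].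
  rewrite /hausdorff_gauge; have [->|/set0P[x Ux]] := eqVneq (U i) set0.
    exists (0%R, 0%R); rewrite image_set0; split=> //.
    by rewrite vol_diag mule0.
  have Dfin : ediam (U i) \is a fin_num.
    by rewrite ge0_fin_numE ?ediam_ge0 // (le_lt_trans (Ud i)) // ltry.
  pose D := fine (ediam (U i)); have DE : ediam (U i) = D%:E by rewrite fineK.
  have D0 : (0 <= D)%R by rewrite fine_ge0 // ediam_ge0.
  exists (affine_map C b x - const_mx (L * D), affine_map C b x + const_mx (L * D))%R.
  have LD0 : (0 <= L * D)%R by rewrite mulr_ge0 // ltW.
  split=> [j|_ [y Uy <-] j|].
  - by rewrite /= [leLHS]mxE [leRHS]mxE lerD2l !mxE; lra.
  - rewrite /=; have yx : (enorm (y - x) <= D)%R by rewrite -lee_fin -DE; exact: enorm_le_ediam.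
    have := LP y x j; have : (L * enorm (y - x) <= L * D)%R by rewrite ler_pM2l.
    rewrite [X in (X <= _ <= _)%R]mxE [X in (_ <= _ <= X)%R]mxE ![const_mx _ _ _]mxE.
    rewrite [(- const_mx _)%R _ _]mxE ![const_mx _ _ _]mxE.
    move: (affine_map C b y 0%R j) (affine_map C b x 0%R j) (L * enorm _)%R => p q e.
    move=> e1 /ler_normlP[e2 e3]; lra.
  - rewrite DE -EFin_expe -EFinM lee_fin -exprMn /vol /=.
    rewrite (eq_bigr (fun=> (2 * L * D)%R)) => [|j _].
      by rewrite prodr_const card_ord.
    rewrite [X in (X - _)%R]mxE [X in (_ - X)%R]mxE [(- const_mx _)%R _ _]mxE ![const_mx _ _ _]mxE.
    lra.
have [p pP] := choice H.
apply: le_trans (_ : \sum_(0 <= i <oo) (vol (p i).1 (p i).2)%:E <= _).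
  apply: ereal_inf_lbound; exists (fun i => (p i).1), (fun i => (p i).2); split=> //.
    by move=> i; have [] := pP i.
  move=> _ [x /AU[i _ Ux] <-]; exists i => //.
  by have [_ + _] := pP i; apply; exists x.
rewrite -nneseriesZl => [|i _]; last exact: hausdorff_gauge_ge0.
apply: lee_nneseries => [i _ _|i _]; first by have [? _ _] := pP i; rewrite lee_fin vol_ge0.
by have [] := pP i.
Qed.

End hausdorff_theory.

Section pushforward_restriction.
Context {R : realType} {d1 d2 : measure_display}
  {T1 : measurableType d1} {T2 : measurableType d2}.
Variables (m : {measure set T1 -> \bar R}) (F : set T1) (f : T1 -> T2).
Local Open Scope ereal_scope.

Definition push_restr (mF : measurable F) (mf : measurable_fun [set: T1] f)
  (B : set T2) : \bar R := m (F `&` f @^-1` B).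

Variables (mF : measurable F) (mf : measurable_fun [set: T1] f).

Let mpre B : measurable B -> measurable (F `&` f @^-1` B).
Proof. by move=> mB; apply: measurableI => //; rewrite -[X in measurable X]setTI; exact: mf. Qed.

Let push_restr0 : push_restr mF mf set0 = 0.
Proof. by rewrite /push_restr preimage_set0 setI0 measure0. Qed.

Let push_restr_ge0 B : 0 <= push_restr mF mf B.
Proof. exact: measure_ge0. Qed.

Let push_restr_sigma_additive : semi_sigma_additive (push_restr mF mf).
Proof.
move=> A mA tA mUA; rewrite /push_restr preimage_bigcup setI_bigcupr.
apply: measure_semi_sigma_additive.
- by move=> i; exact: mpre.
- by move=> i j _ _ [x [[_ xi] [_ xj]]]; apply: tA => //; exists (f x).
- by rewrite -setI_bigcupr -preimage_bigcup; exact: mpre.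
Qed.

HB.instance Definition _ := isMeasure.Build _ _ _ (push_restr mF mf)
  push_restr0 push_restr_ge0 push_restr_sigma_additive.

End pushforward_restriction.

(** * Cubes have positive and hyperplanes zero Lebesgue measure *)

Section lebesgue_facts.
Context {R : realType} {k : nat}.
Local Open Scope ereal_scope.
Implicit Types (A B : set 'rV[R]_k.+1).

Lemma leb_bounded A (M : R) : (forall x, A x -> forall j, `|x 0 j| <= M)%R -> leb A < +oo.
Proof.
move=> AM; pose M' := Num.max 0%R M.
have M0 : (0 <= M')%R by rewrite le_max lexx.
apply: (@le_lt_trans _ _ (leb (box (const_mx (- M')%R) (const_mx M' : 'rV[R]_k.+1)))).
  apply: le_lebesgue_rV => x Ax j; rewrite !mxE -ler_norml.
  by apply: le_trans (AM _ Ax j) _; rewrite le_max lexx orbT.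
apply: (@le_lt_trans _ _ _ _ _ (lebesgue_rV_box _)); last exact: ltry.
by move=> j; rewrite !mxE; lra.
Qed.

Lemma leb_cube_fin s : leb (cube s : set 'rV[R]_k.+1) < +oo.
Proof.
apply: (@leb_bounded _ s) => x xs j; have := xs j; rewrite mxE => /andP[x0 xs'].
by rewrite gtr0_norm.
Qed.

Lemma leb_cube_gt0 s : (0 < s)%R -> 0 < leb (cube s : set 'rV[R]_k.+1).
Proof.
move=> s0; pose K : set 'rV[R]_k.+1 := box 0%R (const_mx s).
have K0 : 0 < lebesgue_rV K.
  apply: (@lt_le_trans _ _ (s ^+ k.+1)%:E); first by rewrite lte_fin exprn_gt0.
  apply: le_ereal_inf_tmp => _ [a [b [ab Kab ->]]].
  have := @cube_cover_volume R k.+1 s xpredT a b (ltW s0) ab.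
  rewrite (eq_eseriesr (g := fun i => (vol (a i) (b i))%:E)) => [|i _]; last by rewrite mul1r.
  by apply=> x xs; have [i _ xi] : (\bigcup_i box (a i) (b i)) x
    by [apply: Kab => j; rewrite !mxE]; exists i.
have h0 : (0 < 2^-1 :> R)%R by rewrite invr_gt0.
(* The cube is half-open, whereas the covering bound is about the closed one; halving the closed
   cube and moving it by [s / 2] puts it into the half-open cube. *)
have K1 : 0 < lebesgue_rV (homothety 2^-1%R (const_mx (s / 2)%R) @` K).
  by rewrite lebesgue_rV_homothety // mule_gt0 // lte_fin exprn_gt0.
apply: lt_le_trans K1 _; apply: le_lebesgue_rV => _ [x Kx <-] j; rewrite !mxE.
by have := Kx j; rewrite !mxE => /andP[x0 xs]; lra.
Qed.

Lemma measurable_hyperplane n (w : 'rV[R]_n) c :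
  measurable ([set x | dotv w x = c] : set (borel_rV R n)).
Proof.
apply: closed_borel.
apply: (@closed_comp _ _ (fun x : 'rV[R]_n => dotv w x) [set c]); last exact: closed_eq.
move=> x _; rewrite (_ : (fun y => _) = (fun y : 'rV[R]_n => \sum_i w 0%R i * y 0%R i)%R).
  apply: continuous_sum => i y.
  apply: (@continuousM R _ (fun=> w 0%R i) (fun y : 'rV[R]_n => y 0%R i) y).
    exact: cst_continuous.
  exact: coord_continuous.
by apply/funext => y; rewrite dotvE.
Qed.

Lemma dotv_gt0 n (w : 'rV[R]_n) : w != 0%R -> (0 < dotv w w)%R.
Proof.
move=> w0; have ww0 : (0 <= dotv w w)%R.
  by rewrite dotvE sumr_ge0 // => i _; rewrite -expr2 sqr_ge0.
rewrite lt_neqAle ww0 andbT eq_sym; apply: contraNneq w0 => ww.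
apply/eqP/rowP => i; rewrite mxE; apply/eqP; rewrite -normr_eq0 eq_le normr_ge0 andbT.
by have := coord_le_enorm w i; rewrite /enorm ww sqrtr0.
Qed.

(* Infinitely many disjoint translates of a bounded piece of the hyperplane
   fit in a bounded set. *)
Lemma leb_hyperplane0 (w : 'rV[R]_k.+1) c (M : R) : w != 0%R ->
  leb ([set x | dotv w x = c] `&` [set x | forall j, `|x 0 j| <= M]%R) = 0.
Proof.
move=> w0; set A := _ `&` _.
have mbox (r : R) : measurable ([set x : 'rV[R]_k.+1 | forall j, `|x 0 j| <= r]%R : set (borel_rV R k.+1)).
  rewrite (_ : [set x | _] = box (const_mx (- r)%R) (const_mx r)); first exact: measurable_box.
  by apply/seteqP; split=> x xr j; have := xr j; rewrite !mxE -ler_norml.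
have mA : measurable (A : set (borel_rV R k.+1)).
  by apply: measurableI; [exact: measurable_hyperplane|exact: mbox].
(* Translation by [t i *: w] raises the level [c] by [t i * dotv w w], so the levels are pairwise
   distinct, and it moves each coordinate by at most that of [w]. *)
pose t i : R := i.+1%:R^-1%R.
pose T i := homothety 1 (t i *: w)%R @` A.
have mT i : measurable (T i : set (borel_rV R k.+1)).
  by apply: measurable_homothety => //; exact: oner_neq0.
have lT i : leb (T i) = leb A.
  by rewrite /leb /T lebesgue_rV_homothety // expr1n mul1e.
have tT : trivIset [set: nat] T.
  apply/trivIsetP => i j _ _ ij; apply/seteqP; split=> // x [[y [yc _] <-] [z [zc _]]].
  rewrite /homothety !scale1r => /(congr1 (dotv w)).
  rewrite !dotvD !dotvZ yc zc => /addrI /mulIf; rewrite gt_eqF ?dotv_gt0 // => /(_ isT).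
  move=> /invr_inj /eqP; rewrite eqr_nat eqSS => /eqP ji.
  by rewrite ji eqxx in ij.
pose M1 := (M + \sum_j `|w 0%R j|)%R.
pose B := [set x : 'rV[R]_k.+1 | forall j, `|x 0 j| <= M1]%R.
have TB i : T i `<=` B.
  move=> _ [y [_ yM] <-] j; rewrite !mxE mul1r; apply: le_trans (ler_normD _ _) _.
  apply: lerD => //; rewrite normrM ger0_norm ?invr_ge0 //.
  apply: le_trans (_ : `|w 0 j| <= _)%R; last by rewrite (bigD1 j) //= lerDl sumr_ge0.
  by rewrite ler_piMl // invf_le1 // ler1n.
have Bfin : leb B < +oo by apply: (@leb_bounded _ M1).
have Afin : leb A \is a fin_num.
  rewrite ge0_fin_numE ?leb_ge0 //; apply: le_lt_trans Bfin; rewrite -(lT 0%N).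
  by apply: le_lebesgue_rV; exact: TB.
have bound N : (N%:R * fine (leb A) <= fine (leb B))%R.
  rewrite -lee_fin (fineK (x := leb B)); last by rewrite ge0_fin_numE ?leb_ge0.
  rewrite (_ : _%:E = \sum_(i < N) leb (T i)); last first.
    rewrite (eq_bigr (fun=> (fine (leb A))%:E)) => [|i _]; last by rewrite fineK.
    by rewrite sumEFin sumr_const card_ord mulr_natl.
  rewrite -measure_bigsetU_ord //=; last first.
    apply/trivIsetP => i j _ _ ij; move/trivIsetP : tT; apply => //.
  apply: le_lebesgue_rV.
  apply: (big_ind (fun X => X `<=` B)) => [|X Y XB YB x []|i _].
  - exact: sub0set.
  - exact: XB.
  - exact: YB.
  - exact: TB.
apply/eqP; rewrite -(fineK Afin) eqe; apply: contraT => a0.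
have {}a0 : (0 < fine (leb A))%R by rewrite lt_neqAle eq_sym a0 fine_ge0 ?leb_ge0.
have b0 : (0 <= fine (leb B) / fine (leb A))%R by rewrite divr_ge0 ?fine_ge0 ?leb_ge0.
have /truncn_itv/andP[_] := b0; set N := _.+1.
by rewrite ltr_pdivrMr // ltNge bound.
Qed.

End lebesgue_facts.

(** * The law of a boundary point on a facet *)

Section facet_law.
Context {R : realType} {n k : nat}.
Local Open Scope ereal_scope.
Variables (L : {measure set (borel_rV R n) -> \bar R}) (M : R) (D F : set 'rV[R]_n).
Variables (C : 'M[R]_(n, k.+1)) (b : 'rV[R]_k.+1) (C' : 'M[R]_(k.+1, n)) (b' : 'rV[R]_n).
Hypothesis M0 : (0 < M)%R.
Hypothesis L_fin : L setT < +oo.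
Hypothesis LH : forall B : set 'rV[R]_n, measurable (B : set (borel_rV R n)) ->
  M%:E * L B = hausdorff k.+1 (D `&` B).
Hypothesis clF : closed F.
Hypothesis FD : F `<=` D.
Hypothesis chF : is_chart F (affine_map C b) (affine_map C' b').
Variable BF : R.
Hypothesis bdF : forall x, F x -> forall j, (`|x 0 j| <= BF)%R.

Let psi := affine_map C b.
Let phi := affine_map C' b'.
Let Q := psi @` F.

Let psiK y : psi (phi y) = y. Proof. by case: chF. Qed.
Let phiK x : F x -> phi (psi x) = x. Proof. by case: chF => _ + _; apply. Qed.

(** The preimage form shows that [Q] is closed. *)
Lemma chart_imageE : Q = phi @^-1` F.
Proof.
apply/seteqP; split=> [_ [x Fx <-]|y Fy] /=; first by rewrite phiK.
by exists (phi y) => //; rewrite psiK.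
Qed.

Lemma measurable_chart_image : measurable (Q : set (borel_rV R k.+1)).
Proof.
rewrite chart_imageE; apply: closed_borel; apply: closed_comp => // y _.
exact: affine_map_continuous.
Qed.

Let mF : measurable (F : set (borel_rV R n)).
Proof. exact: closed_borel. Qed.

Let bdQ : exists2 BQ : R, (0 <= BQ)%R & forall y, Q y -> forall j, (`|y 0 j| <= BQ)%R.
Proof.
pose c := ((\sum_j \sum_i BF * `|C i j|) + \sum_j `|b 0%R j|)%R.
exists (Num.max 0 c)%R; first by rewrite le_max lexx.
move=> _ [x Fx <-] j; rewrite le_max; apply/orP; right.
have BF0 i : (0 <= BF * `|C i j|)%R.
  by rewrite mulr_ge0 // (le_trans _ (bdF Fx i)).
rewrite /psi /affine_map !mxE; apply: le_trans (ler_normD _ _) _; apply: lerD.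
  apply: le_trans (ler_norm_sum _ _ _) _.
  apply: le_trans (_ : \sum_i BF * `|C i j| <= _)%R.
    by apply: ler_sum => i _; rewrite normrM ler_wpM2r // bdF.
  rewrite [leRHS](bigD1 j) //= lerDl sumr_ge0 // => l _; apply: sumr_ge0 => i _.
  by rewrite mulr_ge0 // (le_trans _ (bdF Fx i)).
by rewrite [leRHS](bigD1 j) //= lerDl sumr_ge0.
Qed.

(** With this side the cube fits into the standard simplex, which a chart places inside [Q]. *)
Let s : R := k.+1%:R^-1%R.
Let s0 : (0 < s)%R. Proof. by rewrite invr_gt0. Qed.

Let cubeQ : cube s `<=` Q.
Proof.
move=> y ys; rewrite chart_imageE /=; case: chF => _ _; apply.
  by move=> i; have /andP[/ltW] := ys i.
apply: le_trans (_ : \sum_(i < k.+1) s <= _)%R.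
  by apply: ler_sum => i _; have /andP[_] := ys i; rewrite mxE.
by rewrite sumr_const card_ord -mulr_natl /s divff.
Qed.

Let imE B : B `<=` Q -> F `&` psi @^-1` B = phi @` B.
Proof.
move=> BQ; apply/seteqP; split=> [x [Fx Bx]|_ [y By <-]] /=.
  by exists (psi x) => //; rewrite phiK.
by have := BQ _ By; rewrite chart_imageE psiK.
Qed.

Let mpsi : measurable_fun [set: borel_rV R n] (psi : borel_rV R n -> borel_rV R k.+1).
Proof. by apply: measurable_borel_continuous; exact: affine_map_continuous. Qed.

Let nu : {measure set (borel_rV R k.+1) -> \bar R} := push_restr L mF mpsi.

Let nuE B : measurable (B : set (borel_rV R k.+1)) -> B `<=` Q ->
  M%:E * nu B = hausdorff k.+1 (phi @` B).
Proof.
move=> mB BQ; rewrite -imE // [nu B]/(L _) LH; last first.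
  by apply: measurableI => //; rewrite -[X in measurable X]setTI; exact: mpsi.
by rewrite setIA (setIidr FD).
Qed.

(** An affine parametrization turns a homothety into one of the same ratio, so the scaling rule of
    Hausdorff measure can be read in the chart. *)
Let phi_homothety r t B : phi @` (homothety r t @` B) =
  homothety r (t *m C' + b' - r *: b')%R @` (phi @` B).
Proof.
have E y : phi (homothety r t y) = homothety r (t *m C' + b' - r *: b')%R (phi y).
  rewrite /phi /affine_map /homothety mulmxDl scalerDr -scalemxAl -!addrA; congr (_ + _)%R.
  by rewrite [RHS]addrCA [X in _ = (_ + X)%R]addrC subrK.
apply/seteqP; split=> [_ [_ [y By <-] <-]|_ [_ [y By <-] <-]].
  by exists (phi y); [exists y|rewrite E].
by exists (homothety r t y); [exists y|rewrite E].
Qed.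

Let mcube : measurable (cube s : set (borel_rV R k.+1)).
Proof. exact: measurable_corner. Qed.

Let nu_fin : nu (cube s) < +oo.
Proof.
apply: le_lt_trans L_fin; rewrite [nu _]/(L _); apply: le_measure; rewrite ?inE //.
by apply: measurableI => //; rewrite -[X in measurable X]setTI; exact: mpsi.
Qed.

Let nu_translate B t : measurable (B : set (borel_rV R k.+1)) -> B `<=` cube s ->
  homothety 1 t @` B `<=` cube s -> nu (homothety 1 t @` B) = nu B.
Proof.
move=> mB Bs Bts.
have mBt : measurable (homothety 1 t @` B : set (borel_rV R k.+1)).
  by apply: measurable_homothety => //; exact: oner_neq0.
have : M%:E * nu (homothety 1 t @` B) = M%:E * nu B.
  rewrite !nuE //; [|exact: subset_trans cubeQ|exact: subset_trans cubeQ].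
  by rewrite phi_homothety hausdorff_homothety // expr1n mul1e.
by move/(congr1 (fun x => M^-1%:E * x)); rewrite !muleA -EFinM mulVf ?gt_eqF // !mul1e.
Qed.

Let leb_translate B t : measurable (B : set (borel_rV R k.+1)) -> B `<=` cube s ->
  homothety 1 t @` B `<=` cube s -> leb (homothety 1 t @` B) = leb B.
Proof. by move=> _ _ _; rewrite /leb lebesgue_rV_homothety // expr1n mul1e. Qed.

Lemma leb_chart_image_fin : leb Q < +oo.
Proof. by have [BQ _ QB] := bdQ; apply: (@leb_bounded _ _ _ BQ). Qed.

Lemma leb_chart_image_gt0 : 0 < leb Q.
Proof. by apply: lt_le_trans (leb_cube_gt0 s0) _; exact: le_lebesgue_rV. Qed.

Lemma facet_law : exists2 kap : R, (0 < kap)%R &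
  forall B : set 'rV[R]_k.+1, measurable (B : set (borel_rV R k.+1)) ->
    L (F `&` psi @^-1` B) = kap%:E * leb (Q `&` B).
Proof.
have lc0 := @leb_cube_gt0 R k s s0; have lcf := @leb_cube_fin R k s.
have nuf : nu (cube s) \is a fin_num by rewrite ge0_fin_numE.
have lfn : leb (cube s : set 'rV[R]_k.+1) \is a fin_num by rewrite ge0_fin_numE // ltW.
pose a := fine (leb (cube s : set 'rV[R]_k.+1)); pose v := fine (nu (cube s)).
have aE : leb (cube s : set 'rV[R]_k.+1) = a%:E by rewrite fineK.
have vE : nu (cube s) = v%:E by rewrite fineK.
have a0 : (0 < a)%R by rewrite -lte_fin -aE.
have [BQ BQ0 QB] := bdQ.
have v0 : (0 < v)%R.
  rewrite -lte_fin -vE.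
  have [c c0 cP] := lebesgue_le_hausdorff C b.
  have := cP (phi @` cube s); rewrite (_ : affine_map C b @` _ = cube s).
    rewrite -nuE // muleA -EFinM => /(lt_le_trans lc0).
    by rewrite pmule_rgt0 // lte_fin mulr_gt0.
  apply/seteqP; split=> [_ [_ [y ys <-] <-]|y ys]; first by rewrite -/psi psiK.
  by exists (phi y); [exists y|rewrite -/psi psiK].
exists (v / a)%R => [|B mB]; first by rewrite divr_gt0.
(* Coordinates bounded by [BQ] shrink to less than [s / 2], and [t] moves the centre to that of the
   cube. The summand 1 keeps the denominator positive and the bound strict. *)
pose r := (s / (2 * (BQ + 1)))%R.
have B1 : (0 < BQ + 1)%R by rewrite ltr_wpDl.
have r0 : (0 < r)%R by rewrite divr_gt0 // mulr_gt0.
pose t : 'rV[R]_k.+1 := const_mx (s / 2)%R.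
pose E := Q `&` B; pose E' := homothety r t @` E.
have mE : measurable (E : set (borel_rV R k.+1)).
  by apply: measurableI => //; exact: measurable_chart_image.
have mE' : measurable (E' : set (borel_rV R k.+1)).
  by apply: measurable_homothety => //; rewrite gt_eqF.
have E's : E' `<=` cube s.
  move=> _ [y [Qy _] <-] j; rewrite !mxE.
  have rB : (`|r * y 0 j| < s / 2)%R.
    rewrite normrM gtr0_norm // /r invfM mulrA -[ltRHS]mulr1 -[ltLHS]mulrA ltr_pM2l ?divr_gt0 //.
    rewrite mulrC ltr_pdivrMr // mul1r; apply: le_lt_trans (QB _ Qy j) _; lra.
  by move: rB => /ltr_normlP[]; move: (r * _)%R => z *; apply/andP; lra.
have key : a%:E * nu E' = v%:E * leb E'.
  rewrite -aE -vE.
  exact: (cube_measure_unique s0 nu_fin lcf nu_translate leb_translate mE' E's).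
have rk0 : (0 < r ^+ k.+1)%R by rewrite exprn_gt0.
have EQ : E `<=` Q by exact: subIsetl.
have nuE' : nu E' = (r ^+ k.+1)%:E * nu E.
  have : M%:E * nu E' = M%:E * ((r ^+ k.+1)%:E * nu E).
    rewrite muleCA !nuE //; last exact: subset_trans cubeQ.
    by rewrite phi_homothety hausdorff_homothety.
  by move/(congr1 (fun x => M^-1%:E * x)); rewrite !muleA -EFinM mulVf ?gt_eqF // !mul1e.
have lebE' : leb E' = (r ^+ k.+1)%:E * leb E by rewrite /leb lebesgue_rV_homothety.
have -> : F `&` psi @^-1` B = F `&` psi @^-1` E.
  apply/seteqP; split=> x [Fx Bx]; split=> //=; last by case: Bx.
  by split => //; exists x.
rewrite -[L _]/(nu E); move: key; rewrite nuE' lebE' muleCA [RHS]muleCA.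
move/(congr1 (fun x => (r ^+ k.+1)^-1%:E * x)).
rewrite !muleA -!EFinM mulVf ?gt_eqF // !mul1r => key.
have : (a^-1)%:E * (a%:E * nu E) = (a^-1)%:E * (v%:E * leb E) by rewrite key.
by rewrite !muleA -!EFinM mulVf ?gt_eqF // mul1e mulrC.
Qed.

End facet_law.

(** * Polytopes are compact, and their proper faces lie on the boundary *)

Section polytope_topology.
Context {R : realType} {n K : nat}.
Variable p : 'I_K -> 'rV[R]_n.+1.

Lemma conv_hull_bounded (S : {set 'I_K}) :
  exists B : R, forall x, conv_hull (p @` [set` S]) x -> forall j, `|x 0 j| <= B.
Proof.
exists (\sum_j \sum_i `|p i 0 j|) => x /conv_hull_finP[c [c0 _ c1 ->]] j.
rewrite summxE; apply: le_trans (ler_norm_sum _ _ _) _.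
apply: le_trans (_ : \sum_i `|p i 0 j| <= _).
  apply: ler_sum => i _; rewrite mxE normrM ger0_norm // ler_piMl //.
  by rewrite -c1 (bigD1 i) //= lerDl sumr_ge0.
by rewrite [leRHS](bigD1 j) //= lerDl sumr_ge0 // => l _; exact: sumr_ge0.
Qed.

(** The hull is a continuous image of the compact simplex of coefficients. *)
Lemma conv_hull_closed (S : {set 'I_K}) : closed (conv_hull (p @` [set` S])).
Proof.
pose A : 'M[R]_(K, n.+1) := \matrix_i p i.
pose simplex := [set c : 'rV[R]_K | [/\ forall i, 0 <= c 0 i,
  forall i, i \notin S -> c 0 i = 0 & \sum_i c 0 i = 1]].
have -> : conv_hull (p @` [set` S]) = affine_map A 0 @` simplex.
  have E (c : 'rV[R]_K) : affine_map A 0 c = \sum_i c 0 i *: p i.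
    by rewrite /affine_map addr0 mulmx_sum_row; apply: eq_bigr => i _; rewrite rowK.
  apply/seteqP; split=> [x /conv_hull_finP[c [c0 cS c1 ->]]|_ [c [c0 cS c1] <-]].
    exists (\row_i c i).
      split=> [i|i iS|]; rewrite ?mxE // ?c0 ?cS //.
      by under eq_bigr do rewrite mxE.
    by rewrite E; apply: eq_bigr => i _; rewrite mxE.
  by apply/conv_hull_finP; exists (fun i => c 0 i).
apply: compact_closed; first exact: norm_hausdorff.
apply: continuous_compact.
  by apply: continuous_subspaceT => x; exact: affine_map_continuous.
apply: bounded_closed_compact.
  exists 1; split=> // M M1 c [c0 _ c1] /=.
  rewrite [leLHS]mx_normrE; apply: bigmax_le => [|[i j] _].
    by apply: ltW; apply: lt_trans M1.
  rewrite (ord1 i) /= ger0_norm //; apply: le_trans (ltW M1).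
  by rewrite -c1 (bigD1 j) //= lerDl sumr_ge0.
have -> : simplex = (\bigcap_(i in [set: 'I_K]) [set c : 'rV[R]_K | 0 <= c 0 i]) `&`
   ((\bigcap_(i in [set i | i \notin S]) [set c : 'rV[R]_K | c 0 i = 0]) `&`
   [set c : 'rV[R]_K | \sum_i c 0 i = 1]).
  apply/seteqP; split=> [c [c0 cS c1]|c [c0 [cS c1]]].
    by split=> [i _|]; [exact: c0|split=> [i|]; [exact: cS|]].
  by split=> [i|i|//]; [exact: c0|exact: cS].
apply: closedI; last apply: closedI.
- apply: closed_bigI => i _; apply: (@closed_comp _ _ (fun c : 'rV[R]_K => c 0 i) [set x | 0 <= x]).
    by move=> x _; exact: coord_continuous.
  exact: closed_ge.
- apply: closed_bigI => i _; apply: (@closed_comp _ _ (fun c : 'rV[R]_K => c 0 i) [set 0]).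
    by move=> x _; exact: coord_continuous.
  exact: closed_eq.
- apply: (@closed_comp _ _ (fun c : 'rV[R]_K => \sum_i c 0 i) [set 1]).
    by move=> x _; apply: continuous_sum => i; exact: coord_continuous.
  exact: closed_eq.
Qed.

(** From a point of the face, any step in the direction [u] leaves [P]. The number [M] bounds the
    coordinates of [u], so that the step stays in the ball of radius [e] for the maximum norm. *)
Lemma face_sub_boundary (P : set 'rV[R]_n.+1) u a : u != 0 ->
  (forall x, P x -> dotv u x <= a) -> P `&` [set x | dotv u x = a] `<=` boundary P.
Proof.
move=> u0 Pa x [Px /= xa]; split; first exact: subset_closure.
move=> /nbhs_ballP[e /= e0 eP].
have uu := dotv_gt0 u0.
pose M := 1 + \sum_i `|u 0 i|.
have M0 : 0 < M by rewrite ltr_pwDl // sumr_ge0.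
have t0 : 0 < e / (2 * M) by rewrite divr_gt0 // mulr_gt0.
have : P (x + (e / (2 * M)) *: u).
  apply: eP; rewrite /ball /=; split=> // i j.
  rewrite (ord1 i) /ball /= !mxE opprD addrA subrr add0r normrN normrM gtr0_norm //.
  apply: le_lt_trans (_ : e / (2 * M) * M < e).
    rewrite ler_pM2l //; rewrite /M (bigD1 j) //= addrCA lerDl.
    by rewrite addr_ge0 // sumr_ge0.
  by rewrite invfM mulrA mulfVK ?gt_eqF //; lra.
move/Pa; rewrite dotvD dotvZ xa gerDl leNgt => /negP; apply.
exact: mulr_gt0.
Qed.

Lemma facet_normal_neq0 (P : set 'rV[R]_n.+1) u a : has_dim P n.+1 ->
  has_dim (P `&` [set x | dotv u x = a]) n -> u != 0.
Proof.
move=> dP dF; apply/eqP => u0; subst u.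
have /has_dimP[e [/(_ ord0)[_ /= e0] _ _]] := dF; rewrite dotv0 in e0; subst a.
have PE : P `&` [set x | dotv 0 x = 0] = P.
  by apply/setIidPl => x _ /=; rewrite dotv0.
rewrite PE in dF; have := has_dim_uniq dP dF => /eqP.
by rewrite -[X in X == _]addn1 -[X in _ == X]addn0 eqn_add2l.
Qed.

End polytope_topology.

(** * Independence and null events *)

Definition mk_mfun d1 d2 (T1 : measurableType d1) (T2 : measurableType d2)
  (f : T1 -> T2) (mf : measurable_fun [set: T1] f) : {mfun T1 >-> T2} :=
  HB.pack f (isMeasurableFun.Build _ _ _ _ f mf).

Section independence.
Context {R : realType} {n : nat} {disp : measure_display} {T : measurableType disp}.
Variables (Pr : probability T R) (N : nat).
Variable X : 'I_N -> {RV Pr >-> borel_rV R n}.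
Variable L : probability (borel_rV R n) R.
Local Open Scope ereal_scope.
Hypothesis indepX : independent_rv X.
Hypothesis lawX : forall i (B : set (borel_rV R n)), measurable B -> Pr (X i @^-1` B) = L B.

Lemma measurable_rv i (B : set (borel_rV R n)) : measurable B -> measurable (X i @^-1` B).
Proof. by move=> mB; rewrite -[_ @^-1` _]setTI; exact: measurable_funP. Qed.

Section one_index.
Variable j : 'I_N.

(** Events depending on the variables other than [X j]. The sigma-algebra that they generate on the
    same space [T] stands in for the product space of the other variables. *)
Definition cylinders : set (set T) :=
  [set A | exists B : 'I_N -> set (borel_rV R n),
    [/\ forall i, measurable (B i), B j = setT & A = \bigcap_(i in setT) (X i @^-1` B i)]].

Definition other_type := g_sigma_algebraType cylinders.

Lemma measurable_cylinder A : cylinders A -> measurable A.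
Proof.
move=> [B [mB _ ->]]; apply: fin_bigcap_measurable; first exact: finite_finset.
by move=> i _; exact: measurable_rv.
Qed.

Lemma other_measurable (A : set T) : measurable (A : set other_type) -> measurable A.
Proof.
move: A; apply: smallest_sub; first exact: sigma_algebra_measurable.
exact: measurable_cylinder.
Qed.

Lemma measurable_other_id : measurable_fun [set: T] (id : T -> other_type).
Proof. by move=> _ B mB; rewrite setTI; exact: other_measurable. Qed.

Lemma measurable_other_rv i : i != j ->
  measurable_fun [set: other_type] (X i : other_type -> borel_rV R n).
Proof.
move=> ij _ B mB; rewrite setTI; apply: sub_sigma_algebra.
exists (fun l => if l == i then B else setT); split.
- by move=> l; case: eqP => // _; exact: measurableT.
- by rewrite eq_sym (negbTE ij).
- apply/seteqP; split=> [w Bw l _ /=|w /(_ i I)]; last by rewrite /= eqxx.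
  by case: eqP => [->|].
Qed.

(** For fixed [B] both sides are finite measures in [A]. They agree on cylinders, by the product
    rule, and cylinders are stable under intersection. *)
Lemma independent_other (A : set T) (B : set (borel_rV R n)) :
  measurable (A : set other_type) -> measurable B ->
  Pr (A `&` X j @^-1` B) = Pr A * L B.
Proof.
move=> mA mB.
have LB0 : (0 <= fine (L B))%R by rewrite fine_ge0.
have LBE : (fine (L B))%:E = L B by rewrite fineK ?fin_num_measure.
pose m1 := mrestr Pr (measurable_rv j mB); pose m2 := mscale (NngNum LB0) Pr.
have m1E D : m1 D = Pr (D `&` X j @^-1` B) by [].
have m2E D : m2 D = (fine (L B))%:E * Pr D by [].
have cT : cylinders setT.
  exists (fun=> setT); split=> //.
  by apply/seteqP; split=> // w _ i _.
suff : m1 A = m2 A by rewrite m1E m2E LBE muleC.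
apply: (@g_sigma_algebra_measure_unique _ R T cylinders _ (fun=> setT)) => //.
- by move=> D /measurable_cylinder.
- by rewrite bigcup_const //; exists 0%N.
- move=> _ _ [B1 [mB1 B1j ->]] [B2 [mB2 B2j ->]].
  exists (fun i => B1 i `&` B2 i); split=> [i||].
  + exact: measurableI.
  + by rewrite B1j B2j setTI.
  + apply/seteqP; split=> [w [w1 w2] i _|w H]; first by split; [exact: w1|exact: w2].
    by split=> i _; have [] := H i I.
- move=> _ [B1 [mB1 B1j ->]]; rewrite [LHS]m1E [RHS]m2E LBE -(lawX j) //.
  pose B2 i := if i == j then B else B1 i.
  have mB2 i : measurable (B2 i) by rewrite /B2; case: eqP.
  have -> : \bigcap_(i in setT) (X i @^-1` B1 i) `&` X j @^-1` B =
      \bigcap_(i in setT) (X i @^-1` B2 i).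
    apply/seteqP; split=> [w [w1 wB] i _|w w2].
      by rewrite /B2 /=; case: eqP => [->//|_]; exact: w1.
    split; last by have := w2 j I; rewrite /B2 /= eqxx.
    move=> i _ /=; have := w2 i I; rewrite /B2 /=; case: eqP => // ->.
    by rewrite B1j.
  have E1 := indepX mB1; have E2 := indepX mB2.
  rewrite [X in Pr X]/(\bigcap_i _) in E1.
  rewrite E1 E2 (bigD1 j) //= [in RHS](bigD1 j) //= B1j preimage_setT probability_setT mul1e.
  rewrite /B2 eqxx; congr (_ * _); apply: eq_bigr => i /negbTE ij.
  by rewrite ij.
- by move=> _; rewrite [ltLHS]m1E setTI (le_lt_trans (probability_le1 _ _)) ?ltry //;
    exact: measurable_rv.
Qed.

Definition with_other (w : T) : other_type * borel_rV R n := (w, X j w).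

Lemma measurable_with_other : measurable_fun [set: T] with_other.
Proof.
apply/measurable_fun_pairP; split=> /=; first exact: measurable_other_id.
exact: measurable_funP.
Qed.

(* Fubini: freeze all the variables but [X j]. *)
Lemma frozen_null (S : set (other_type * borel_rV R n)) : measurable S ->
  (forall w, L (xsection S w) = 0) -> Pr [set w | S (w, X j w)] = 0.
Proof.
move=> mS S0.
pose m1 := distribution Pr (mk_mfun measurable_other_id).
pose m12 := distribution Pr (mk_mfun measurable_with_other).
have H (A : set other_type) (B : set (borel_rV R n)) :
    measurable A -> measurable B -> m12 (A `*` B) = m1 A * L B.
  by move=> mA mB; rewrite -independent_other.
apply: (etrans (esym (product_measure_unique H mS))).
rewrite /product_measure1 -[RHS](@integral0 _ _ _ m1 setT); apply: eq_integral => w _ /=.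
exact: S0.
Qed.

End one_index.

End independence.

Section facet_hyperplane.
Context {R : realType} {n k : nat}.
Local Open Scope ereal_scope.
Variables (L : {measure set (borel_rV R n) -> \bar R}) (F : set 'rV[R]_n).
Variables (C : 'M[R]_(n, k.+1)) (b : 'rV[R]_k.+1) (C' : 'M[R]_(k.+1, n)) (b' : 'rV[R]_n).
Hypothesis chF : is_chart F (affine_map C b) (affine_map C' b').
Variables (kap BF : R).
Hypothesis lawF : forall B : set 'rV[R]_k.+1, measurable (B : set (borel_rV R k.+1)) ->
    L (F `&` affine_map C b @^-1` B) = kap%:E * leb (affine_map C b @` F `&` B).
Hypothesis bdQ : forall y, (affine_map C b @` F) y -> forall j, (`|y 0 j| <= BF)%R.

(** In the chart the functional is [dotv w y + c0]. If [w = 0] it is constant, and nonzero because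
    of [e]; otherwise its zeros form a hyperplane of the chart, whose bounded part has measure 0. *)
Lemma facet_hyperplane_null e (c : 'cV[R]_(n + 1)) : F e -> (hm e *m c) 0%R 0%R != 0%R ->
  L (F `&` [set x | (hm x *m c) 0 0 = 0]%R) = 0.
Proof.
move=> Fe ce; pose c' := affine_mx C' b' *m c.
pose w := (usubmx c')^T; pose c0 := (dsubmx c') 0%R 0%R.
have E x : F x -> ((hm x *m c) 0 0 = dotv w (affine_map C b x) + c0)%R.
  move=> Fx; have [_ phK _] := chF.
  rewrite -[in LHS](phK _ Fx) hm_affine_map -mulmxA -/c' -[c']vsubmxK /hm mul_row_col mul1mx.
  by rewrite mxE; congr (_ + _)%R; rewrite dotvC /dotv trmxK.
have [w0|w0] := eqVneq w 0%R.
  rewrite (_ : _ `&` _ = set0) ?measure0 //; apply/seteqP; split=> // x [Fx /=].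
  move: ce; rewrite !E // w0 !dotv0 => /negP ce ?; apply: ce; exact/eqP.
have -> : F `&` [set x | (hm x *m c) 0 0 = 0]%R =
    F `&` affine_map C b @^-1` [set y | dotv w y = - c0]%R.
  apply/seteqP; split=> x [Fx /= xc]; split=> //=.
    by apply/eqP; rewrite -subr_eq0 opprK -E // xc.
  by rewrite E // xc addNr.
rewrite lawF; last exact: measurable_hyperplane.
suff -> : leb (affine_map C b @` F `&` [set y | dotv w y = - c0]%R) = 0 by rewrite mule0.
apply/eqP; rewrite eq_le leb_ge0 andbT -(leb_hyperplane0 (- c0)%R BF w0).
apply: le_lebesgue_rV => y [Qy yc]; split=> //= j; exact: bdQ.
Qed.

End facet_hyperplane.

(** * Measurability of determinants and cofactors *)

Section measurable_entries.
Context {R : realType}.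

Lemma measurable_det d (T : measurableType d) m (A : T -> 'M[R]_m) :
  (forall i j, measurable_fun [set: T] (fun w => A w i j)) ->
  measurable_fun [set: T] (fun w => \det (A w)).
Proof.
move=> mA; rewrite /determinant; apply: measurable_sum => s.
apply: measurable_funM; first exact: measurable_cst.
by apply: measurable_prod => i _; exact: mA.
Qed.

Lemma measurable_borel_real n (f : 'rV[R]_n -> R) : continuous f ->
  measurable_fun [set: borel_rV R n] (f : borel_rV R n -> R).
Proof.
move=> cf; apply: (measurability _ (RGenOpens.measurableE R)).
move=> _ [_ [a [c ->] <-]]; rewrite setTI; apply: open_borel.
by move/continuousP: cf; apply; exact: interval_open.
Qed.

Lemma measurable_hm n (r : 'I_(n + 1)) :
  measurable_fun [set: borel_rV R n] ((fun x => hm x 0 r) : borel_rV R n -> R).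
Proof.
apply: measurable_borel_real.
have -> : (fun x : 'rV[R]_n => hm x 0 r) =
    match fintype.split r with inl j => fun x => x 0 j | inr _ => fun=> 1 end.
  apply/funext => x; rewrite /hm mxE; case: fintype.split => j //.
  by rewrite (ord1 j) mxE eqxx mulr1n.
by case: fintype.split => j; [exact: coord_continuous|exact: cst_continuous].
Qed.

Lemma measurable_mulmx d (T : measurableType d) m q l (A : T -> 'M[R]_(m, q)) (B : T -> 'M[R]_(q, l)) :
  (forall i j, measurable_fun [set: T] (fun w => A w i j)) ->
  (forall i j, measurable_fun [set: T] (fun w => B w i j)) ->
  forall i j, measurable_fun [set: T] (fun w => (A w *m B w) i j).
Proof.
move=> mA mB i j; under eq_fun do rewrite mxE.
by apply: measurable_sum => r; apply: measurable_funM.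
Qed.

(** The cofactor does not read the row [i]. When that row is the random point [X j], the cofactor is
    measurable with respect to the other points. *)
Lemma measurable_cofactor d (T : measurableType d) m (A : T -> 'M[R]_m) (i j : 'I_m) :
  (forall r l, r != i -> measurable_fun [set: T] (fun w => A w r l)) ->
  measurable_fun [set: T] (fun w => cofactor (A w) i j).
Proof.
move=> mA; rewrite /cofactor; apply: measurable_funM; first exact: measurable_cst.
apply: measurable_det => r l; under eq_fun do rewrite !mxE.
by apply: mA; rewrite eq_sym neq_lift.
Qed.

Lemma cofactor_eq_row m (A B : 'M[R]_m) i j : (forall r l, r != i -> A r l = B r l) ->
  cofactor A i j = cofactor B i j.
Proof.
move=> AB; rewrite /cofactor; congr (_ * \det _); apply/matrixP => r l.
by rewrite !mxE AB // eq_sym neq_lift.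
Qed.

End measurable_entries.

Section null_events.
Context {R : realType} {n : nat} {disp : measure_display} {T : measurableType disp}.
Variables (Pr : probability T R) (N : nat).
Variable X : 'I_N -> {RV Pr >-> borel_rV R n}.
Variable L : probability (borel_rV R n) R.
Hypothesis indepX : independent_rv X.
Hypothesis lawX : forall i (B : set (borel_rV R n)), measurable B ->
  Pr (X i @^-1` B) = L B.

Lemma ae_law i (B : set 'rV[R]_n) : measurable (B : set (borel_rV R n)) ->
  L B = 0%E -> {ae Pr, forall w, ~ B (X i w)}.
Proof.
move=> mB LB; exists (X i @^-1` B); split; first exact: measurable_rv.
  by rewrite lawX.
by move=> w /= /contrapT.
Qed.

(** With the other points frozen, [v w] is a fixed functional. If it vanishes at [e], the section of
    the bad event is empty; otherwise its zeros on [F] are null by hypothesis. *)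
Lemma ae_affine_null (j : 'I_N) (F : set 'rV[R]_n) (e : 'rV[R]_n)
    (v : T -> 'cV[R]_(n + 1)) :
  closed F ->
  (forall c : 'cV[R]_(n + 1), (hm e *m c) 0 0 != 0 ->
     L (F `&` [set x | (hm x *m c) 0 0 = 0]) = 0%E) ->
  (forall r, measurable_fun [set: other_type X j] (fun w => v w r 0)) ->
  {ae Pr, forall w, F (X j w) -> (hm e *m v w) 0 0 != 0 -> (hm (X j w) *m v w) 0 0 != 0}.
Proof.
move=> cF HN mv.
pose D (q : other_type X j * borel_rV R n) : R := (hm (q.2 : 'rV[R]_n) *m v q.1) 0 0.
pose De (q : other_type X j * borel_rV R n) : R := (hm e *m v q.1) 0 0.
have mv' r l : measurable_fun [set: other_type X j * borel_rV R n] (fun q => v q.1 r l).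
  by rewrite (ord1 l); exact: (measurableT_comp (mv r) measurable_fst).
have mD : measurable_fun [set: other_type X j * borel_rV R n] D.
  apply: measurable_mulmx => // i r; rewrite (ord1 i).
  exact: (measurableT_comp (@measurable_hm R n r) measurable_snd).
have mDe : measurable_fun [set: other_type X j * borel_rV R n] De.
  by apply: measurable_mulmx => // i r; exact: measurable_cst.
pose S : set (other_type X j * borel_rV R n) :=
  (snd @^-1` (F : set (borel_rV R n))) `&` (D @^-1` [set 0] `&` De @^-1` (~` [set 0])).
have mS : measurable S.
  apply: measurableI; last apply: measurableI.
  - rewrite -[X in measurable X]setTI; apply: measurable_snd => //; exact: closed_borel.
  - by rewrite -[X in measurable X]setTI; apply: mD.
  - rewrite -[X in measurable X]setTI; apply: mDe => //; exact: measurableC.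
have S0 : Pr [set w | S (w, X j w)] = 0%E.
  apply: (frozen_null indepX lawX mS) => w.
  have [z|nz] := eqVneq ((hm e *m v w) 0 0) 0.
    rewrite (_ : xsection S w = set0) ?measure0 //; apply/seteqP; split=> // x.
    by rewrite /xsection /= inE /S /De /= => -[_ [_]]; rewrite z.
  apply/eqP; rewrite eq_le measure_ge0 andbT -(HN _ nz); apply: le_measure.
  - by rewrite inE; exact: measurable_xsection.
  - rewrite inE; apply: measurableI; first exact: closed_borel.
    rewrite (_ : [set x | _] = (fun x : 'rV[R]_n => (hm x *m v w) 0 0) @^-1` [set 0]) //.
    rewrite -[X in measurable X]setTI.
    apply: (@measurable_mulmx _ _ (borel_rV R n) _ _ _ (fun x => hm (x : 'rV[R]_n)) (fun=> v w)) => //.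
      by move=> i r; rewrite (ord1 i); exact: measurable_hm.
  - by move=> x; rewrite /xsection /= inE /S /D /= => -[Fx [Dx _]].
exists [set w | S (w, X j w)]; split => //.
  have mw : measurable_fun [set: T] (with_other X j) by exact: measurable_with_other.
  by have := mw measurableT S mS; rewrite setTI.
move=> w /= /not_implyP[Fw /not_implyP[De0 /negP/negPn/eqP D0]].
by split => //; split => //=; exact/eqP.
Qed.

End null_events.

(** * Almost sure general position *)

Section almost_everywhere_logic.
Context {R : realType} {disp : measure_display} {T : measurableType disp}.
Variable Pr : {measure set T -> \bar R}.

Lemma aeS (P Q : T -> Prop) : {ae Pr, forall w, P w} -> (forall w, P w -> Q w) ->
  {ae Pr, forall w, Q w}.
Proof.
move=> [Z [mZ Z0 PZ]] PQ; exists Z; split=> // w nQ.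
by apply: PZ => Pw; apply: nQ; exact: PQ.
Qed.

Lemma ae_and (P Q : T -> Prop) : {ae Pr, forall w, P w} -> {ae Pr, forall w, Q w} ->
  {ae Pr, forall w, P w /\ Q w}.
Proof.
move=> nP nQ; have := negligibleU nP nQ; apply: negligibleS => w /= /not_andP[]; by [left|right].
Qed.

End almost_everywhere_logic.

Section general_position_ae.
Context {R : realType} {k : nat} {disp : measure_display} {T : measurableType disp}.
Variables (Pr : probability T R) (N : nat).
Variable X : 'I_N -> {RV Pr >-> borel_rV R k.+2}.
Variable L : probability (borel_rV R k.+2) R.
Hypothesis indepX : independent_rv X.
Hypothesis lawX : forall i (B : set (borel_rV R k.+2)), measurable B ->
  Pr (X i @^-1` B) = L B.

Section one_facet.
Variables (F : set 'rV[R]_k.+2) (C : 'M[R]_(k.+2, k.+1)) (b : 'rV[R]_k.+1).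
Hypothesis cF : closed F.
Hypothesis HN : forall (e : 'rV[R]_k.+2) (c : 'cV[R]_(k.+2 + 1)), F e -> (hm e *m c) 0 0 != 0 ->
     L (F `&` [set x | (hm x *m c) 0 0 = 0]) = 0%E.

(* Exchange: the points of an affine basis [e] of [F] are replaced by random
   points one at a time, the determinant staying nonzero. *)
Lemma ae_row_free_facet m (e : 'I_m -> 'rV[R]_k.+2) (i : 'I_m -> 'I_N) :
  m = (k.+1 + 1)%N -> (forall l, F (e l)) -> row_free (hmx (affine_map C b \o e)) ->
  injective i ->
  {ae Pr, forall w, (forall l, F (X (i l) w)) ->
    row_free (hmx (affine_map C b \o (fun l => X (i l) w)))}.
Proof.
move=> Em; subst m => Fe fe inj.
pose M (l : nat) w : 'M[R]_(k.+1 + 1) := \matrix_r hm (affine_map C b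
  (if (r < l)%N then X (i r) w : 'rV[R]_k.+2 else e r)).
have M0 w : \det (M 0%N w) != 0.
  by move: fe; rewrite row_free_unit unitmxE unitfE.
suff H l : (l <= k.+1 + 1)%N ->
    {ae Pr, forall w, (forall r, F (X (i r) w)) -> \det (M l w) != 0}.
  have HH := H (k.+1 + 1)%N (leqnn _).
  apply: (aeS HH) => w Hw /Hw.
  rewrite row_free_unit unitmxE unitfE.
  suff -> : M (k.+1 + 1)%N w = hmx (affine_map C b \o (fun l => X (i l) w)) by [].
  by apply/row_matrixP => r; rewrite rowK row_hmx /= ltn_ord.
elim: l => [_|l IH lk]; first by apply: aeW => w _; exact: M0.
pose l0 := Ordinal lk.
(* As a function of its row [l0] the determinant is linear, and its coefficients are the cofactors,
   which involve only the other points. *)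
pose v w : 'cV[R]_(k.+2 + 1) := affine_mx C b *m \col_c cofactor (M l w) l0 c.
have detE w (A : 'M[R]_(k.+1 + 1)) x : row l0 A = hm (affine_map C b x) ->
    (forall r c, r != l0 -> A r c = M l w r c) -> \det A = (hm x *m v w) 0 0.
  move=> Al AM; rewrite (expand_det_row _ l0) /v mulmxA -hm_affine_map -Al mxE.
  by apply: eq_bigr => c _; rewrite !mxE (cofactor_eq_row (B := M l w)).
have Me w : \det (M l w) = (hm (e l0) *m v w) 0 0.
  by apply: detE => //; rewrite rowK ltnn.
have MX w : \det (M l.+1 w) = (hm (X (i l0) w : 'rV[R]_k.+2) *m v w) 0 0.
  apply: detE => [|r c rl]; first by rewrite rowK /= ltnSn.
  rewrite [LHS]mxE [RHS]mxE; congr (hm (affine_map C b _) 0 c).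
  have rl' : (r != l :> nat) by apply: contraNneq rl => rl; apply/eqP/val_inj.
  by rewrite ltnS leq_eqVlt (negbTE rl').
have mv r : measurable_fun [set: other_type X (i l0)] (fun w => v w r 0).
  apply: measurable_mulmx => [? ?|c q]; first exact: measurable_cst.
  under eq_fun do rewrite mxE.
  apply: measurable_cofactor => s t sl; under eq_fun do rewrite mxE.
  case: (ltnP s l) => sl'; last exact: measurable_cst.
  have mh := measurableT_comp (@measurable_hm R k.+1 t)
    (measurable_borel_continuous (@affine_map_continuous R _ _ C b)).
  apply: (measurableT_comp mh); apply: measurable_other_rv.
  by rewrite (inj_eq inj).
have := ae_affine_null indepX lawX cF (fun c => @HN (e l0) c (Fe l0)) mv.
move=> /(ae_and (IH (ltnW lk))) IHH; apply: (aeS IHH) => w [H1 H2] FX.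
by rewrite MX; apply: H2 => //; rewrite -Me; exact: H1.
Qed.

(** With the points [X (i l)] as the other rows, the determinant is an affine functional of the last
    point. It does not vanish at [e], so it almost surely does not vanish at [X j] on [F]. *)
Lemma ae_avoid_hyperplane (e : 'rV[R]_k.+2) m (i : 'I_m -> 'I_N) j :
  m = k.+2 -> F e -> (forall l, i l != j) ->
  {ae Pr, forall w, F (X j w) -> row_free (hmx (fun l => X (i l) w : 'rV[R]_k.+2)) ->
     ~~ (hm e <= hmx (fun l => X (i l) w : 'rV[R]_k.+2))%MS ->
     ~~ (hm (X j w : 'rV[R]_k.+2) <= hmx (fun l => X (i l) w : 'rV[R]_k.+2))%MS}.
Proof.
move=> Em; subst m => Fe ij.
pose l0 : 'I_(k.+2 + 1) := rshift k.+2 ord0.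
pose M w (x : 'rV[R]_k.+2) : 'M[R]_(k.+2 + 1) :=
  hmx (rcons_fam (fun l => X (i l) w : 'rV[R]_k.+2) x).
pose v w : 'cV[R]_(k.+2 + 1) := \col_c cofactor (M w 0) l0 c.
have rE w (r : 'I_(k.+2 + 1)) : r != l0 -> exists l, forall x,
    rcons_fam (fun l => X (i l) w : 'rV[R]_k.+2) x r = X (i l) w.
  move=> rl; have [l rE] : exists l, r = lshift 1 l.
    rewrite -(splitK r); case: (fintype.split r) rl (splitK r) => [l|l] rl rE.
      by exists l.
    by move: rl; rewrite -rE /= (ord1 l) eqxx.
  by exists l => y; rewrite rE /rcons_fam (unsplitK (inl l)).
have detE w x : \det (M w x) = (hm x *m v w) 0 0.
  rewrite (expand_det_row _ l0) mxE; apply: eq_bigr => c _; rewrite [v w _ _]mxE.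
  rewrite (cofactor_eq_row (B := M w 0)) => [|r q rl].
    congr (_ * _); rewrite mxE /rcons_fam.
    by rewrite (unsplitK (inr ord0)).
  by have [l lE] := rE w r rl; rewrite [LHS]mxE [RHS]mxE !lE.
have mv r : measurable_fun [set: other_type X j] (fun w => v w r 0).
  under eq_fun do rewrite mxE.
  apply: measurable_cofactor => s t sl.
  have [l sE] : exists l, s = lshift 1 l.
    rewrite -(splitK s); case: (fintype.split s) sl (splitK s) => [l|l] sl sE.
      by exists l.
    by move: sl; rewrite -sE /= (ord1 l) eqxx.
  rewrite (_ : (fun w => _) = (fun w => hm (X (i l) w : 'rV[R]_k.+2) 0 t)).
    apply: (measurableT_comp (@measurable_hm R k.+2 t)).
    by apply: measurable_other_rv.
  by apply/funext => w; rewrite mxE sE /rcons_fam (unsplitK (inl l)).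
have := ae_affine_null indepX lawX cF (fun c => @HN e c Fe) mv.
move=> HH; apply: (aeS HH) => w H FX fi ei.
have det_free x : (\det (M w x) != 0) = row_free (M w x).
  by rewrite row_free_unit unitmxE unitfE.
have : row_free (M w (X j w)).
  rewrite -det_free detE; apply: H => //; rewrite -detE det_free.
  exact: row_free_rcons.
rewrite /M hmx_rcons => /eqP rk; apply/negP => xi.
have : (\rank (col_mx (hmx (fun l => X (i l) w : 'rV[R]_k.+2)) (hm (X j w : 'rV[R]_k.+2))) <= k.+2)%N.
  rewrite -addsmxE; apply: leq_trans (rank_leq_row (hmx (fun l => X (i l) w : 'rV[R]_k.+2))).
  by apply: mxrankS; rewrite addsmx_sub submx_refl.
by rewrite rk addn1 ltnn.
Qed.

End one_facet.

End general_position_ae.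

(** * The facets of the polytope, their charts and their probabilities *)

Section facets.
Context {R : realType} {k K : nat}.
Variable p : 'I_K -> 'rV[R]_k.+2.
Variable L : probability (borel_rV R k.+2) R.
Variable M : R.

Definition hull (J : {set 'I_K}) : set 'rV[R]_k.+2 := conv_hull (p @` [set` J]).
Let P := hull [set: 'I_K].

Hypothesis dimP : has_dim P k.+2.
Hypothesis M0 : 0 < M.
Hypothesis LH : forall B : set 'rV[R]_k.+2, measurable (B : set (borel_rV R k.+2)) ->
  (M%:E * L B)%E = hausdorff k.+1 (boundary P `&` B).

Definition facet_type := {J : {set 'I_K} | J \in facesets p [set: 'I_K] k.+1}.

(** All that is used about a facet, with its functional and chart as explicit data to be chosen once
    for all facets. The law is written in normalised form, to match [uniform_on] after conditioning;
    the last clause is the source of general position. *)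
Definition facet_spec (F : facet_type) (u : 'rV[R]_k.+2) (a : R)
    (C : 'M[R]_(k.+2, k.+1)) (b : 'rV[R]_k.+1) : Prop :=
  [/\ forall x, P x -> dotv u x <= a,
      hull (val F) = P `&` [set x | dotv u x = a] /\ val F = tight p [set: 'I_K] u a,
      exists C' b', is_chart (hull (val F)) (affine_map C b) (affine_map C' b'),
      (0 < L (hull (val F)))%E /\ (forall B : set 'rV[R]_k.+1, measurable (B : set (borel_rV R k.+1)) ->
        L (hull (val F) `&` affine_map C b @^-1` B) =
        (L (hull (val F)) * (lebesgue_rV (affine_map C b @` hull (val F) `&` B) /
          lebesgue_rV (affine_map C b @` hull (val F))))%E)
    & forall (e : 'rV[R]_k.+2) (c : 'cV[R]_(k.+2 + 1)), hull (val F) e -> (hm e *m c) 0 0 != 0 ->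
        L (hull (val F) `&` [set x | (hm x *m c) 0 0 = 0]) = 0%E].

Lemma dim_facet (F : facet_type) : has_dim (hull (val F)) k.+1.
Proof. by have [] := facesets_face (valP F). Qed.

Lemma closed_hull J : closed (hull J).
Proof. exact: conv_hull_closed. Qed.

Lemma facet_spec_exists (F : facet_type) : exists u a C b, facet_spec F u a C b.
Proof.
have /facesetsP[[u [a [Sa JE]]] _] := valP F.
have dF := dim_facet F.
have Pa x : P x -> dotv u x <= a.
  by apply: conv_hull_le => _ [i _ <-]; apply: Sa; rewrite inE.
have FE : hull (val F) = P `&` [set x | dotv u x = a].
  by rewrite /hull JE -conv_hull_face.
have u0 : u != 0 by apply: (@facet_normal_neq0 _ _ P u a) => //; rewrite -FE.
have [C [b [C' [b' ch]]]] := chart_exists dF (@conv_hull_convex _ _ _).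
exists u, a, C, b.
have FD : hull (val F) `<=` boundary P by rewrite FE; exact: face_sub_boundary.
have [BF bdF] := conv_hull_bounded p (val F).
have Lfin : (L setT < +oo)%E by rewrite probability_setT ltry.
have clF := @closed_hull (val F).
have [kap kap0 law] := facet_law M0 Lfin LH clF FD ch bdF.
set Q := affine_map C b @` hull (val F) in law *.
have Qfin : (leb Q < +oo)%E := leb_chart_image_fin C b bdF.
have Q0 : (0 < leb Q)%E := leb_chart_image_gt0 ch.
have QE : leb Q = (fine (leb Q))%:E by rewrite fineK // ge0_fin_numE // ltW.
have q0 : 0 < fine (leb Q) by rewrite -lte_fin -QE.
have lawT : L (hull (val F)) = (kap%:E * leb Q)%E.
  by have := law setT measurableT; rewrite preimage_setT !setIT.
split=> //.
- by exists C', b'.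
- split=> [|B mB]; first by rewrite lawT mule_gt0.
  rewrite law // lawT -[lebesgue_rV Q]/(leb Q) QE -[lebesgue_rV _]/(leb (Q `&` B)).
  rewrite inver gt_eqF // -[RHS]muleA; congr (_ * _)%E.
  by rewrite muleCA -EFinM divff ?gt_eqF // mule1.
- move=> e c Fe ce; have [BQ QB] : exists BQ : R, forall y, Q y -> forall j, `|y 0 j| <= BQ.
    have imQ : Q = conv_hull ((affine_map C b \o p) @` [set` val F]).
      by rewrite -image_comp -affine_conv_hull.
    have [BQ bQ] := conv_hull_bounded (affine_map C b \o p) (val F).
    by exists BQ => y; rewrite imQ; exact: bQ.
  exact: (facet_hyperplane_null ch law QB Fe ce).
Qed.

Section chosen.
Variables (u : facet_type -> 'rV[R]_k.+2) (a : facet_type -> R).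
Variables (C : facet_type -> 'M[R]_(k.+2, k.+1)) (b : facet_type -> 'rV[R]_k.+1).
Hypothesis spec : forall F, facet_spec F (u F) (a F) (C F) (b F).

(** Otherwise [F] is contained in [F']. Having the same dimension, they have the same affine hull,
    so [F'] lies in the hyperplane of [F] and the two coincide. *)
Lemma facets_distinct F F' : F != F' ->
  exists2 e, hull (val F) e & dotv (u F') e != a F'.
Proof.
move=> FF'; apply: contrapT => H.
have sub x : hull (val F) x -> dotv (u F') x = a F'.
  by move=> Fx; apply/eqP; apply: contrapT => /negP nx; apply: H; exists x.
have [_ [FE _] _ _ _] := spec F; have [_ [FE' _] _ _ _] := spec F'.
have FsubF' : hull (val F) `<=` hull (val F').
  by move=> x Fx; rewrite FE'; split; [move: Fx; rewrite FE => -[]|exact: sub].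
have /has_dimP[e [Fe fe full]] := dim_facet F.
have full' := has_dim_full (dim_facet F') erefl (fun i => FsubF' _ (Fe i)) fe.
case/negP: FF'; apply/eqP/val_inj.
apply: (facesets_inj (valP F) (valP F')); rewrite -/(hull (val F)) -/(hull (val F')).
apply/seteqP; split=> // x Fx; rewrite -/(hull (val F)) FE; split.
  by move: Fx; rewrite -/(hull (val F')) FE' => -[].
apply/eqP; apply: contraT => nx.
have eF i : dotv (u F) (e i) = a F by have := Fe i; rewrite FE => -[].
by have := not_sub_hmx eF nx; rewrite full'.
Qed.

Lemma facet_inter_null F F' : F != F' ->
  L (hull (val F) `&` [set x | dotv (u F') x = a F']) = 0%E.
Proof.
move=> FF'; have [e Fe ne] := facets_distinct FF'.
have [_ _ _ _ HN] := spec F.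
have E x : (hm x *m affine_col (u F') (a F')) 0 0 = dotv (u F') x - a F'.
  by rewrite hm_affine_col mxE eqxx mulr1n.
have := HN e (affine_col (u F') (a F')) Fe; rewrite E subr_eq0 => /(_ ne) <-.
congr (L _); congr (_ `&` _); apply/seteqP; split=> x /=; rewrite E => /eqP.
  by rewrite -subr_eq0 => /eqP.
by rewrite subr_eq0 => /eqP.
Qed.

(** The top element of a flag of the chart image is a ridge. Rotation around it, applied to the
    vertices of the polytope itself, gives another facet; it has positive probability and meets [F]
    in a null set. *)
Lemma facet_proba_lt1 F : (0 < #|flagsets (affine_map (C F) (b F) \o p) (val F)|)%N ->
  (L (hull (val F)) < 1)%E.
Proof.
move=> /card_gt0P[g /flagsetsP[/(_ ord_max) gG _]]; set G := g ord_max in gG.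
have [Pa [FE JE] _ _ _] := spec F.
have /facesetsP[[v [c [vc GE]]] dG] := gG.
have /has_dimP[e [eG fe _]] := dG.
have [h hG he] := fin_all_exists2 eG.
have fh : row_free (hmx (p \o h)).
  apply: (@row_free_affine_map _ _ _ (C F) (b F)).
  by rewrite (_ : hmx _ = hmx e) //; apply/row_matrixP => i; rewrite !row_hmx -he.
have [j jJ] : exists j, j \notin val F.
  apply/existsP; rewrite -negb_forall; apply/negP => /forallP JT.
  have FT : val F = [set: 'I_K]%SET by apply/finset.setP => j; rewrite JT inE.
  have dFT := dim_facet F; rewrite FT in dFT.
  by have /n_Sn := has_dim_uniq dFT dimP.
have [i iJ iG] : exists2 i, i \in val F & i \notin G.
  apply: contrapT => H; have JG : val F = G.
    apply/finset.setP => i; apply/idP/idP => [iJ|]; last by rewrite GE inE => /andP[].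
    by apply: contraT => iG; case: H; exists i.
  have [_ _ [C' [b' ch]] _ _] := spec F.
  have dQ : has_dim ((affine_map (C F) (b F) \o p) @` [set` G]) k.+1.
    rewrite -image_comp; apply: (has_dim_chart ch).
      by rewrite -JG; exact: sub_conv_hull.
    by apply/has_dim_conv_hull; rewrite -JG; exact: dim_facet.
  by have := has_dim_uniq dQ dG => /esym /n_Sn.
have vE l : dotv v (affine_map (C F) (b F) (p l)) - c =
    dotv (v *m (C F)^T) (p l) - (c - dotv v (b F)).
  by rewrite dotv_affine_map; ring.
have [|||E EE [_ [l lE lJ]]] := @facet_of_ridge _ _ _ p (val F) G (u F) (a F)
    (v *m (C F)^T) (c - dotv v (b F)) h _ JE _ _ hG fh (ex_intro _ j jJ) (ex_intro2 _ _ i iJ iG).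
- by move=> l; apply: Pa; apply: sub_conv_hull; exists l => //=; rewrite inE.
- by move=> l lJ; rewrite -subr_le0 -vE subr_le0; exact: vc.
- by apply/finset.setP => l; rewrite GE !inE; congr (_ && _); rewrite -subr_eq0 vE subr_eq0.
pose F' : facet_type := exist _ E EE.
have FF' : F != F' by apply: contraNneq lJ => FF'; rewrite FF'.
have [_ [FE' _] _ [L0 _] _] := spec F'.
have mh J : measurable (hull J : set (borel_rV R k.+2)) by apply: closed_borel; exact: closed_hull.
have disj : L (hull (val F) `&` hull (val F')) = 0%E.
  apply/eqP; rewrite eq_le measure_ge0 andbT -(facet_inter_null FF').
  apply: le_measure; rewrite ?inE.
  - exact: measurableI.
  - apply: measurableI => //; exact: measurable_hyperplane.
  - by apply: setIS; rewrite [X in X `<=` _]FE'; exact: subIsetr.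
apply: (@lt_le_trans _ _ (L (hull (val F)) + L (hull (val F')))%E).
  by rewrite lteDl // fin_num_measure.
have -> : (L (hull (val F)) + L (hull (val F')))%E = L (hull (val F) `|` hull (val F')).
  rewrite measureUfinl //; last by rewrite (le_lt_trans (probability_le1 _ _)) ?ltry.
  by rewrite [X in (_ = _ - X)%E](_ : _ = 0%E) ?sube0 //; exact: disj.
by apply: probability_le1; exact: measurableU.
Qed.

End chosen.

End facets.

Section random_points_on_facets.
Context {R : realType} {k K : nat}.
Variable p : 'I_K -> 'rV[R]_k.+2.
Variable L : probability (borel_rV R k.+2) R.
Variable M : R.
Let P := hull p [set: 'I_K].
Hypothesis M0 : 0 < M.
Hypothesis LH : forall B : set 'rV[R]_k.+2, measurable (B : set (borel_rV R k.+2)) ->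
  (M%:E * L B)%E = hausdorff k.+1 (boundary P `&` B).
Variables (u : facet_type p -> 'rV[R]_k.+2) (a : facet_type p -> R).
Variables (C : facet_type p -> 'M[R]_(k.+2, k.+1)) (b : facet_type p -> 'rV[R]_k.+1).
Hypothesis spec : forall F, facet_spec L F (u F) (a F) (C F) (b F).

Let psi F := affine_map (C F) (b F).

(** [P] is closed, so it contains its boundary, which carries all of [L]. *)
Lemma outside_null : L (~` P) = 0%E.
Proof.
have cP : closed P by exact: closed_hull.
have mP : measurable (P : set (borel_rV R k.+2)) by exact: closed_borel.
have : (M%:E * L P = M%:E)%E.
  rewrite LH // (_ : _ `&` P = boundary P `&` setT).
    by rewrite -LH ?probability_setT ?mule1 //; exact: measurableT.
  rewrite setIT; apply/setIidPl => x [cx _].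
  by move: cx; rewrite -(proj1 (closure_id P)).
have Lfin := fin_num_measure L _ mP.
rewrite -(fineK Lfin) -EFinM => -[ME].
have L1 : fine (L P) = 1 by apply: (mulfI (lt0r_neq0 M0)); rewrite mulr1.
rewrite probability_setC //= -[L P](fineK Lfin) L1 -EFinB subrr //.
Qed.

Lemma chart_flags_le :
  (nflags P <= \sum_(F : facet_type p) nflags (psi F @` hull p (val F)))%N.
Proof.
have H (F : facet_type p) : exists D : 'M[R]_(k.+1, k.+2) * 'rV[R]_k.+2,
    is_chart (hull p (val F)) (psi F) (affine_map D.1 D.2).
  by have [_ _ [C' [b' ch]] _ _] := spec F; exists (C', b').
have [D DP] := choice H.
(* Data indexed by facets are extended to all index sets by a default value. *)
pose ext V (x0 : V) (f : facet_type p -> V) (J : {set 'I_K}) : V :=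
  if insub J is Some F then f F else x0.
have extE V (x0 : V) f (F : facet_type p) : ext V x0 f (val F) = f F by rewrite /ext valK.
have := @card_flagsets_le R K k.+1 p [set: 'I_K]%SET (ext _ 0 C) (ext _ 0 b)
  (ext _ 0 (fun F => (D F).1)) (ext _ 0 (fun F => (D F).2)).
rewrite -nflagsE => H1; apply: (leq_trans (H1 _)).
  by move=> J JF; have := DP (exist _ J JF); rewrite -[J]/(val (exist (fun J => J \in _) J JF : facet_type p)) !extE.
rewrite big_sub; apply: leq_sum => F _; rewrite !extE.
by rewrite -nflagsE -image_comp -affine_conv_hull.
Qed.

Section sample.
Context {disp : measure_display} {T : measurableType disp}.
Variables (Pr : probability T R) (N : nat).
Variable X : 'I_N -> {RV Pr >-> borel_rV R k.+2}.
Hypothesis indepX : independent_rv X.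
Hypothesis lawX : forall i (B : set (borel_rV R k.+2)), measurable B ->
  Pr (X i @^-1` B) = L B.

(** Each clause is a finite conjunction of almost sure events; finite functions replace index maps
    to make the quantifiers finite. For the last clause, some point of a fixed affine basis of [F]
    lies off the span of the given [k.+2] points, and this witness serves to avoid the
    hyperplane. *)
Lemma ae_general_position : {ae Pr, forall w, (forall i, P (X i w)) /\
  general_position (fun i => X i w : 'rV[R]_k.+2) u a C b}.
Proof.
have He (F : facet_type p) : exists e : 'I_k.+2 -> 'rV[R]_k.+2,
    (forall h, hull p (val F) (e h)) /\ row_free (hmx e).
  by have /has_dimP[e [? ? _]] := dim_facet F; exists e.
have [e eP] := choice He.
have clF F : closed (hull p F) := @closed_hull _ _ _ p F.
have H1 : {ae Pr, forall w, forall i, P (X i w)}.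
  apply: filter_forall => i.
  have mC : measurable (~` P : set (borel_rV R k.+2)).
    by apply: measurableC; apply: closed_borel; exact: clF.
  by apply: (aeS (ae_law lawX i mC outside_null)) => w /contrapT.
have H2 : {ae Pr, forall w, forall q : facet_type p * facet_type p * 'I_N, q.1.1 != q.1.2 ->
    ~ (hull p (val q.1.1) `&` [set x | dotv (u q.1.2) x = a q.1.2]) (X q.2 w)}.
  apply: filter_forall => -[[F F'] i] /=; have [->|FF'] := eqVneq F F'.
    exact: aeW.
  have mI : measurable (hull p (val F) `&` [set x | dotv (u F') x = a F'] : set (borel_rV R k.+2)).
    by apply: measurableI; [apply: closed_borel; exact: clF|exact: measurable_hyperplane].
  by apply: (aeS (ae_law lawX i mI (facet_inter_null spec FF'))).
have H3 : {ae Pr, forall w, forall q : facet_type p * {ffun 'I_k.+2 -> 'I_N}, injective q.2 ->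
    (forall l, hull p (val q.1) (X (q.2 l) w)) ->
    row_free (hmx (psi q.1 \o (fun l => X (q.2 l) w)))}.
  apply: filter_forall => -[F i] /=; have [inj|ninj] := pselect (injective i); last exact: aeW.
  have [eF fe] := eP F; have [_ _ [C' [b' [_ phK _]]] _ HN] := spec F.
  have fe' : row_free (hmx (psi F \o e F)).
    apply: (@row_free_affine_map _ _ _ C' b').
    rewrite (_ : hmx _ = hmx (e F)) //; apply/row_matrixP => h.
    by rewrite !row_hmx /= phK.
  have HH := ae_row_free_facet indepX lawX (clF _) HN (esym (addn1 _)) eF fe' inj.
  by apply: (aeS HH) => w Hw _.
have H4 : {ae Pr, forall w, forall q : facet_type p * {ffun 'I_k.+2 -> 'I_N} * 'I_N * 'I_k.+2,
    (forall l, q.1.1.2 l != q.1.2) -> hull p (val q.1.1.1) (X q.1.2 w) ->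
    row_free (hmx (fun l => X (q.1.1.2 l) w : 'rV[R]_k.+2)) ->
    ~~ (hm (e q.1.1.1 q.2) <= hmx (fun l => X (q.1.1.2 l) w : 'rV[R]_k.+2))%MS ->
    ~~ (hm (X q.1.2 w : 'rV[R]_k.+2) <= hmx (fun l => X (q.1.1.2 l) w : 'rV[R]_k.+2))%MS}.
  apply: filter_forall => -[[[F i] j] h] /=.
  have [ij|nij] := pselect (forall l, i l != j); last exact: aeW.
  have [eF fe] := eP F; have [_ _ _ _ HN] := spec F.
  have HH := ae_avoid_hyperplane indepX lawX (clF _) HN (erefl _) (eF h) ij.
  by apply: (aeS HH) => w Hw _.
have H := ae_and (ae_and H1 H2) (ae_and H3 H4); apply: (aeS H) => w {H H1 H2 H3 H4}.
move=> [[H1 H2] [H3 H4]]; split=> //.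
have JE F i : (i \in tight (fun i => X i w : 'rV[R]_k.+2) [set: 'I_N] (u F) (a F)) ->
    hull p (val F) (X i w).
  rewrite !inE /= => /eqP Xi; have [_ [-> _] _ _ _] := spec F.
  by split; [exact: H1|].
have JEr F i : (i \in tight (fun i => X i w : 'rV[R]_k.+2) [set: 'I_N] (u F) (a F)) =
    (dotv (u F) (X i w) == a F) by rewrite !inE.
split.
- by move=> F i; have [Pa _ _ _ _] := spec F; apply: Pa; exact: H1.
- move=> F F' i FF' /JE Fi; rewrite JEr; apply/negP => /eqP Xi.
  by apply: (H2 (F, F', i)).
- move=> F i inj iJ.
  have := H3 (F, finfun i); rewrite /= => H.
  rewrite (_ : hmx _ = hmx (psi F \o (fun l => X ([ffun x => i x] l) w))); last first.
    by apply/row_matrixP => l; rewrite !row_hmx /= ffunE.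
  apply: H => [l l'|l]; rewrite !ffunE; [exact: inj|].
  by apply: JE.
move=> F m i j Em; subst m => fi [l il] jJ ij; apply/negP => xj.
have [eF fe] := eP F.
have xE : hmx ((fun i => X i w : 'rV[R]_k.+2) \o i) =
    hmx (fun l => X ([ffun x => i x] l) w : 'rV[R]_k.+2).
  by apply/row_matrixP => h; rewrite !row_hmx /= ffunE.
have sub h : (hm (e F h) <= hmx ((fun i => X i w : 'rV[R]_k.+2) \o i))%MS.
  apply: contraTT xj => eh; rewrite xE.
  apply: (H4 (F, [ffun x => i x], j, h)) => /=; rewrite -?xE //.
  - by move=> l'; rewrite ffunE.
  - exact: JE.
have esub : (hmx (e F) <= hmx ((fun i => X i w : 'rV[R]_k.+2) \o i))%MS by apply/hmx_sub.
(* Both spans have rank [k.+2]. If one contained the basis of [F] they would coincide, and all the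
   points would lie in the hyperplane of [F]. *)
have := mxrank_leqif_eq esub => -[_].
move: (fe) (fi) => /eqP -> /eqP ->; rewrite eqxx => /esym/andP[_ sube].
have : (hm (X (i l) w : 'rV[R]_k.+2) <= hmx (e F))%MS.
  apply: submx_trans sube.
  exact: (hm_sub_hmx ((fun i => X i w : 'rV[R]_k.+2) \o i) l).
apply/negP; apply: (@not_sub_hmx _ _ _ _ (u F) (a F)).
  by move=> h; have := eF h; have [_ [-> _] _ _ _] := spec F => -[].
by move: il; rewrite JEr.
Qed.

End sample.

End random_points_on_facets.

(** * Conditioning *)

Section conditioning.
Context {R : realType} {disp : measure_display} {T : measurableType disp}.
Variable Pr : probability T R.
Import HBNNSimple.
Local Open Scope ereal_scope.

(** For nonnegative functions the integral is a supremum over simple functions below, which is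
    monotone without measurability. *)
Lemma le_integral_ge0 (mu : {measure set T -> \bar R}) (f g : T -> \bar R) :
  (forall w, 0 <= f w) -> (forall w, f w <= g w) ->
  \int[mu]_w f w <= \int[mu]_w g w.
Proof.
move=> f0 fg; have g0 w : 0 <= g w by exact: le_trans (fg w).
rewrite !ge0_integralTE //; apply: le_ereal_sup => _ [h hf <-]; exists h => // w.
exact: le_trans (fg w).
Qed.

Lemma lt_integral_nnsfun (mu : {measure set T -> \bar R}) (f : T -> \bar R) x :
  (forall w, 0 <= f w) -> x < \int[mu]_w f w ->
  exists2 h : {nnsfun T >-> R}, (forall w, (h w)%:E <= f w) & x < \int[mu]_w (h w)%:E.
Proof.
move=> f0; rewrite ge0_integralTE // => /ereal_sup_gt[_ [h hf <-] xh].
by exists h => //; rewrite integralT_nnsfun.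
Qed.

(** If [E] is a null event, the normalisation falls back on [Pr]. *)
Definition cond_proba (E : set T) (mE : measurable E) : probability T R :=
  mnormalize (mrestr Pr mE) Pr.

Lemma cond_probaE (E : set T) (mE : measurable E) A : 0 < Pr E ->
  cond_proba mE A = Pr (A `&` E) * (fine (Pr E))^-1%:E.
Proof.
move=> E0; have -> : cond_proba mE A = (if (Pr (setT `&` E) == 0) || (Pr (setT `&` E) == +oo)
    then fun U => Pr U else fun U => Pr (U `&` E) * (fine (Pr (setT `&` E)))^-1%:E) A by [].
rewrite setTI gt_eqF //=.
by rewrite lt_eqF // (le_lt_trans (probability_le1 _ _)) ?ltry.
Qed.

Lemma integral_cond_proba (E : set T) (mE : measurable E) (h : {nnsfun T >-> R}) : 0 < Pr E ->
  \int[Pr]_w (\1_E w * h w)%:E = Pr E * \int[cond_proba mE]_w (h w)%:E.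
Proof.
move=> E0.
have Efin : Pr E \is a fin_num by exact: fin_num_measure.
have e0 : (0 < fine (Pr E))%R by rewrite -lte_fin fineK.
have mh D : measurable_fun D (fun w => (h w)%:E).
  by apply/measurable_EFinP; exact: measurable_funTS.
have h0 w : 0 <= (h w)%:E by rewrite lee_fin fun_ge0.
have mC : measurable (~` E) by exact: measurableC.
have C0 : cond_proba mE (~` E) = 0 by rewrite cond_probaE // setICl measure0 mul0e.
rewrite [X in _ * X](ge0_negligible_integral mC) // setTD setCK.
have [k kE] : exists k : {nonneg R}, Pr E = (k%:num)%:E.
  by exists (NngNum (ltW e0)); rewrite /= fineK.
rewrite kE -ge0_integral_mscale // -(@eq_measure_integral _ _ _ E (mscale k (cond_proba mE)) Pr).
  rewrite [RHS]integral_mkcond; apply: eq_integral => w _; rewrite patchE indicE.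
  by case: ifP => wE; rewrite ?mul1r ?mul0r.
move=> A mA AE; transitivity ((k%:num)%:E * cond_proba mE A) => //.
rewrite cond_probaE // -kE.
rewrite (setIidl AE) /= muleCA -[X in _ * (X * _)](fineK Efin) -EFinM divff ?mule1 //.
exact: lt0r_neq0.
Qed.

(* The integrand need not be measurable: its integral is then the lower
   integral, which is superadditive. *)
Lemma lower_integral_sum (I : finType) (D : pred I) (E : I -> set T)
    (mE : forall i, measurable (E i)) (v : I -> R) (g : I -> T -> R) (f : T -> R) :
  (forall w, (0 <= f w)%R) -> (forall i w, (0 <= g i w)%R) ->
  (forall i, D i -> 0 < Pr (E i)) ->
  (forall i, D i -> (v i)%:E < \int[cond_proba (mE i)]_w (g i w)%:E) ->
  {ae Pr, forall w, (\sum_(i | D i) \1_(E i) w * g i w <= f w)%R} ->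
  \sum_(i | D i) Pr (E i) * (v i)%:E <= \int[Pr]_w (f w)%:E.
Proof.
move=> f0 g0 E0 vg [Z [mZ Z0 ZP]].
(* The strict inequality on the lower integral provides a simple function below [g i] whose integral
   still exceeds [v i]. *)
have H i : exists h : {nnsfun T >-> R}, D i -> (forall w, (h w)%:E <= (g i w)%:E) /\
    (v i)%:E < \int[cond_proba (mE i)]_w (h w)%:E.
  have [Di|] := boolP (D i); last by exists nnsfun0.
  have g0' w : 0 <= (g i w)%:E by rewrite lee_fin.
  by have [h hg vh] := lt_integral_nnsfun g0' (vg i Di); exists h.
have [h hP] := choice H.
pose G w := \sum_(i <- [seq i <- index_enum I | D i]) (\1_(E i) w * h i w)%:E.
have h0 i w : 0 <= (\1_(E i) w * h i w)%:E by rewrite lee_fin mulr_ge0 // fun_ge0.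
have mh i A : measurable_fun A (fun w => (\1_(E i) w * h i w)%:E).
  apply: measurable_funTS; apply/measurable_EFinP; apply: measurable_funM => //.
apply: (@le_trans _ _ (\int[Pr]_w G w)).
  rewrite /G ge0_integral_sum // big_filter; apply: lee_sum => i Di.
  have [_ vh] := hP i Di; rewrite (integral_cond_proba (mE i)) ?E0 //.
  by apply: lee_wpmul2l; rewrite ?measure_ge0 // ltW.
have G0 w : 0 <= G w by apply: sume_ge0.
(* The exceptional set is removed from the measurable minorant [G]; to [f] only monotonicity is
   applied. *)
rewrite (ge0_negligible_integral mZ) //; last by apply: emeasurable_sum.
rewrite setTD integral_mkcond; apply: le_integral_ge0 => w; rewrite patchE.
  by case: ifP.
case: ifPn => [|_]; last by rewrite lee_fin.
rewrite inE => Zw; have : (\sum_(i | D i) \1_(E i) w * g i w <= f w)%R.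
  by apply: contrapT => nle; apply: Zw; exact: ZP.
rewrite -lee_fin; apply: le_trans; rewrite /G big_filter sumEFin lee_fin.
apply: ler_sum => i Di; apply: ler_wpM2l => //.
by have [+ _] := hP i Di => /(_ w); rewrite lee_fin.
Qed.

End conditioning.

Lemma big_codom_inj (V : Type) (idx : V) (op : Monoid.com_law idx) (I J : finType)
    (i : I -> J) (F : J -> V) : injective i ->
  \big[op/idx]_(j in codom i) F j = \big[op/idx]_l F (i l).
Proof.
move=> inj; rewrite -big_uniq; last by rewrite map_inj_uniq // enum_uniq.
by rewrite big_image.
Qed.

(** * The law of the points on a facet, given which points lie there *)

Section conditional_law.
Context {R : realType} {n d : nat} {disp : measure_display} {T : measurableType disp}.
Variables (Pr : probability T R) (N : nat).
Variable X : 'I_N -> {RV Pr >-> borel_rV R n}.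
Variable L : probability (borel_rV R n) R.
Hypothesis indepX : independent_rv X.
Hypothesis lawX : forall i (B : set (borel_rV R n)), measurable B ->
  Pr (X i @^-1` B) = L B.
Variables (F : set (borel_rV R n)) (psi : borel_rV R n -> borel_rV R d).
Hypothesis mF : measurable F.
Hypothesis mpsi : measurable_fun [set: borel_rV R n] psi.
Variable Q : set 'rV[R]_d.
Hypothesis lawF : forall B : set (borel_rV R d), measurable B ->
  L (F `&` psi @^-1` B) = (L F * (lebesgue_rV (Q `&` B) / lebesgue_rV Q))%E.

Let q (B : set (borel_rV R n)) : R := fine (L B).
Let qE B : measurable B -> L B = (q B)%:E.
Proof. by move=> mB; rewrite fineK // fin_num_measure. Qed.

Section subsample.
Variables (m : nat) (i : 'I_m -> 'I_N).
Hypothesis inj : injective i.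

(** Stated for a family of indices, not for a set, since the conditioned sample is to be indexed by
    ['I_m]. *)
Definition inside_exactly : set T :=
  \bigcap_(j in setT) (X j @^-1` (if j \in codom i then F else ~` F)).

Lemma measurable_inside_exactly : measurable inside_exactly.
Proof.
apply: fin_bigcap_measurable; first exact: finite_finset.
by move=> j _; apply: measurable_rv; case: ifP => // _; exact: measurableC.
Qed.

Lemma proba_inside_exactly (B : 'I_m -> set (borel_rV R n)) : (forall l, measurable (B l)) ->
  Pr (inside_exactly `&` \bigcap_(l in setT) (X (i l) @^-1` B l)) =
  ((\prod_l q (F `&` B l)) * q (~` F) ^+ (N - m))%:E.
Proof.
move=> mB; pose D j : set (borel_rV R n) :=
  if [pick l | i l == j] is Some l then F `&` B l else ~` F.
have mD j : measurable (D j).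
  by rewrite /D; case: pickP => [l _|_]; [exact: measurableI|exact: measurableC].
have Di l : D (i l) = F `&` B l.
  by rewrite /D; case: pickP => [l' /eqP/inj -> //|/(_ l)]; rewrite eqxx.
have Dn j : j \notin codom i -> D j = ~` F.
  by rewrite /D; case: pickP => // l /eqP <-; rewrite codom_f.
have -> : inside_exactly `&` \bigcap_(l in setT) (X (i l) @^-1` B l) =
    \bigcap_j (X j @^-1` D j).
  apply/seteqP; split=> [w [wE wB] j _ /=|w wD].
    have := wE j I; rewrite /=; case: ifPn => [/codomP[l ->] Fw|ji nFw]; last by rewrite Dn.
    by rewrite Di; split=> //; exact: wB.
  split=> [j _ /=|l _ /=].
    case: ifPn => [/codomP[l ->]|ji]; last by have := wD j I; rewrite /= Dn.
    by have := wD (i l) I; rewrite /= Di => -[].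
  by have := wD (i l) I; rewrite /= Di => -[].
rewrite (indepX mD) (eq_bigr (fun j => (q (D j))%:E)) => [|j _]; last first.
  by rewrite lawX // qE.
rewrite prodEFin; congr (_%:E).
rewrite (bigID (mem (codom i))) /= big_codom_inj //; congr (_ * _).
  by apply: eq_bigr => l _; rewrite Di.
rewrite (eq_bigr (fun=> q (~` F))) => [|j ji]; last by rewrite Dn.
rewrite prodr_const; congr (_ ^+ _).
have := cardC (mem (codom i)); rewrite card_codom // card_ord [X in _ = X -> _]card_ord.
by move=> /(canRL (addKn _)).
Qed.

Lemma proba_inside_exactlyT :
  Pr inside_exactly = (q F ^+ m * q (~` F) ^+ (N - m))%:E.
Proof.
have := @proba_inside_exactly (fun=> setT) (fun=> measurableT).
rewrite (_ : \bigcap_(l in _) _ = setT) ?setIT; last by apply/seteqP; split.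
move=> ->; congr (_%:E); congr (_ * _); rewrite -[m in RHS]card_ord -prodr_const.
by apply: eq_bigr => l _; congr q; exact: setIT.
Qed.

Definition cond_sample (l : 'I_m) :
    {RV (cond_proba Pr measurable_inside_exactly) >-> borel_rV R d} :=
  mk_mfun (measurableT_comp mpsi (measurable_funPT (X (i l)))).

(** Numerator and denominator share the factor of the points outside [F]; what remains is a product
    over the points inside, which gives independence and the law together. *)
Lemma iid_cond_sample : (0 < Pr inside_exactly)%E ->
  iid_uniform lebesgue_rV Q cond_sample.
Proof.
move=> E0.
have e0 : q F ^+ m * q (~` F) ^+ (N - m) != 0.
  by move: E0; rewrite proba_inside_exactlyT lte_fin => /lt0r_neq0.
(* For the empty sample [q F] may be 0, but then there is no index to speak about. *)
have [f0 g0] : (m == 0%N) || (q F != 0) /\ q (~` F) ^+ (N - m) != 0.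
  move: e0; rewrite mulf_eq0 negb_or => /andP[]; rewrite expf_eq0 negb_and.
  by rewrite lt0n negbK.
have H (B : 'I_m -> set (borel_rV R d)) : (forall l, measurable (B l)) ->
    cond_proba Pr measurable_inside_exactly (\bigcap_l (cond_sample l @^-1` B l)) =
    (\prod_l (q (F `&` psi @^-1` B l) / q F))%:E.
  move=> mB; rewrite cond_probaE // setIC.
  rewrite [X in (X * _)%E](_ : _ = Pr (inside_exactly `&`
    \bigcap_(l in setT) (X (i l) @^-1` (psi @^-1` B l)))) //.
  have mB' l : measurable (psi @^-1` B l).
    by rewrite -[X in measurable X]setTI; exact: mpsi.
  rewrite (proba_inside_exactly mB') proba_inside_exactlyT -EFinM; congr (_%:E).
  rewrite /= big_split /= prodr_const card_ord exprVn invfM.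
  by rewrite mulrACA divff // mulr1.
have H1 l (B : set (borel_rV R d)) : measurable B ->
    cond_proba Pr measurable_inside_exactly (cond_sample l @^-1` B) =
    (q (F `&` psi @^-1` B) / q F)%:E.
  move=> mB; pose B' l' := if l' == l then B else setT.
  have mB' l' : measurable (B' l') by rewrite /B'; case: ifP => // _; exact: measurableT.
  have -> : cond_sample l @^-1` B = \bigcap_l' (cond_sample l' @^-1` B' l').
    apply/seteqP; split=> [w wB l' _ /=|w /(_ l I) /=]; last by rewrite /B' eqxx.
    by rewrite /B'; case: eqP => [->|].
  rewrite H // (bigD1 l) //= big1 => [|l' ll']; rewrite /B' ?eqxx ?mulr1 //.
  rewrite (negbTE ll') preimage_setT setIT divff //.
  by case/orP: f0 => // /eqP m0; case: (l) => ?; rewrite m0.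
split=> [B mB|l B mB].
  by rewrite H // -prodEFin; apply: eq_bigr => l _; rewrite H1.
have qF : q F != 0 by case/orP: f0 => // /eqP m0; case: (l) => ?; rewrite m0.
have mpre : measurable (F `&` psi @^-1` B).
  by apply: measurableI => //; rewrite -[X in measurable X]setTI; exact: mpsi.
rewrite [LHS]H1 // mulrC EFinM -qE // lawF // [L F]qE // muleA -EFinM.
by rewrite mulVf // mul1e.
Qed.

End subsample.

End conditional_law.

Section uniform_lower_bound.
Context {R : realType} {n k : nat}.
Variable c : nat -> nat -> R.
Hypothesis c_spec : face_constants c.
Variables (disp : nat -> measure_display) (T : forall N, measurableType (disp N)).
Variables (Pr : forall N, probability (T N) R).
Variable X : forall N, 'I_N -> {RV (Pr N) >-> borel_rV R n}.
Variable L : probability (borel_rV R n) R.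
Hypothesis indepX : forall N, independent_rv (@X N).
Hypothesis lawX : forall N i (B : set (borel_rV R n)), measurable B ->
  Pr N (@X N i @^-1` B) = L B.
Variables (F : set (borel_rV R n)) (psi : borel_rV R n -> borel_rV R k.+1).
Hypothesis mF : measurable F.
Hypothesis mpsi : measurable_fun [set: borel_rV R n] psi.
Variable Q : set 'rV[R]_k.+1.
Hypothesis lawF : forall B : set (borel_rV R k.+1), measurable B ->
  L (F `&` psi @^-1` B) = (L F * (lebesgue_rV (Q `&` B) / lebesgue_rV Q))%E.
Hypothesis polyQ : is_polytope Q.
Hypothesis dimQ : has_dim Q k.+1.
Hypothesis F_gt0 : (0 < L F)%E.
Hypothesis F_lt1 : (L F < 1)%E.
Hypothesis cQ : 0 < c k.+1 k * (nflags Q)%:R.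

Lemma inside_exactly_gt0 N m (i : 'I_m -> 'I_N) : injective i ->
  (0 < Pr N (inside_exactly (@X N) F i))%E.
Proof.
move=> inj; rewrite (proba_inside_exactlyT (@indepX N) (@lawX N) mF inj) lte_fin.
have Lfin := fin_num_measure L F mF.
rewrite mulr_gt0 // exprn_gt0 // -lte_fin fineK ?fin_num_measure //; last exact: measurableC.
by rewrite probability_setC // -(fineK Lfin) -EFinB lte_fin subr_gt0 -lte_fin fineK.
Qed.

(* The bound is uniform in the total number of points and in the indices of the
   points of [F]: otherwise the bad samples, one for every size, would
   contradict [c_spec]. *)
Lemma uniform_lower_bound (eps : R) : 0 < eps -> \forall m \near \oo,
  forall N (i : 'I_m -> 'I_N), injective i ->
  ((c k.+1 k * (nflags Q)%:R * ln (m%:R : R) ^+ k * (1 - eps))%:E <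
    expected_nfaces (cond_sample (@X N) mF mpsi i) k)%E.
Proof.
move=> eps0.
pose bad m (N : nat) (i : 'I_m -> 'I_N) := injective i /\
  ~ ((c k.+1 k * (nflags Q)%:R * ln (m%:R : R) ^+ k * (1 - eps))%:E <
    expected_nfaces (cond_sample (@X N) mF mpsi i) k)%E.
(* One sample for each size: a bad one if there is any, and otherwise all of [m] points, so that the
   sequence is always defined. *)
have H m : exists s : {N : nat & 'I_m -> 'I_N}, injective (projT2 s) /\
    ((exists (N : nat) (i : 'I_m -> 'I_N), bad m N i) -> bad m (projT1 s) (projT2 s)).
  have [[N [i Bi]]|nB] := pselect (exists (N : nat) (i : 'I_m -> 'I_N), bad m N i).
    by exists (existT _ N i); split=> //; case: Bi.
  by exists (existT _ m id); split.
pose s m := sval (cid (H m)).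
have sP m : injective (projT2 (s m)) /\
    ((exists (N : nat) (i : 'I_m -> 'I_N), bad m N i) -> bad m (projT1 (s m)) (projT2 (s m))).
  by rewrite /s; case: cid.
have := @c_spec k.+1 k (ltn0Sn _) (ltnSn _) Q polyQ dimQ (fun m => disp (projT1 (s m)))
  (fun m => T (projT1 (s m))) _ (fun m => cond_sample (@X (projT1 (s m))) mF mpsi (projT2 (s m))).
case=> [m|e [e0 eE]].
  apply: (iid_cond_sample (@indepX _) (@lawX _)) => //; first by case: (sP m).
  by apply: inside_exactly_gt0; case: (sP m).
have e_eps : \forall m \near \oo, `|e m| < eps.
  by move/cvgrPdist_lt: e0 => /(_ _ eps0); apply: filterS => m; rewrite sub0r normrN.
near=> m.
have m2 : (2 <= m)%N by near: m; exact: nbhs_infty_ge.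
have lnm : 0 < ln (m%:R : R) by rewrite ln_gt0 // ltr1n.
have EE : expected_nfaces (cond_sample (@X (projT1 (s m))) mF mpsi (projT2 (s m))) k =
  (c k.+1 k * (nflags Q)%:R * ln (m%:R : R) ^+ (k.+1 - 1) * (1 + e m))%:E by near: m.
have em : `|e m| < eps by near: m.
move=> N i inj; apply: contrapT => nlt.
have [] : bad m (projT1 (s m)) (projT2 (s m)).
  by case: (sP m) => _; apply; exists N, i.
move=> _; apply; rewrite EE subn1 lte_fin ltr_pM2l; last first.
  by rewrite mulr_gt0 // exprn_gt0.
by move: em; rewrite ltr_norml => /andP[em _]; rewrite ltrD2l.
Unshelve. all: by end_near. Qed.

End uniform_lower_bound.

(** * Binomial tails *)

Section binomial_tail.
Context {R : realType}.

Lemma sum_subsets (N : nat) (x y : R) :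
  \sum_(I : {set 'I_N}) x ^+ #|I| * y ^+ (N - #|I|) = (x + y) ^+ N.
Proof.
rewrite -[N in RHS]card_ord -prodr_const bigA_distr /=; apply: eq_bigr => I _.
rewrite [RHS](bigID (mem I)) /=; congr (_ * _).
  by rewrite (eq_bigr (fun=> x)) => [|i ->] //; rewrite prodr_const.
rewrite (eq_bigr (fun=> y)) => [|i /negbTE ->] //; rewrite prodr_const; congr (_ ^+ _).
have := cardC (mem I); rewrite [X in _ = X -> _]card_ord.
by move=> /(canRL (addKn _)).
Qed.

(** The exponential moment bound: for fewer than [K] elements, [p ^+ #|I|] is at most
    [2 ^+ K * (p / 2) ^+ #|I|], and the sum over all subsets is a binomial power. *)
Lemma sum_small_subsets_le (N K : nat) (p : R) : 0 <= p <= 1 ->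
  \sum_(I : {set 'I_N} | (#|I| < K)%N) p ^+ #|I| * (1 - p) ^+ (N - #|I|) <=
    2 ^+ K * (1 - p / 2) ^+ N.
Proof.
move=> /andP[p0 p1]; have q0 : 0 <= 1 - p by rewrite subr_ge0.
have -> : 1 - p / 2 = p / 2 + (1 - p) by lra.
rewrite -(sum_subsets N (p / 2)) mulr_sumr [leRHS](bigID (fun I : {set 'I_N} => (#|I| < K)%N)) /=.
rewrite -[leLHS]addr0; apply: lerD; last first.
  by apply: sumr_ge0 => I _; rewrite !mulr_ge0 ?exprn_ge0 // divr_ge0.
apply: ler_sum => I IK; rewrite mulrA; apply: ler_wpM2r; first exact: exprn_ge0.
rewrite expr_div_n mulrA ler_pdivlMr ?exprn_gt0 // mulrC.
by apply: ler_wpM2r; rewrite ?exprn_ge0 // ler_weXn2l ?ler1n // ltnW.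
Qed.

Lemma bernoulli_le (x : R) k : 0 <= x <= 1 -> 1 - k%:R * x <= (1 - x) ^+ k.
Proof.
move=> /andP[x0 x1]; elim: k => [|k IH]; first by rewrite mul0r subr0 expr0.
have : (1 - x) * (1 - k%:R * x) <= (1 - x) ^+ k.+1.
  by rewrite exprS ler_wpM2l // subr_ge0.
apply: le_trans; rewrite -natr1.
have : 0 <= k%:R * x * x by rewrite !mulr_ge0.
lra.
Qed.

(* A binomial variable of parameters [N] and [p] exceeds a positive fraction of
   [N] with probability tending to 1, and its logarithm is then equivalent to
   [ln N]. *)
Lemma binomial_log (p : R) (M k : nat) (eps : R) : 0 < p < 1 -> 0 < eps < 1 ->
  \forall N \near \oo, (1 - eps) * ln (N%:R : R) ^+ k <=
    \sum_(I : {set 'I_N} | (M <= #|I| < N)%N)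
      p ^+ #|I| * (1 - p) ^+ (N - #|I|) * ln (#|I|%:R : R) ^+ k.
Proof.
move=> /andP[p0 p1] /andP[eps0 eps1].
have q0 : 0 <= 1 - p by rewrite subr_ge0 ltW.
(* Two losses [del] come from the subsets that are too small or full, and [k] from the power of the
   logarithm. *)
pose del := eps / k.+2%:R.
have del0 : 0 < del by rewrite divr_gt0.
have del1 : del < 1 by rewrite ltr_pdivrMr // mul1r (lt_trans eps1) // ltr1n.
have small (x d : R) : 0 <= x < 1 -> 0 < d -> \forall n \near \oo, x ^+ n <= d.
  move=> /andP[x0 x1] d0; have : `|x| < 1 by rewrite ger0_norm.
  move=> /cvg_expr /cvgrPdist_le /(_ _ d0); apply: filterS => n.
  by rewrite sub0r normrN ger0_norm // exprn_ge0.
(* With [K = N %/ L0] the value [1 / 4] beats the factor [2 ^+ K] of the tail bound and leaves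
   [(1 / 2) ^+ K]. *)
have [L0 _ /(_ L0 (leqnn _)) L0P] : \forall n \near \oo, (1 - p / 2) ^+ n <= 1 / 4.
  by apply: small => //; lra.
have L1 : (0 < L0)%N.
  by case: (L0) L0P => //; rewrite expr0; lra.
have [n0 _ n0P] : \forall n \near \oo, (1 / 2 : R) ^+ n <= del by apply: small => //; lra.
near=> N.
have NL : (L0 * (n0 + M + 2) <= N)%N by near: N; exact: nbhs_infty_ge.
have Np : p ^+ N <= del by near: N; apply: small => //; rewrite ltW.
have Nln : expR (ln ((2 * L0)%:R : R) / del) <= N%:R by near: N; exact: nbhs_infty_ger.
pose K := (N %/ L0)%N.
have KM : (n0 + M + 2 <= K)%N by rewrite /K leq_divRL // mulnC.
have NK : (N <= 2 * L0 * K)%N.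
  by rewrite {1}(divn_eq N L0) -/K; have := ltn_pmod N L1; nia.
have K0 : (0 < K)%N by lia.
(* Since [N <= 2 * L0 * K], passing from [N] to [K] costs [ln (2 * L0)], which is at most
   [del * ln N] for large [N]. *)
have lnK : (1 - del) * ln (N%:R : R) <= ln (K%:R : R).
  have : ln (N%:R : R) <= ln ((2 * L0)%:R : R) + ln (K%:R : R).
    by rewrite -lnM ?posrE ?ltr0n ?muln_gt0 // -natrM ler_ln ?posrE ?ltr0n ?muln_gt0 ?ler_nat ?L1 //; lia.
  have : ln ((2 * L0)%:R : R) <= del * ln (N%:R : R).
    rewrite -ler_pdivrMl // mulrC -[leLHS]expRK ler_ln ?posrE ?expR_gt0 // ltr0n; lia.
  by rewrite mulrBl mul1r; lra.
have lnN0 : 0 <= ln (N%:R : R) by rewrite ln_ge0 // ler1n; lia.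
have tail : \sum_(I : {set 'I_N} | (#|I| < K)%N) p ^+ #|I| * (1 - p) ^+ (N - #|I|) <= del.
  apply: le_trans (sum_small_subsets_le _ _ _) _; first by rewrite !ltW.
  apply: (@le_trans _ _ ((1 / 2) ^+ K)); last by apply: n0P => /=; lia.
  apply: (@le_trans _ _ (2 ^+ K * ((1 - p / 2) ^+ L0) ^+ K)).
    apply: ler_wpM2l; first exact: exprn_ge0.
    rewrite -exprM ler_wiXn2l //; [lra|lra|].
    by rewrite mulnC; exact: leq_trunc_div.
  rewrite -exprMn; apply: lerXn2r; rewrite ?nnegrE.
  - by rewrite mulr_ge0 // exprn_ge0 //; lra.
  - lra.
  - by move: L0P; set r := _ ^+ L0; lra.
have total := @sum_subsets N p (1 - p); rewrite [p + _]addrC subrK expr1n in total.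
rewrite (bigID (fun I : {set 'I_N} => (#|I| < K)%N)) /= in total.
rewrite [X in _ + X](bigID (fun I : {set 'I_N} => (#|I| < N)%N)) /= in total.
have full : \sum_(I : {set 'I_N} | ~~ (#|I| < K)%N && ~~ (#|I| < N)%N)
    p ^+ #|I| * (1 - p) ^+ (N - #|I|) <= del.
  apply: le_trans Np; rewrite (bigD1 [set: 'I_N]%SET) /=; last first.
    by rewrite cardsT card_ord ltnn -leqNgt leq_div.
  rewrite big1 ?addr0 => [|I]; first by rewrite cardsT card_ord subnn expr0 mulr1.
  rewrite -!leqNgt => /andP[/andP[_ NI] /negP IT]; case: IT.
  by rewrite eqEcard finset.subsetT cardsT card_ord.
pose mid := \sum_(I : {set 'I_N} | ~~ (#|I| < K)%N && (#|I| < N)%N)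
    p ^+ #|I| * (1 - p) ^+ (N - #|I|).
have midE : 1 - 2 * del <= mid.
  have aux (t m f : R) : t + (m + f) = 1 -> t <= del -> f <= del -> 1 - 2 * del <= m.
    by clear=> *; lra.
  exact: aux total tail full.
clear total tail full.
apply: (@le_trans _ _ (mid * ln (K%:R : R) ^+ k)).
  have b1 : 0 <= 1 - del by rewrite subr_ge0 ltW.
  have : (1 - 2 * del) * ((1 - del) * ln (N%:R : R)) ^+ k <= mid * ln (K%:R : R) ^+ k.
    apply: (@le_trans _ _ (mid * ((1 - del) * ln (N%:R : R)) ^+ k)).
      by apply: ler_wpM2r => //; rewrite exprn_ge0 // mulr_ge0.
    apply: ler_wpM2l.
      by apply: sumr_ge0 => I _; rewrite mulr_ge0 ?exprn_ge0 // ltW.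
    by apply: lerXn2r; rewrite ?nnegrE ?mulr_ge0 // ln_ge0 // ler1n.
  apply: le_trans; rewrite exprMn mulrA; apply: ler_wpM2r; first exact: exprn_ge0.
  have bern : 1 - k%:R * del <= (1 - del) ^+ k by apply: bernoulli_le; rewrite !ltW.
  have epsE : eps = (k%:R + 2) * del by rewrite /del -[k.+2]addn2 natrD mulrC divfK // -natrD pnatr_eq0 addn2.
  have [d2|d2] := lerP (2 * del) 1.
    apply: (@le_trans _ _ ((1 - 2 * del) * (1 - k%:R * del))); last first.
      by apply: ler_wpM2l => //; rewrite subr_ge0.
    have : 0 <= k%:R * del * del by rewrite !mulr_ge0 // ltW.
    by rewrite epsE; lra.
  have : 0 <= k%:R * del by rewrite mulr_ge0 // ltW.
  by rewrite epsE in eps1; lra.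
rewrite mulr_suml; rewrite [leRHS](bigID (fun I : {set 'I_N} => (K <= #|I|)%N)) /=.
rewrite -[leLHS]addr0; apply: lerD; last first.
  apply: sumr_ge0 => I _; rewrite !mulr_ge0 ?exprn_ge0 ?(ltW p0) //.
  by case: (posnP #|I|) => [->|I0]; [rewrite ln0|rewrite ln_ge0 // ler1n].
rewrite (eq_bigl (fun I : {set 'I_N} => (M <= #|I| < N)%N && (K <= #|I|)%N)) => [|I]; last first.
  rewrite -leqNgt; case: (leqP K #|I|) => KI; rewrite ?andbF ?andbT //=.
  by have -> : (M <= #|I|)%N by apply: leq_trans KI; apply: leq_trans KM; lia.
apply: ler_sum => I /andP[_ KI]; apply: ler_wpM2l; first by rewrite mulr_ge0 ?exprn_ge0 ?(ltW p0).
apply: lerXn2r; rewrite ?nnegrE ?ln_ge0 ?ler1n //; first by exact: leq_trans KI.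
by rewrite ler_ln ?posrE ?ltr0n ?ler_nat // (leq_trans K0).
Unshelve. all: by end_near. Qed.

End binomial_tail.

(** * The lower bound *)

Section lower_bound.
Context {R : realType} {k K : nat}.
Variable c : nat -> nat -> R.
Hypothesis c_spec : face_constants c.
Variable p : 'I_K -> 'rV[R]_k.+2.
Variable L : probability (borel_rV R k.+2) R.
Variable M : R.
Let P := hull p [set: 'I_K].
Hypothesis dimP : has_dim P k.+2.
Hypothesis M0 : 0 < M.
Hypothesis LH : forall B : set 'rV[R]_k.+2, measurable (B : set (borel_rV R k.+2)) ->
  (M%:E * L B)%E = hausdorff k.+1 (boundary P `&` B).
Variables (u : facet_type p -> 'rV[R]_k.+2) (a : facet_type p -> R).
Variables (C : facet_type p -> 'M[R]_(k.+2, k.+1)) (b : facet_type p -> 'rV[R]_k.+1).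
Hypothesis spec : forall F, facet_spec L F (u F) (a F) (C F) (b F).
Variables (disp : nat -> measure_display) (T : forall N, measurableType (disp N)).
Variables (Pr : forall N, probability (T N) R).
Variable X : forall N, 'I_N -> {RV (Pr N) >-> borel_rV R k.+2}.
Hypothesis indepX : forall N, independent_rv (@X N).
Hypothesis lawX : forall N i (B : set (borel_rV R k.+2)), measurable B ->
  Pr N (@X N i @^-1` B) = L B.

Let psi F : borel_rV R k.+2 -> borel_rV R k.+1 := affine_map (C F) (b F).
Let fac (F : facet_type p) : set (borel_rV R k.+2) := hull p (val F).
Let Q (F : facet_type p) : set 'rV[R]_k.+1 := psi F @` fac F.
Let prob F : R := fine (L (fac F)).

Let mfac F : measurable (fac F).
Proof. by apply: closed_borel; exact: closed_hull. Qed.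

Let mpsi F : measurable_fun [set: borel_rV R k.+2] (psi F).
Proof. by apply: measurable_borel_continuous; exact: affine_map_continuous. Qed.

Let QE F : Q F = conv_hull ((psi F \o p) @` [set` val F]).
Proof. by rewrite -image_comp -affine_conv_hull. Qed.

Let polyQ F : is_polytope (Q F).
Proof.
exists [seq psi F (p i) | i <- enum (val F)]; rewrite QE; congr conv_hull.
apply/seteqP; split=> [_ [i iF <-]|x /= /mapP[i]].
  by apply/mapP; exists i => //; rewrite mem_enum.
by rewrite mem_enum => iF ->; exists i.
Qed.

Let dimQ F : has_dim (Q F) k.+1.
Proof.
have [_ _ [C' [b' ch]] _ _] := spec F.
by apply: (has_dim_chart ch) => //; exact: dim_facet.
Qed.

Let probE F : L (fac F) = (prob F)%:E.
Proof. by rewrite fineK // fin_num_measure. Qed.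

Let probC F : fine (L (~` fac F)) = 1 - prob F.
Proof. by rewrite probability_setC // probE. Qed.

Let fac_gt0 F : (0 < L (fac F))%E.
Proof. by have [_ _ _ [? _] _] := spec F. Qed.

Let fac_lt1 F : (0 < nflags (Q F))%N -> (L (fac F) < 1)%E.
Proof.
by rewrite QE nflagsE => H; apply: (facet_proba_lt1 dimP spec).
Qed.

Let sample N (I : {set 'I_N}) (F : facet_type p) :=
  cond_sample (@X N) (mfac F) (@mpsi F) (@enum_val 'I_N (mem I)).

(** For each [F] the only event that occurs at [w] is the one with [I = J F], so the double sum
    collapses to the sum of [nfaces_general_position]. *)
Lemma nfaces_hull_ge N w (m : nat) (D : pred (facet_type p)) : (k.+2 <= m)%N ->
  general_position (fun i => @X N i w : 'rV[R]_k.+2) u a C b -> (forall i, P (@X N i w)) ->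
  \sum_(q : facet_type p * {set 'I_N} | D q.1 && (m <= #|q.2| < N)%N)
    \1_(inside_exactly (@X N) (fac q.1) (@enum_val 'I_N (mem q.2))) w *
    (nfaces k (random_hull (@sample N q.2 q.1) w))%:R <=
  (nfaces k.+1 (random_hull (@X N) w))%:R :> R.
Proof.
move=> km gp XP; pose x i : 'rV[R]_k.+2 := @X N i w.
pose J F := tight x [set: 'I_N] (u F) (a F).
have JP F i : (i \in J F) <-> fac F (x i).
  have [_ [FE _] _ _ _] := spec F; rewrite /fac FE !inE /=; split=> [/eqP xi|[_ /eqP] //].
  by split=> //; exact: XP.
have EJ F (I : {set 'I_N}) :
    inside_exactly (@X N) (fac F) (@enum_val 'I_N (mem I)) w <-> I = J F.
  have codI i : (i \in codom (@enum_val 'I_N (mem I))) = (i \in I).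
    apply/codomP/idP => [[l ->]|iI]; first exact: enum_valP.
    by exists (enum_rank_in iI i); rewrite enum_rankK_in.
  split=> [H|-> i _ /=].
    apply/finset.setP => i; have := H i Logic.I; rewrite /= codI.
    case: ifP => iI Fi; first by apply/esym/JP.
    by apply/esym/negP => /JP.
  rewrite (_ : (i \in _) = (i \in J F)); last first.
    apply/codomP/idP => [[l ->]|iI]; first exact: enum_valP.
    by exists (enum_rank_in iI i); rewrite enum_rankK_in.
  by case: ifP => [/JP //|/negP iJ Fi]; apply: iJ; apply/JP.
have nE F : (nfaces k (random_hull (@sample N (J F) F) w)) = #|facesets (psi F \o x) (J F) k|.
  rewrite -nfacesE; congr (nfaces k (conv_hull _)); apply/seteqP; split=> [_ [l _ <-]|_ [i iJ <-]].
    by exists (enum_val l) => //; exact: enum_valP.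
  by exists (enum_rank_in iJ i) => //=; rewrite enum_rankK_in.
have -> : nfaces k.+1 (random_hull (@X N) w) = #|facesets x [set: 'I_N] k.+1|.
  rewrite -nfacesE; congr (nfaces _ (conv_hull _)).
  by apply/seteqP; split=> [_ [l _ <-]|_ [i _ <-]]; [exists l => //=; rewrite inE|exists i].
have := nfaces_general_position gp; rewrite -(ler_nat R); apply: le_trans.
rewrite -(pair_big D (fun I : {set 'I_N} => (m <= #|I| < N)%N) (fun F I =>
  \1_(inside_exactly (@X N) (fac F) (@enum_val 'I_N (mem I))) w *
    (nfaces k (random_hull (@sample N I F) w))%:R)) /=.
rewrite natr_sum big_mkcond [leRHS]big_mkcond /=; apply: ler_sum => F _.
have G0 I : I != J F -> \1_(inside_exactly (@X N) (fac F) (@enum_val 'I_N (mem I))) w *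
    (nfaces k (random_hull (@sample N I F) w))%:R = 0 :> R.
  by move=> IJ; rewrite indicE memNset ?mul0r // => /EJ IE; rewrite IE eqxx in IJ.
have [mJ|mJ] := boolP (m <= #|J F| < N)%N.
  have -> : (k.+2 <= #|J F| < N)%N by case/andP: mJ => mJ ->; rewrite (leq_trans km).
  case: (D F) => //; rewrite (bigD1 (J F)) //= big1 => [|I /andP[_ /G0]] //.
  by rewrite addr0 nE indicE mem_set ?mul1r //; exact/EJ.
rewrite big1 => [|I mI]; first by case: (D F); case: ifP.
by apply: G0; apply: contraNneq mJ => <-.
Qed.

Lemma expected_nfaces_ge (eps : R) : 0 < c k.+1 k -> 0 < eps < 1 -> \forall N \near \oo,
  ((c k.+1 k * (nflags P)%:R * ln (N%:R : R) ^+ k * (1 - eps))%:E <=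
    expected_nfaces (@X N) k.+1)%E.
Proof.
(* One factor [1 - e1] is lost in the face numbers on a facet and one in the binomial average. *)
move=> c0 /andP[eps0 eps1]; pose e1 := eps / 2.
have e10 : 0 < e1 by rewrite divr_gt0.
have e11 : e1 < 1 by rewrite /e1; lra.
have [m1 _ m1P] : \forall m \near \oo, forall F, (0 < nflags (Q F))%N ->
    forall N (i : 'I_m -> 'I_N), injective i ->
    ((c k.+1 k * (nflags (Q F))%:R * ln (m%:R : R) ^+ k * (1 - e1))%:E <
      expected_nfaces (cond_sample (@X N) (mfac F) (@mpsi F) i) k)%E.
  apply: filter_forall => F; have [nf|nf] := posnP (nflags (Q F)); first exact: nearW.
  have [_ _ _ [_ law] _] := spec F.
  have cQ : 0 < c k.+1 k * (nflags (Q F))%:R by rewrite mulr_gt0 // ltr0n.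
  have := uniform_lower_bound c_spec indepX lawX (mfac F) (@mpsi F) law (polyQ F) (dimQ F)
    (fac_gt0 F) (fac_lt1 nf) cQ e10.
  by apply: filterS => m H _.
(* [m1] is the threshold of the uniform bound, [k.+2] that of the pointwise inequality. *)
pose m := maxn m1 k.+2.
have near_bin : \forall N \near \oo, forall F, (0 < nflags (Q F))%N ->
    (1 - e1) * ln (N%:R : R) ^+ k <= \sum_(I : {set 'I_N} | (m <= #|I| < N)%N)
      prob F ^+ #|I| * (1 - prob F) ^+ (N - #|I|) * ln (#|I|%:R : R) ^+ k.
  apply: filter_forall => F; have [nf|nf] := posnP (nflags (Q F)); first exact: nearW.
  have p01 : 0 < prob F < 1.
    by rewrite -!lte_fin -probE fac_gt0 fac_lt1.
  by have := binomial_log m k p01 (introT andP (conj e10 e11)); apply: filterS => N H _.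
near=> N.
have bin F : (0 < nflags (Q F))%N ->
    (1 - e1) * ln (N%:R : R) ^+ k <= \sum_(I : {set 'I_N} | (m <= #|I| < N)%N)
      prob F ^+ #|I| * (1 - prob F) ^+ (N - #|I|) * ln (#|I|%:R : R) ^+ k.
  by move: F; near: N.
have lnN0 : 0 <= ln (N%:R : R).
  by case: (N) => [|N']; [rewrite ln0|rewrite ln_ge0 // ler1n].
pose E (q : facet_type p * {set 'I_N}) :=
  inside_exactly (@X N) (fac q.1) (@enum_val 'I_N (mem q.2)).
pose mE q : measurable (E q) := measurable_inside_exactly (@X N) (mfac q.1) _.
pose D (q : facet_type p * {set 'I_N}) :=
  (0 < nflags (Q q.1))%N && (m <= #|q.2| < N)%N.
pose v (q : facet_type p * {set 'I_N}) : R :=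
  c k.+1 k * (nflags (Q q.1))%:R * ln (#|q.2|%:R : R) ^+ k * (1 - e1).
pose g (q : facet_type p * {set 'I_N}) w : R :=
  (nfaces k (random_hull (@sample N q.2 q.1) w))%:R.
have PrE q : Pr N (E q) =
    (prob q.1 ^+ #|q.2| * (1 - prob q.1) ^+ (N - #|q.2|))%:E.
  rewrite (proba_inside_exactlyT (@indepX N) (@lawX N) (mfac q.1)).
    by rewrite probC.
  exact: enum_val_inj.
apply: (@le_trans _ _ (\sum_(q | D q) Pr N (E q) * (v q)%:E)%E); last first.
  rewrite /expected_nfaces expectation.unlock.
  apply: (@lower_integral_sum _ _ _ (Pr N) _ D E mE v g) => //.
  - move=> q /andP[nf _]; apply: (inside_exactly_gt0 indepX lawX) => //.
    + exact: fac_lt1.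
    + exact: enum_val_inj.
  - move=> q /andP[nf /andP[mq _]].
    have := m1P #|q.2| _ q.1 nf N _ (@enum_val_inj 'I_N (mem q.2)).
    by rewrite /expected_nfaces expectation.unlock; apply => /=; apply: leq_trans mq; exact: leq_maxl.
  have km : (k.+2 <= m)%N by exact: leq_maxr.
  have HH := ae_general_position M0 LH spec (@indepX N) (@lawX N).
  apply: (aeS HH) => w [XP gp].
  exact: (nfaces_hull_ge (fun F => 0 < nflags (Q F))%N km gp XP).
under eq_bigr do rewrite PrE -EFinM.
rewrite sumEFin lee_fin /D -(pair_big (fun F => 0 < nflags (Q F))%N
  (fun I : {set 'I_N} => (m <= #|I| < N)%N) (fun F I =>
  prob F ^+ #|I| * (1 - prob F) ^+ (N - #|I|) * (v (F, I)))) /=.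
apply: (@le_trans _ _ (\sum_(F | (0 < nflags (Q F))%N)
    (c k.+1 k * (nflags (Q F))%:R * (1 - e1)) * ((1 - e1) * ln (N%:R : R) ^+ k))).
  have fl : (nflags P)%:R <= \sum_(F | (0 < nflags (Q F))%N) (nflags (Q F))%:R :> R.
    rewrite -natr_sum ler_nat; apply: leq_trans (chart_flags_le spec) _.
    rewrite [X in (_ <= X)%N]big_mkcond; apply: leq_sum => F _.
    by case: posnP => // ->.
  set A := c k.+1 k; set l := ln (N%:R : R) ^+ k.
  have l0 : 0 <= l by exact: exprn_ge0.
  rewrite (eq_bigr (fun F => (A * (1 - e1) * (1 - e1) * l) * (nflags (Q F))%:R)); last first.
    by move=> F _; ring.
  have b0 : 0 <= 1 - e1 by rewrite subr_ge0 ltW.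
  rewrite -mulr_sumr; apply: (@le_trans _ _ (A * (1 - e1) * (1 - e1) * l * (nflags P)%:R)).
    have -> : A * (1 - e1) * (1 - e1) * l * (nflags P)%:R =
      A * (nflags P)%:R * l * ((1 - e1) * (1 - e1)) by ring.
    apply: ler_wpM2l; first by rewrite !mulr_ge0 // ltW.
    by have : 0 <= e1 * e1 by [rewrite mulr_ge0 // ltW]; rewrite /e1; lra.
  by apply: ler_wpM2l fl; rewrite !mulr_ge0 // ltW.
apply: ler_sum => F nf.
apply: le_trans (ler_wpM2l _ (bin F nf)) _.
  by rewrite !mulr_ge0 ?subr_ge0 // ltW.
by rewrite mulr_sumr; apply: ler_sum => I _; rewrite /v /= le_eqVlt; apply/orP; left; apply/eqP; ring.
Unshelve. all: by end_near. Qed.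

End lower_bound.

(** The relative error is cut off at 0 from above, so only deficits have to tend to 0. An infinite
    [E N] is treated apart because [fine] sends it to 0. *)
Lemma le_one_plus_small (R : realType) (A : nat -> R) (E : nat -> \bar R) :
  (forall N, 0 <= E N)%E -> (\forall N \near \oo, 0 < A N) ->
  (forall eps : R, 0 < eps < 1 -> \forall N \near \oo, ((A N * (1 - eps))%:E <= E N)%E) ->
  exists eps : nat -> R, (eps N @[N --> \oo] --> (0 : R)) /\
    \forall N \near \oo, ((A N * (1 + eps N))%:E <= E N)%E.
Proof.
move=> E0 A0 AE.
exists (fun N => if E N == +oo%E then 0 else Num.min 0 (fine (E N) / A N - 1)); split.
  apply/cvgrPdist_le => eps eps0; pose e := Num.min eps (1 / 2).
  have e01 : 0 < e < 1 by rewrite lt_min gt_min eps0 /=; lra.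
  have ee : e <= eps by rewrite ge_min lexx.
  near=> N; rewrite sub0r normrN; case: eqP => [_|/eqP Ey]; first by rewrite normr0 ltW.
  have AN : 0 < A N by near: N.
  have : ((A N * (1 - e))%:E <= E N)%E by near: N; exact: AE.
  have -> : E N = (fine (E N))%:E by rewrite fineK // ge0_fin_numE // ltey.
  rewrite lee_fin mulrC -ler_pdivlMr // => H.
  rewrite ler0_norm ?ge_min ?lexx // lerNl le_min lerNl oppr0 (ltW eps0) /=.
  by rewrite /=; lra.
near=> N; case: eqP => [->|/eqP Ey]; first by rewrite leey.
have AN : 0 < A N by near: N.
have -> : E N = (fine (E N))%:E by rewrite fineK // ge0_fin_numE // ltey.
rewrite lee_fin mulrC -ler_pdivlMr // -lerBrDl ge_min /=.
by rewrite lexx orbT.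
Unshelve. all: by end_near. Qed.

Theorem mainTheorem5 (R : realType) (c : nat -> nat -> R)
    (c_spec : face_constants c)
    (n : nat) (n_ge2 : (2 <= n)%N)
    (P : set 'rV[R]_n) (polytopeP : is_polytope P) (dimP : has_dim P n)
    (disp : nat -> measure_display)
    (T : forall N : nat, measurableType (disp N))
    (Pr : forall N : nat, probability (T N) R)
    (X : forall N : nat, 'I_N -> {RV (Pr N) >-> borel_rV R n})
    (X_iid : forall N : nat,
       iid_uniform (hausdorff (n - 1)) (boundary P) (X N)) :
  exists eps : nat -> R, (eps N @[N --> \oo] --> (0 : R)) /\
    \forall N \near \oo,
      ((c (n - 1)%N (n - 2)%N * (nflags P)%:R * ln (N%:R : R) ^+ (n - 2)
          * (1 + eps N))%:E
        <= expected_nfaces (X N) (n - 1))%E.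
Proof.
have [k nE] : exists k, n = k.+2 by exists n.-2; lia.
subst n; rewrite ?subSS ?subn0 in X_iid *.
have E0 N : (0 <= expected_nfaces (X N) k.+1)%E.
  by rewrite /expected_nfaces expectation.unlock; apply: integral_ge0 => w _; rewrite lee_fin.
have lnk0 N : 0 <= ln (N%:R : R) ^+ k.
  by apply: exprn_ge0; case: N => [|N]; [rewrite ln0|rewrite ln_ge0 // ler1n].
(* A nonpositive coefficient makes the bound trivial. Otherwise [c k.+1 k] is positive, as dividing
   by it requires. *)
have [cP|cP] := lerP (c k.+1 k * (nflags P)%:R) 0.
  exists (fun=> 0); split; first exact: cvg_cst.
  apply: nearW => N; apply: le_trans (E0 N).
  by rewrite addr0 mulr1 lee_fin mulr_le0_ge0.
have [s PE] := polytopeP.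
pose p (i : 'I_(size s)) := s`_i.
have PH : P = hull p [set: 'I_(size s)]%SET.
  rewrite PE; congr conv_hull; apply/seteqP; split=> [x /= /(nthP 0)[i si <-]|_ [i _ <-]].
    by exists (Ordinal si) => //=; rewrite inE.
  exact: mem_nth.
pose L : probability (borel_rV R k.+2) R := distribution (Pr 1%N) (X 1%N ord0).
pose h := hausdorff k.+1 (boundary P).
have LB B : measurable B -> L B = (hausdorff k.+1 (boundary P `&` B) / h)%E.
  by move=> mB; have [_ /(_ ord0)] := X_iid 1%N; exact.
have h0 : (0 <= h)%E by exact: hausdorff_ge0.
(* The total mass of [L] is the quotient of [h] by itself, which would be 0 if [h] were 0 or
   infinite. *)
have [M M0 hM] : exists2 M : R, 0 < M & h = M%:E.
  have := LB setT measurableT; rewrite setIT -/h probability_setT.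
  case: (h) h0 => [M M0|_|//].
    have [->|Mn0 _] := eqVneq M 0.
      by rewrite mul0e => -[] /eqP; rewrite oner_eq0.
    by exists M => //; rewrite lt_neqAle eq_sym Mn0 -lee_fin.
  by rewrite invey mule0 => -[] /eqP; rewrite oner_eq0.
have LH B : measurable (B : set (borel_rV R k.+2)) ->
    (M%:E * L B)%E = hausdorff k.+1 (boundary P `&` B).
  move=> mB; rewrite LB // hM inver gt_eqF // muleCA -EFinM divff ?mule1 //.
  exact: lt0r_neq0.
have lawX N i (B : set (borel_rV R k.+2)) : measurable B -> Pr N (X N i @^-1` B) = L B.
  by move=> mB; rewrite LB //; have [_ /(_ i)] := X_iid N; exact.
have indepX N : independent_rv (X N) by have [] := X_iid N.
have c0 : 0 < c k.+1 k.
  have : c k.+1 k * (nflags P)%:R != 0 by rewrite gt_eqF.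
  rewrite mulf_eq0 negb_or => /andP[_ nf]; move: cP; rewrite pmulr_lgt0 //.
  by rewrite lt_neqAle eq_sym nf /=.
rewrite PH in dimP LH.
have spec0 (F : facet_type p) : exists D : 'rV[R]_k.+2 * R * 'M[R]_(k.+2, k.+1) * 'rV[R]_k.+1,
    facet_spec L F D.1.1.1 D.1.1.2 D.1.2 D.2.
  by have [u [a [C [b H]]]] := facet_spec_exists dimP M0 LH F; exists (u, a, C, b).
have [D spec] := choice spec0.
apply: le_one_plus_small => // [|eps eps01].
  near=> N; rewrite mulr_gt0 // exprn_gt0 // ln_gt0 // ltr1n.
  by near: N; exact: nbhs_infty_ge.
have := expected_nfaces_ge c_spec dimP M0 LH spec indepX lawX c0 eps01.
by rewrite -PH.
Unshelve. all: by end_near. Qed.
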